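(* The Strong Offensive Alliance problem admits an $\mathcal{O}^{*}(2^{\mathcal{O}(\sqrt{n}\log n)})$-time algorithm when restricted to apex graphs, where $n$ is the number of vertices of the input graph.
   Context: All graphs are finite, simple and undirected. For $S\subseteq V(G)$, $N(S)$ is the open neighbourhood of $S$, $S^c=V(G)\setminus S$, and $d_S(v)$ is the number of neighbours of $v$ in $S$. A non-empty set $S\subseteq V(G)$ is a strong offensive alliance if $d_S(v)\ge d_{S^c}(v)+2$ for every $v\in N(S)$. Strong Offensive Alliance: given a graph $G$ and integer $r\ge 1$, is there a strong offensive alliance $S$ with $1\le |S|\le r$? An apex graph is a graph that can be made planar by deleting a single vertex. The notation $\mathcal{O}^*$ suppresses factors polynomial in the input size. *)

(* Defs.v *)
From HB Require Import structures.
From mathcomp Require Import all_boot all_order all_algebra.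
From mathcomp Require Import all_classical all_reals all_analysis.

Set Implicit Arguments.
Unset Strict Implicit.
Unset Printing Implicit Defensive.

Import Order.TTheory GRing.Theory Num.Theory.
Import numFieldNormedType.Exports.

Local Open Scope classical_set_scope.
Local Open Scope ring_scope.

Record sgraph (V : finType) := SGraph {
  adj :> rel V;
  adj_sym : symmetric adj;
  adj_irrefl : irreflexive adj }.

Section Alliance.
Variables (V : finType) (G : sgraph V).
Implicit Types (S : {set V}) (v : V).

(* Vertices of S are excluded: N(S) = N[S] \ S. *)
Definition open_nbhd S : {set V} :=
  [set v | (v \notin S) && [exists u in S, G u v]]%SET.

Definition deg_in S v : nat := #|[set u in S | G v u]%SET|.

Definition strong_offensive_alliance S : bool :=
  (S != finset.set0) &&
  [forall v in open_nbhd S, (deg_in (~: S)%SET v + 2 <= deg_in S v)%N].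

Definition has_small_strong_offensive_alliance (r : nat) : bool :=
  [exists S : {set V}, strong_offensive_alliance S && (1 <= #|S| <= r)%N].

End Alliance.

Section VertexDeletion.
Variables (V : finType) (G : sgraph V) (v : V).

Definition del_adj : rel {x : V | x != v} := fun x y => G (val x) (val y).

Lemma del_adj_sym : symmetric del_adj.
Proof. by move=> x y; apply: adj_sym. Qed.

Lemma del_adj_irrefl : irreflexive del_adj.
Proof. by move=> x; apply: adj_irrefl. Qed.

Definition del_vertex : sgraph {x : V | x != v} :=
  SGraph del_adj_sym del_adj_irrefl.

End VertexDeletion.

Section Planarity.
Variable R : realType.

Definition is_arc (p q : R * R) (A : set (R * R)) : Prop :=
  exists f : R -> R * R,
    [/\ {within `[0, 1]%classic, continuous f},
        {in `[0, 1] &, injective f},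
        f 0 = p, f 1 = q & A = f @` `[0, 1]%classic].

Definition edges (V : finType) (G : sgraph V) : {set {set V}} :=
  [set [set uv.1; uv.2] | uv : V * V & G uv.1 uv.2]%SET.

(* A drawing in the plane: [pos] places the vertices, and [draw e] is the
   curve representing the edge [e], an unordered pair of vertices. *)
Definition plane_drawing (V : finType) (G : sgraph V)
    (pos : V -> R * R) (draw : {set V} -> set (R * R)) : Prop :=
  [/\ injective pos,
      forall u v, G u v -> is_arc (pos u) (pos v) (draw [set u; v]%SET),
      forall e w, e \in edges G -> draw e (pos w) -> w \in e
    & forall e f, e \in edges G -> f \in edges G -> e != f ->
        draw e `&` draw f `<=` pos @` [set` (e :&: f)%SET]].

Definition planar (V : finType) (G : sgraph V) : Prop :=
  exists pos draw, @plane_drawing V G pos draw.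

Definition apex (V : finType) (G : sgraph V) : Prop :=
  exists v : V, planar (del_vertex G v).

End Planarity.

(* Random access machine with unbounded natural-number registers, all
   initially 0, and a read-only, randomly accessible input sequence.  Every
   instruction costs one step.  There is no multiplication: register lengths
   grow by at most one bit per step, so this unit cost measure is polynomially
   related to Turing machine time. *)
Inductive instr :=
| Const (d k : nat)      (* R[d] := k *)
| Add (d a b : nat)      (* R[d] := R[a] + R[b] *)
| Sub (d a b : nat)      (* R[d] := R[a] - R[b], truncated at 0 *)
| Input (d a : nat)      (* R[d] := input[R[a]], or 0 past the end *)
| Read (d a : nat)       (* R[d] := R[R[a]] *)
| Write (a b : nat)      (* R[R[a]] := R[b] *)
| JumpZ (a l : nat).     (* if R[a] = 0 then jump to instruction l *)

Definition program := seq instr.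

Record config := Config { pc : nat; regs : nat -> nat }.

Definition set_reg (m : nat -> nat) (d k : nat) : nat -> nat :=
  fun i => if i == d then k else m i.

Definition exec (x : seq nat) (i : instr) (s : config) : config :=
  let m := regs s in
  let next := (pc s).+1 in
  match i with
  | Const d k => Config next (set_reg m d k)
  | Add d a b => Config next (set_reg m d (m a + m b)%N)
  | Sub d a b => Config next (set_reg m d (m a - m b)%N)
  | Input d a => Config next (set_reg m d (nth 0%N x (m a)))
  | Read d a => Config next (set_reg m d (m (m a)))
  | Write a b => Config next (set_reg m (m a) (m b))
  | JumpZ a l => Config (if m a == 0%N then l else next) m
  end.

Definition step (P : program) (x : seq nat) (s : config) : config :=
  if onth P (pc s) is Some i then exec x i s else s.

(* [P] halts by leaving its code; its answer is then read in register 0. *)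
Definition answers_within (P : program) (x : seq nat) (t : nat) (b : bool) :
    Prop :=
  let s := iter t (step P x) (Config 0 (fun=> 0%N)) in
  (size P <= pc s)%N /\ regs s 0%N = b.

(* The instance (G, r): n, r, then the adjacency matrix row by row. *)
Definition encode (n : nat) (G : sgraph 'I_n) (r : nat) : seq nat :=
  [:: n, r & [seq nat_of_bool (G i j) | i <- enum 'I_n, j <- enum 'I_n]].

(* Total number of bits of the binary notations of the entries. *)
Definition input_size (x : seq nat) : nat :=
  (\sum_(a <- x) (trunc_log 2 a).+1)%N.

(* Main.v *)
(* Every set of at most q ^ 2 vertices of a graph without K_5 minor is cut in half
   by 10 q + O(1) of its vertices: following Alon, Seymour and Thomas, one maintains a
   connected set B with more than half of the vertices together with a model of K_k
   covering its boundary, and either shrinks B or enlarges the model.  A plane graph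
   has no K_5 minor, because after replacing arcs by nearby polygonal lines, counting
   modulo 2 the edges above each vertex gives a contradiction.

   Removing such separators recursively, each of them found by exhaustive search,
   orders the vertices so that every prefix of the order has only O(sqrt n) vertices
   with a neighbour outside of the prefix.  Along this order, dynamic programming
   needs only the size of a partial alliance S and, for each of these frontier
   vertices u, whether u is in S and the number of its neighbours in S; the condition
   on u is checked as soon as all neighbours of u are placed.  Hence at most
   n ^ O(sqrt n) different records occur. *)

Require Import Defs.
From HB Require Import structures.
From mathcomp Require Import all_boot all_order all_algebra.
From mathcomp Require Import all_classical all_reals all_analysis.
From mathcomp Require Import ring lra zify.

Set Implicit Arguments.
Unset Strict Implicit.
Unset Printing Implicit Defensive.

Import Order.TTheory GRing.Theory Num.Theory.
Import numFieldNormedType.Exports.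

Local Open Scope ring_scope.

(** * Plane drawings and K_5 *)

(** Planarity is given by continuous arcs alone, so whatever is extracted from it must survive
    approximation. That edges without a common end are disjoint does survive, by compactness, and
    the parity count rests on this fact only.

    The hypothesis on the graph reaches the algorithm only through the existence of separators. The
    program receives neither a drawing nor the apex vertex, and it computes no bound on the size of
    a separator: it counts upwards in base n + 1, the digits naming vertices. A halving set of k
    vertices is spelled by k low digits, so the search ends within (n + 1)^k rounds, and its first
    success also removes at most k vertices. The apex vertex is just one more member of the
    separator, whence the O(1).

    A block that is cut is finished before any older block is resumed, and different blocks are not
    adjacent. So the frontier is contained in the separators of the enclosing blocks. Their sizes
    form a geometric series, because each block has at most half of the vertices of the one around
    it. *)

Section SegmentParity.
Variable R : realFieldType.
Implicit Types p a b c d : R * R.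

Definition orient a b p : R :=
  (b.1 - a.1) * (p.2 - a.2) - (b.2 - a.2) * (p.1 - a.1).

Definition between a b p : bool := (a.1 < p.1) (+) (b.1 < p.1).

Definition below a b p : bool :=
  if a.1 < b.1 then orient a b p < 0 else orient b a p < 0.

(* The vertical upward ray from p meets the segment ab. *)
Definition under a b p : bool := between a b p && below a b p.

Ltac xor_cases :=
  repeat match goal with
    | |- context [@Order.lt ?d ?T ?x ?y] => generalize (@Order.lt d T x y)
    | |- context [under ?a ?b ?c] => generalize (under a b c)
    end;
  clear; do !case=> //.

Definition seg_disjoint a b c d : Prop :=
  forall u t : R, 0 <= u <= 1 -> 0 <= t <= 1 ->
    ~ (a.1 + u * (b.1 - a.1) = c.1 + t * (d.1 - c.1) /\
       a.2 + u * (b.2 - a.2) = c.2 + t * (d.2 - c.2)).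

Lemma seg_disjointC a b c d : seg_disjoint a b c d -> seg_disjoint c d a b.
Proof. by move=> H u t Hu Ht [e1 e2]; apply: (H t u Ht Hu). Qed.

Lemma seg_disjoint_revl a b c d : seg_disjoint a b c d -> seg_disjoint b a c d.
Proof.
move=> H u t Hu Ht [e1 e2]; apply: (H (1 - u) t) => //; first by lra.
by split; [rewrite -e1|rewrite -e2]; ring.
Qed.

Lemma under_revl a b p : a.1 != b.1 -> under b a p = under a b p.
Proof.
rewrite /under /between /below => ne; rewrite addbC; congr (_ && _).
by case: (ltgtP a.1 b.1) ne.
Qed.

(** [orient a b] is affine in its last argument, so the last equation puts the point of [cd] with
    parameter [t] on the line [ab]; its abscissa then puts it on the segment. *)
Lemma collinear_on_segment a b c d t : a.1 < b.1 -> 0 <= t <= 1 ->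
  a.1 <= c.1 + t * (d.1 - c.1) <= b.1 ->
  orient a b c + t * (orient a b d - orient a b c) = 0 ->
  ~ seg_disjoint a b c d.
Proof.
move=> ab ht hq ho /(_ ((c.1 + t * (d.1 - c.1) - a.1) / (b.1 - a.1)) t).
have nz : b.1 - a.1 != 0 by rewrite subr_eq0 gt_eqF.
case=> //.
  by rewrite divr_ge0 ?ler_pdivrMr ?subr_gt0 ?subr_ge0 //; lra.
split; first by field.
have -> : (c.1 + t * (d.1 - c.1) - a.1) / (b.1 - a.1) * (b.2 - a.2) =
  ((b.2 - a.2) * (c.1 + t * (d.1 - c.1) - a.1)) / (b.1 - a.1) by field.
move: ho; rewrite /orient => ho.
have -> : (b.2 - a.2) * (c.1 + t * (d.1 - c.1) - a.1) =
   (b.1 - a.1) * (c.2 + t * (d.2 - c.2) - a.2) by apply/eqP; rewrite -subr_eq0; apply/eqP; lra.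
by field.
Qed.

(** If [c] and [d] lay on different sides of [ab], the zero of the affine function [orient a b]
    along [cd] would be a common point. *)
Lemma nested_parity a b c d : a.1 < c.1 -> c.1 <= d.1 -> d.1 < b.1 ->
  seg_disjoint a b c d -> (orient a b c < 0) = (orient a b d < 0).
Proof.
move=> ac cd db dis.
have ab : a.1 < b.1 by lra.
have key : forall c' d' : R * R, a.1 < c'.1 < b.1 -> a.1 < d'.1 < b.1 ->
    seg_disjoint a b c' d' -> orient a b c' < 0 -> orient a b d' < 0.
  move=> c' d' hc hd dis' oc; rewrite ltNge; apply/negP => od.
  set o1 := orient a b c' in oc *; set o2 := orient a b d' in od *.
  have h : 0 < o2 - o1 by lra.
  have ht : 0 <= - o1 / (o2 - o1) <= 1.
    by rewrite divr_ge0 ?ler_pdivrMr //=; lra.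
  apply: (@collinear_on_segment a b c' d' (- o1 / (o2 - o1))) => //.
  - by nra.
  - by rewrite -/o1 -/o2; field; rewrite gt_eqF.
apply/idP/idP; apply: key => //; try by lra.
by apply/seg_disjointC/seg_disjoint_revl/seg_disjointC.
Qed.

(** Over the abscissas common to both segments their vertical order cannot change. At the left end
    it is read off from [c] and [ab], at the right end from [b] and [cd]. *)
Lemma overlap_parity a b c d : a.1 < c.1 -> c.1 < b.1 -> b.1 < d.1 ->
  seg_disjoint a b c d -> (orient a b c < 0) = ~~ (orient c d b < 0).
Proof.
move=> ac cb bd dis.
have ab : a.1 < b.1 by lra.
have cd : c.1 < d.1 by lra.
set o1 := orient a b c; set o4 := orient c d b; set D := orient a b d - o1.
(* Up to positive factors, this evaluates [orient a b] at the point of [cd] on the vertical line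
   through [b], once by interpolation and once from [o4]. *)
have id1 : D * (b.1 - c.1) = - o4 * (b.1 - a.1) - o1 * (d.1 - c.1).
  by rewrite /D /o1 /o4 /orient; ring.
(* The factor [e], 1 or -1, covers both signs at once. *)
have key : forall e : R, e * o1 < 0 -> e * o4 <= 0 -> False.
  move=> e h1 h4.
  have hD : 0 < e * D.
    rewrite -(@pmulr_lgt0 _ (b.1 - c.1)) ?subr_gt0 //.
    by rewrite -mulrA id1; nra.
  have eid : e * D * (b.1 - c.1) = - (e * o4) * (b.1 - a.1) - e * o1 * (d.1 - c.1).
    by rewrite -mulrA id1; ring.
  have ht0 : 0 <= - (e * o1) / (e * D) by rewrite divr_ge0 //; lra.
  have htb : - (e * o1) / (e * D) * (d.1 - c.1) <= b.1 - c.1.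
    by rewrite mulrAC ler_pdivrMr //; nra.
  apply: (@collinear_on_segment a b c d (- (e * o1) / (e * D))) => //.
  - by apply/andP; split=> //; nra.
  - by apply/andP; split; nra.
  - have : e * D != 0 by rewrite gt_eqF.
    by rewrite mulf_eq0 negb_or -/o1 -/D => /andP[e0 D0]; field; rewrite ?e0 ?D0.
have o1n0 : o1 != 0.
  apply/eqP => o10; apply: (@collinear_on_segment a b c d 0) => //; try by lra.
  by rewrite -/o1 o10; ring.
case: (ltP o1 0) => h1; case: (ltP o4 0) => h4 //=; exfalso.
- by apply: (key 1); lra.
- by apply: (key (-1)); first (move: o1n0; rewrite neq_lt => /orP[]); lra.
Qed.

Lemma under_parity_ordered a b c d : a.1 <= b.1 -> c.1 <= d.1 -> a.1 < c.1 ->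
  a.1 != d.1 -> b.1 != c.1 -> b.1 != d.1 -> seg_disjoint a b c d ->
  under c d a (+) under c d b (+) under a b c (+) under a b d =
  (a.1 < c.1) (+) (b.1 < c.1) (+) (a.1 < d.1) (+) (b.1 < d.1).
Proof.
move=> ab cd ac nad nbc nbd dis; rewrite /under /between /below.
have ad : a.1 < d.1 by lra.
rewrite ac ad (lt_gtF ac) (lt_gtF ad) /=.
case: (ltgtP b.1 c.1) nbc => // bc _.
  have bd : b.1 < d.1 by lra.
  by rewrite bd (lt_gtF bd).
have ab' : a.1 < b.1 by lra.
rewrite ab' /=.
case: (ltgtP b.1 d.1) nbd => // bd _ /=.
  have cd' : c.1 < d.1 by lra.
  by rewrite cd' (overlap_parity ac bc bd dis) addbN addbb.
by rewrite (nested_parity ac cd bd dis) addbb.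
Qed.

(** The right side is 1 exactly when the two ranges of abscissas interleave. It is written as four
    comparisons of end points so that, like the left side, it telescopes along polygonal lines. The
    first two hypotheses exclude vertical segments but admit single points. *)
Lemma under_parity a b c d :
  (a.1 = b.1 -> a = b) -> (c.1 = d.1 -> c = d) -> 
  a.1 != c.1 -> a.1 != d.1 -> b.1 != c.1 -> b.1 != d.1 -> seg_disjoint a b c d ->
  under c d a (+) under c d b (+) under a b c (+) under a b d =
  (a.1 < c.1) (+) (b.1 < c.1) (+) (a.1 < d.1) (+) (b.1 < d.1).
Proof.
move=> eab ecd nac nad nbc nbd dis.
have rev p q x : (p.1 = q.1 -> p = q) -> under q p x = under p q x.
  by case: (eqVneq p.1 q.1) => [e /(_ e) ->//|/under_revl ->].
wlog ab : a b eab nac nad nbc nbd dis / a.1 <= b.1.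
  case: (leP a.1 b.1) => [ab /(_ a b)|/ltW ba /(_ b a)]; first exact.
  rewrite !(rev a b) // => H.
  have eba : b.1 = a.1 -> b = a by move=> /esym/eab.
  move: (H eba nbc nbd nac nad (seg_disjoint_revl dis) ba) => {H}.
  xor_cases.
wlog cd : c d ecd nac nad nbc nbd dis / c.1 <= d.1.
  case: (leP c.1 d.1) => [cd /(_ c d)|/ltW dc /(_ d c)]; first exact.
  have edc : d.1 = c.1 -> d = c by move=> /esym/ecd.
  have dis' := seg_disjointC (seg_disjoint_revl (seg_disjointC dis)).
  rewrite !(rev c d) // => /(_ edc nad nac nbd nbc dis' dc).
  xor_cases.
have [ac|ca] : (a.1 < c.1) \/ (c.1 <= a.1) by case: ltP; [left|right].
  exact: under_parity_ordered.
have {}ca : c.1 < a.1 by rewrite lt_neqAle eq_sym nac.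
have flip (x y : R) : x != y -> (y < x) = ~~ (x < y) by case: ltgtP.
have [nca ncb nda ndb] : [/\ c.1 != a.1, c.1 != b.1, d.1 != a.1 & d.1 != b.1].
  by rewrite ![c.1 == _]eq_sym ![d.1 == _]eq_sym.
move: (under_parity_ordered cd ab ca ncb nda ndb (seg_disjointC dis)).
rewrite (flip a.1 c.1) // (flip a.1 d.1) // (flip b.1 c.1) // (flip b.1 d.1) //.
xor_cases.
Qed.

End SegmentParity.

(** The unknown multiple of 2 turns a relation between booleans into a linear equation over the
    integers, as [lia] expects it. *)
Lemma addb_parity (x1 x2 x3 x4 y1 y2 y3 y4 : bool) :
  x1 (+) x2 (+) x3 (+) x4 = y1 (+) y2 (+) y3 (+) y4 ->
  exists m : int, x1%:Z + x2%:Z + x3%:Z + x4%:Z + 2 * m =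
                  y1%:Z + y2%:Z + y3%:Z + y4%:Z.
Proof.
move=> h; exists (((y1 + y2 + y3 + y4)%:Z - (x1 + x2 + x3 + x4)%:Z) %/ 2)%Z.
by case: x1 x2 x3 x4 y1 y2 y3 y4 h => [] [] [] [] [] [] [] [].
Qed.

Lemma addb_cancel (a b c d e f g h i j k l : bool) :
  a (+) b (+) c (+) d = e (+) f (+) g (+) h ->
  i (+) j (+) d (+) k = g (+) h (+) l ->
  (a (+) i) (+) (b (+) j) (+) c (+) k = e (+) f (+) l.
Proof.
move=> h1 h2.
have -> : a = e (+) f (+) g (+) h (+) d (+) c (+) b by rewrite -h1; case: a b c d {h1 h2} => [] [] [] [].
have -> : i = g (+) h (+) l (+) j (+) d (+) k by rewrite -h2; case: i j d k {h1 h2} => [] [] [] [].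
by case: b j c k d g h {h1 h2} => [] [] [] [] [] [] []; case: e f l => [] [] [].
Qed.

(** * Parity of polygonal lines, and K_5 *)

Section Polylines.
Variable R : realFieldType.
Implicit Types (p q a b c d : R * R) (L M : seq (R * R)).

Fixpoint segments a L : seq ((R * R) * (R * R)) :=
  if L is b :: L' then (a, b) :: segments b L' else [::].

Fixpoint under_poly a L p : bool :=
  if L is b :: L' then under a b p (+) under_poly b L' p else false.

Definition poly_disjoint a L c M : Prop :=
  forall e f, e \in segments a L -> f \in segments c M ->
    seg_disjoint e.1 e.2 f.1 f.2.

Lemma segment_poly_parity a b c M :
  {in [:: a, b, c & M] &, injective fst} ->
  a \notin c :: M -> b \notin c :: M -> poly_disjoint a [:: b] c M ->
  under_poly c M a (+) under_poly c M b (+) under a b c (+) under a b (last c M) =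
  (a.1 < c.1) (+) (b.1 < c.1) (+) (a.1 < (last c M).1) (+) (b.1 < (last c M).1).
Proof.
elim: M c => [|d M IH] c inj an bn dis /=.
  by rewrite addbb; do !case: (_ < _).
have {IH} := IH d; have mem : {subset [:: a, b, d & M] <= [:: a, b, c, d & M]}.
  by move=> x; rewrite !inE => /or4P[]->; rewrite ?orbT.
move=> /(_ (sub_in2 mem inj)).
move: (an) (bn); rewrite inE negb_or => /andP[ac ad]; rewrite inE negb_or => /andP[bc bd].
move=> /(_ ad bd) IH.
have {}IH := IH (fun e f he hf => dis e f he (mem_behead (s := _ :: _) hf)).
have ne x y : x \in [:: a, b, c, d & M] -> y \in [:: a, b, c, d & M] ->
    x != y -> x.1 != y.1.
  by move=> hx hy; apply: contraNneq => /(inj _ _ hx hy) ->.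
have ad' : a != d by move: ad; rewrite inE negb_or => /andP[].
have bd' : b != d by move: bd; rewrite inE negb_or => /andP[].
have h1 : under c d a (+) under c d b (+) under a b c (+) under a b d =
    (a.1 < c.1) (+) (b.1 < c.1) (+) (a.1 < d.1) (+) (b.1 < d.1).
  apply: under_parity; rewrite ?ne ?inE ?eqxx ?orbT //.
  - by apply: inj; rewrite !inE eqxx ?orbT.
  - by apply: inj; rewrite !inE eqxx ?orbT.
  - by apply: (dis (a, b) (c, d)); rewrite inE eqxx.
by have := addb_cancel h1 (etrans IH (esym (addbA _ _ _))); rewrite !addbA.
Qed.

(** The comparisons at an inner vertex of [L] occur for two consecutive segments and cancel, and so
    does the term [under_poly c M] at that vertex. *)
Lemma poly_parity a L c M :
  {in (a :: L) ++ (c :: M) &, injective fst} ->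
  {in a :: L, forall p, p \notin c :: M} -> poly_disjoint a L c M ->
  under_poly c M a (+) under_poly c M (last a L) (+)
  under_poly a L c (+) under_poly a L (last c M) =
  (a.1 < c.1) (+) ((last a L).1 < c.1) (+)
  (a.1 < (last c M).1) (+) ((last a L).1 < (last c M).1).
Proof.
elim: L a => [|b L IH] a inj nin dis /=.
  by rewrite addbb /=; do 2!case: (_ < _).
have inj' : {in (b :: L) ++ (c :: M) &, injective fst}.
  by apply: sub_in2 inj => x; rewrite !mem_cat !inE => /orP[->|->]; rewrite ?orbT.
have nin' : {in b :: L, forall p, p \notin c :: M}.
  by move=> p pL; apply: nin; rewrite inE pL orbT.
have dis' : poly_disjoint b L c M.
  by move=> e f he hf; apply: dis => //=; rewrite inE he orbT.
have := IH b inj' nin' dis'.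
have h1 : under_poly c M a (+) under_poly c M b (+) under a b c (+) under a b (last c M) =
  (a.1 < c.1) (+) (b.1 < c.1) (+) (a.1 < (last c M).1) (+) (b.1 < (last c M).1).
  apply: segment_poly_parity.
  - apply: sub_in2 inj => x; rewrite !mem_cat !inE.
    by case/or4P=> ->; rewrite ?orbT.
  - by apply: nin; rewrite inE eqxx.
  - by apply: nin; rewrite !inE eqxx orbT.
  - move=> e f; rewrite inE => /eqP-> hf; apply: (dis (a, b) f) => //=.
    by rewrite inE eqxx.
move: h1; rewrite /=.
set x1 := under_poly c M a; set x2 := under_poly c M b; set x3 := under a b c.
set x4 := under a b _; set x5 := under_poly c M _; set x6 := under_poly b L c.
set x7 := under_poly b L _.
have E : forall y1 y2 y3 y4 y5 y6 : bool,
  x1 (+) x2 (+) x3 (+) x4 = y1 (+) y2 (+) y3 (+) y4 ->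
  x2 (+) x5 (+) x6 (+) x7 = y2 (+) y5 (+) y4 (+) y6 ->
  x1 (+) x5 (+) (x3 (+) x6) (+) (x4 (+) x7) = y1 (+) y5 (+) y3 (+) y6.
  move: x1 x2 x3 x4 x5 x6 x7; clear => x1 x2 x3 x4 x5 x6 x7 y1 y2 y3 y4 y5 y6 h1 h2.
  have -> : x1 = y1 (+) y2 (+) y3 (+) y4 (+) x2 (+) x3 (+) x4.
    by rewrite -h1; case: x1 x2 x3 x4 {h1 h2} => [] [] [] [].
  have -> : x5 = y2 (+) y5 (+) y4 (+) y6 (+) x2 (+) x6 (+) x7.
    by rewrite -h2; case: x5 x2 x6 x7 {h1 h2} => [] [] [] [].
  by case: x2 x3 x4 x6 x7 {h1 h2} => [] [] [] [] []; case: y1 y2 y3 y4 y5 y6 => [] [] [] [] [] [].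
exact: E.
Qed.

End Polylines.

(** Add [poly_parity] over the 15 pairs of disjoint edges of K_5. Each [r k i j] occurs in two of
    them, for the two choices of the fourth vertex. Each pair of vertices is compared in six of
    them, so modulo 2 only the number of comparisons made in decreasing order counts. Four vertices
    contribute one such comparison from the interleaved pairing and two from the nested one, in all
    5 * 3 = 15. Hence an even number would be odd. *)
Lemma no_k5_polylines (R : realFieldType) (p : nat -> R * R)
    (L : nat -> nat -> seq (R * R)) (P : {pred R * R}) :
  {in P &, injective fst} ->
  (forall i j, (i < j < 5)%N ->
     last (p i) (L i j) = p j /\ {subset p i :: L i j <= P}) ->
  (forall i j k l, (i < j < 5)%N -> (k < l < 5)%N -> uniq [:: i; j; k; l] ->
     {in p i :: L i j, forall q, q \notin p k :: L k l} /\ 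
     poly_disjoint (p i) (L i j) (p k) (L k l)) -> False.
Proof.
move=> inj ends dis.
pose o i j := ((p i).1 < (p j).1).
pose r k i j := under_poly (p i) (L i j) (p k).
have key i j k l : (i < j < 5)%N -> (k < l < 5)%N -> uniq [:: i; j; k; l] ->
  exists m : int,
   [/\ (r i k l)%:Z + (r j k l)%:Z + (r k i j)%:Z + (r l i j)%:Z + 2 * m =
       (o i k)%:Z + (o j k)%:Z + (o i l)%:Z + (o j l)%:Z,
       (o i k)%:Z + (o k i)%:Z = 1, (o j k)%:Z + (o k j)%:Z = 1,
       (o i l)%:Z + (o l i)%:Z = 1 & (o j l)%:Z + (o l j)%:Z = 1].
  move=> hij hkl hu.
  have [e1 s1] := ends _ _ hij; have [e2 s2] := ends _ _ hkl.
  have [d1 d2] := dis _ _ _ _ hij hkl hu.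
  have [|m hm] := addb_parity (poly_parity _ d1 d2).
    by apply: sub_in2 inj => x; rewrite mem_cat => /orP[/s1|/s2].
  have flip (q q' : R * R) : q \in p i :: L i j -> q' \in p k :: L k l ->
      (q.1 < q'.1)%R%:Z + (q'.1 < q.1)%R%:Z = 1.
    move=> hq hq'; have : q.1 != q'.1.
      by apply/eqP => /(inj _ _ (s1 _ hq) (s2 _ hq')) eq; move: (d1 _ hq); rewrite eq hq'.
    by case: ltgtP.
  exists m; rewrite /o /r -e1 -e2 hm; split=> //; apply: flip;
    by rewrite ?mem_last ?inE ?eqxx.
have [m1 [h1 f1 f2 f3 f4]] := key 0 1 2 3 isT isT isT.
have [m2 [h2 f5 f6 f7 f8]] := key 0 1 2 4 isT isT isT.
have [m3 [h3 _ _ _ _]] := key 0 1 3 4 isT isT isT.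
have [m4 [h4 f9 _ _ f10]] := key 0 2 1 3 isT isT isT.
have [m5 [h5 _ _ _ f11]] := key 0 2 1 4 isT isT isT.
have [m6 [h6 _ _ _ _]] := key 0 2 3 4 isT isT isT.
have [m7 [h7 _ _ _ _]] := key 0 3 1 2 isT isT isT.
have [m8 [h8 _ _ _ f12]] := key 0 3 1 4 isT isT isT.
have [m9 [h9 _ _ _ _]] := key 0 3 2 4 isT isT isT.
have [m10 [h10 _ _ _ _]] := key 0 4 1 2 isT isT isT.
have [m11 [h11 _ _ _ _]] := key 0 4 1 3 isT isT isT.
have [m12 [h12 _ _ _ _]] := key 0 4 2 3 isT isT isT.
have [m13 [h13 _ _ _ _]] := key 1 2 3 4 isT isT isT.
have [m14 [h14 _ _ _ _]] := key 1 3 2 4 isT isT isT.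
have [m15 [h15 _ _ _ _]] := key 1 4 2 3 isT isT isT.
move: h1 h2 h3 h4 h5 h6 h7 h8 h9 h10 h11 h12 h13 h14 h15.
move: f1 f2 f3 f4 f5 f6 f7 f8 f9 f10 f11 f12; clear.
repeat match goal with
  | |- context [Posz (nat_of_bool ?x)] => generalize (Posz (nat_of_bool x))
end; move=> *; lia.
Qed.

(** * Polygonal approximation of disjoint arcs *)

Section Sampling.
Local Open Scope classical_set_scope.
Variable R : realType.
Implicit Types f g : R -> R * R.

Lemma unit_continuous_eps f x (e : R) : {within `[0, 1], continuous f} ->
  0 <= x <= 1 -> 0 < e ->
  exists2 d : R, 0 < d & forall y, 0 <= y <= 1 -> `|y - x| < d ->
    `|(f y).1 - (f x).1| < e /\ `|(f y).2 - (f x).2| < e.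
Proof.
move=> /subspace_continuousP cf hx e0.
have /= := cf x; rewrite in_itv /= => /(_ hx (ball (f x) e)).
have nb : nbhs (f x) (ball (f x) e) by exact: nbhsx_ballx.
move=> /(_ nb); rewrite /nbhs /= /within /= => /nbhs_ballP[d d0 hd].
exists d => // y hy yx; have := hd y; rewrite /ball /= distrC => /(_ yx).
rewrite in_itv /= => /(_ hy) [/=]; rewrite /ball /=.
by rewrite ![`|(f y).1 - _|]distrC ![`|(f y).2 - _|]distrC.
Qed.

Lemma convex_bounds (a b x y u : R) : a < x < b -> a < y < b -> 0 <= u <= 1 ->
  a < x + u * (y - x) < b.
Proof.
move=> hx hy hu; have [xy|yx] := leP x y.
  have h1 : 0 <= u * (y - x) by rewrite mulr_ge0 //; lra.
  have h2 : u * (y - x) <= y - x by rewrite ler_piMl //; lra.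
  lra.
have h1 : 0 <= u * (x - y) by rewrite mulr_ge0 //; lra.
have h2 : u * (x - y) <= x - y by rewrite ler_piMl //; lra.
lra.
Qed.

(** Near a pair of parameters the two curves differ by at least 2e in one coordinate. If all four
    end points move by less than e in it, the two segments remain on different sides by convexity.
    Compactness of the square of parameters makes N uniform. *)
Lemma near_segments_disjoint f g :
  {within `[0, 1], continuous f} -> {within `[0, 1], continuous g} ->
  (forall s t, 0 <= s <= 1 -> 0 <= t <= 1 -> f s <> g t) ->
  \forall N \near \oo, forall s s' t t' : R,
    0 <= s <= 1 -> 0 <= s' <= 1 -> 0 <= t <= 1 -> 0 <= t' <= 1 ->
    `|s' - s| <= N.+1%:R^-1 -> `|t' - t| <= N.+1%:R^-1 ->
    seg_disjoint (f s) (f s') (g t) (g t').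
Proof.
move=> cf cg fg.
have K : compact (`[0, 1] `*` `[0, 1] : set (R * R)).
  by apply: compact_setX; exact: segment_compact.
have := (compact_near_coveringP _).1 K nat \oo (fun N x => 0 <= x.1 <= 1 ->
   0 <= x.2 <= 1 -> forall s' t', 0 <= s' <= 1 -> 0 <= t' <= 1 ->
  `|s' - x.1| <= N.+1%:R^-1 -> `|t' - x.2| <= N.+1%:R^-1 ->
    seg_disjoint (f x.1) (f s') (g x.2) (g t')) _.
move=> /(_ _) H.
have {}H : \forall N \near \oo, `[0, 1] `*` `[0, 1] `<=` (fun x : R * R => 0 <= x.1 <= 1 ->
   0 <= x.2 <= 1 -> forall s' t', 0 <= s' <= 1 -> 0 <= t' <= 1 ->
  `|s' - x.1| <= N.+1%:R^-1 -> `|t' - x.2| <= N.+1%:R^-1 ->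
    seg_disjoint (f x.1) (f s') (g x.2) (g t')).
  apply: H => -[s0 t0] [/=]; rewrite !in_itv /= => hs ht.
  have [e [e0 he]] : exists e : R, 0 < e /\
      (2 * e <= `|(f s0).1 - (g t0).1| \/ 2 * e <= `|(f s0).2 - (g t0).2|).
    have [e1|n1] := eqVneq (f s0).1 (g t0).1.
      have n2 : (f s0).2 != (g t0).2.
        apply/eqP => e2; apply: (fg s0 t0) => //.
        by case: (f s0) (g t0) e1 e2 => ? ? [? ?] /= -> ->.
      exists (`|(f s0).2 - (g t0).2| / 2); rewrite divr_gt0 ?normr_gt0 ?subr_eq0 //.
      by split=> //; right; rewrite mulrC divfK.
    exists (`|(f s0).1 - (g t0).1| / 2); rewrite divr_gt0 ?normr_gt0 ?subr_eq0 //.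
    by split=> //; left; rewrite mulrC divfK.
  have [d d0 hd] := unit_continuous_eps cf hs e0.
  have [d' d0' hd'] := unit_continuous_eps cg ht e0.
  (* Half of the minimum: [s] is within [m] of [s0] and [s'] is within [m] of [s], so both are
     within [d] of [s0]. *)
  pose m := Num.min d d' / 2.
  have m0 : 0 < m by rewrite divr_gt0 // lt_min d0 d0'.
  exists (ball (s0, t0) m, [set N | N.+1%:R^-1 < m]) => /=.
    split; first exact: nbhsx_ballx.
    exact: (near_infty_natSinv_lt (PosNum m0)).
  move=> [[s t] N] /= [[/= bs bt] hN] h1 h2 s' t' h1' h2' ds dt u v hu hv [E1 E2].
  have {}hN : N.+1%:R^-1 < m := hN.
  have md : m + m <= d /\ m + m <= d' by rewrite /m -splitr !ge_min !lexx ?orbT.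
  move: bs bt; rewrite /ball /= => bs bt.
  have [f1 f2] := hd s h1 ltac:(rewrite distrC; lra).
  have [g1 g2] := hd' t h2 ltac:(rewrite distrC; lra).
  have [f1' f2'] := hd s' h1' ltac:(have := ler_distD s s' s0; rewrite [`|s - s0|]distrC; set q := N.+1%:R^-1 in ds hN *; lra).
  have [g1' g2'] := hd' t' h2' ltac:(have := ler_distD t t' t0; rewrite [`|t - t0|]distrC; set q := N.+1%:R^-1 in dt hN *; lra).
  move: f1 f2 g1 g2 f1' f2' g1' g2'; rewrite !ltr_distl => f1 f2 g1 g2 f1' f2' g1' g2'.
  have := convex_bounds f1 f1' hu; have := convex_bounds f2 f2' hu.
  have := convex_bounds g1 g1' hv; have := convex_bounds g2 g2' hv.
  rewrite E1 E2 => /andP[k1 k2] /andP[k3 k4] /andP[k5 k6] /andP[k7 k8].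
  clear -k1 k2 k3 k4 k5 k6 k7 k8 he; case: he; rewrite leNgt ltr_distl => /negP; apply; apply/andP; split; lra.
apply: filterS H => N H s s' t t' hs hs' ht ht' d1 d2.
by apply: (H (s, t)) => //; split; rewrite /= in_itv.
Qed.

End Sampling.

From mathcomp Require Import fintype finset.

(** * Connected vertex sets and models of K_5 *)

Section Connectivity.
Variables (V : finType) (G : sgraph V).
Implicit Types (A B C : {set V}) (u v w : V).

Definition res A : rel V := fun u v => [&& u \in A, v \in A & G u v].

(** As [connect] is reflexive, [linked A u u] also holds for [u] outside of [A]; this is why later
    lemmas ask for membership of one end. *)
Definition linked A : rel V := connect (res A).

Definition cset A : Prop :=
  A != set0 /\ {in A &, forall u v, linked A u v}.

Lemma res_sym A : symmetric (res A).
Proof. by move=> u v; rewrite /res adj_sym andbCA. Qed.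

Lemma linked_sym A : symmetric (linked A).
Proof. by apply: sym_connect_sym; apply: res_sym. Qed.

Lemma linkedC A u v : linked A u v -> linked A v u.
Proof. by rewrite linked_sym. Qed.

Lemma linked_trans A : transitive (linked A).
Proof. exact: connect_trans. Qed.

Lemma linked1 A u v : u \in A -> v \in A -> G u v -> linked A u v.
Proof. by move=> uA vA uv; apply: connect1; rewrite /res uA vA. Qed.

Lemma linkedS A B u v : A \subset B -> linked A u v -> linked B u v.
Proof.
move=> /subsetP sAB; apply: connect_sub => x y /and3P[xA yA xy].
by apply: linked1 => //; apply: sAB.
Qed.

Lemma linked_closed A B u v :
  {in A &, forall x y, G x y -> x \in B -> y \in B} ->
  linked A u v -> u \in B -> v \in B.
Proof.
move=> cl /connectP[p]; elim: p u => [|w p IH] u /= => [_ ->//|].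
case/andP => /and3P[uA wA uw] pp ev uB; apply: IH pp ev _.
exact: cl uw uB.
Qed.

Lemma linked_in A u v : linked A u v -> u \in A -> v \in A.
Proof. by apply: linked_closed. Qed.

Lemma linked_within A B u v :
  {in A &, forall x y, G x y -> x \in B -> y \in B} ->
  linked A u v -> u \in A -> u \in B -> linked (A :&: B)%SET u v.
Proof.
move=> cl /connectP[p]; elim: p u => [|w p IH] u /= => [_ -> _ _|]; first exact: connect0.
case/andP => /and3P[uA wA uw] pp ev _ uB.
have wB := cl _ _ uA wA uw uB.
apply: linked_trans (IH _ pp ev wA wB).
by apply: linked1 => //; rewrite inE ?uA ?wA.
Qed.

Lemma csetU A B u v : cset A -> cset B -> u \in A -> v \in B ->
  (u == v) || G u v -> cset (A :|: B)%SET.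
Proof.
move=> [A0 cA] [B0 cB] uA vB uv; split.
  by apply/set0Pn; exists u; rewrite inE uA.
have luv : linked (A :|: B)%SET u v.
  case/orP: uv => [/eqP->|uv]; first exact: connect0.
  by apply: linked1; rewrite // inE ?uA ?vB ?orbT.
have lA x y : x \in A -> y \in A -> linked (A :|: B)%SET x y.
  by move=> xA yA; apply: linkedS (cA _ _ xA yA); apply: subsetUl.
have lB x y : x \in B -> y \in B -> linked (A :|: B)%SET x y.
  by move=> xA yA; apply: linkedS (cB _ _ xA yA); apply: subsetUr.
move=> x y; rewrite !inE => /orP[xA|xB] /orP[yA|yB].
- exact: lA.
- exact: linked_trans (linked_trans (lA _ _ xA uA) luv) (lB _ _ vB yB).
- exact: linked_trans (linked_trans (lB _ _ xB vB) (linkedC luv)) (lA _ _ uA yA).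
- exact: lB.
Qed.

Lemma cset_component A u : u \in A -> cset [set v | linked A u v]%SET.
Proof.
move=> uA; split; first by apply/set0Pn; exists u; rewrite inE; apply: connect0.
suff lu v : linked A u v -> linked [set v | linked A u v]%SET u v.
  by move=> x y; rewrite !inE => /lu lx /lu ly; apply: linked_trans (linkedC lx) ly.
move=> luv.
have := @linked_within A [set v | linked A u v]%SET u v.
rewrite !inE => /(_ _ luv uA (connect0 _ _)) H.
apply: linkedS (H _); first exact: subsetIr.
move=> x y xA yA xy; rewrite !inE => lx.
by apply: linked_trans lx (linked1 xA yA xy).
Qed.

Definition k5_model (B : nat -> {set V}) : Prop :=
  [/\ forall i, (i < 5)%N -> cset (B i),
      forall i j, (i < j < 5)%N -> [disjoint B i & B j] &
      forall i j, (i < j < 5)%N -> exists u v, [/\ u \in B i, v \in B j & G u v]].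

End Connectivity.

(** * General position by shearing *)

Section Shear.
Variable R : realFieldType.
Implicit Types (p q : R * R) (L : seq (R * R)).

Definition shear (s : R) p : R * R := (p.1 + s * p.2, p.2).

(** Two points of different ordinates get equal abscissas for a single value of [s], listed in
    [bad]; the chosen [s] exceeds the absolute values of all of them. *)
Lemma generic_shear L : exists s : R,
  {in L &, forall p q, (shear s p).1 = (shear s q).1 -> p = q}.
Proof.
pose bad := [seq (q.1 - p.1) / (p.2 - q.2) | p <- L, q <- L].
exists (1 + \sum_(x <- bad) `|x|) => p q pL qL /= e.
have [e2|n2] := eqVneq p.2 q.2.
  by move: e; rewrite e2 => /addIr e1; case: p q e1 e2 {pL qL} => ? ? [? ?] /= -> ->.
have nz : p.2 - q.2 != 0 by rewrite subr_eq0.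
exfalso; set s := 1 + _ in e.
have es : s = (q.1 - p.1) / (p.2 - q.2).
  by apply: (mulIf nz); rewrite divfK // mulrBr; lra.
have sb : s \in bad by rewrite es; apply/allpairsP; exists (p, q).
have : `|s| <= \sum_(x <- bad) `|x|.
  rewrite (big_rem s) //= lerDl; apply: sumr_ge0 => *; exact: normr_ge0.
by have := ler_norm s; rewrite {1}/s; lra.
Qed.

Lemma segments_shear s p L :
  segments (shear s p) (map (shear s) L) =
  [seq (shear s e.1, shear s e.2) | e <- segments p L].
Proof. by elim: L p => //= q L IH p; rewrite IH. Qed.

Lemma seg_disjoint_shear s (a b c d : R * R) : seg_disjoint a b c d ->
  seg_disjoint (shear s a) (shear s b) (shear s c) (shear s d).
Proof.
move=> dis u t hu ht /= [e1 e2]; apply: (dis u t hu ht); split=> //.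
have : s * (a.2 + u * (b.2 - a.2)) = s * (c.2 + t * (d.2 - c.2)) by rewrite e2.
by lra.
Qed.

(** A shear is linear and injective, so it keeps disjointness while it separates the abscissas. *)
Lemma no_k5_poly (p : nat -> R * R) (L : nat -> nat -> seq (R * R)) :
  (forall i j, (i < j < 5)%N -> last (p i) (L i j) = p j) ->
  (forall i j k l, (i < j < 5)%N -> (k < l < 5)%N -> uniq [:: i; j; k; l] ->
     {in p i :: L i j, forall q, q \notin p k :: L k l} /\
     poly_disjoint (p i) (L i j) (p k) (L k l)) -> False.
Proof.
move=> ends dis.
pose pts := flatten [seq p i :: L i j | i <- iota 0 5, j <- iota 0 5].
have pin i j : (i < j < 5)%N -> {subset p i :: L i j <= pts}.
  move=> /andP[ij j5] q hq; apply/flattenP; exists (p i :: L i j) => //.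
  apply/allpairsP; exists (i, j); rewrite !mem_iota /= !add0n j5.
  by split=> //; apply: ltn_trans ij j5.
have [s hs] := generic_shear pts.
apply: (@no_k5_polylines R (fun i => shear s (p i)) (fun i j => map (shear s) (L i j))
  [in map (shear s) pts]).
- by move=> _ _ /mapP[x hx ->] /mapP[y hy ->] /(hs _ _ hx hy) ->.
- move=> i j hij; rewrite last_map ends //; split=> // x.
  by rewrite -map_cons => /mapP[y /(pin _ _ hij) hy ->]; apply: map_f.
- move=> i j k l hij hkl hu; have [d1 d2] := dis i j k l hij hkl hu; split.
    move=> x; rewrite -!map_cons => /mapP[y hy ->]; apply/mapP => -[z hz e].
    have ey := hs _ _ (pin _ _ hij _ hy) (pin _ _ hkl _ hz) (congr1 fst e).
    by move: (d1 _ hy); rewrite ey hz.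
  move=> e f; rewrite !segments_shear => /mapP[e' he ->] /mapP[f' hf ->].
  by apply/seg_disjoint_shear/d2.
Qed.

End Shear.

(** * Drawing walks of the graph as polygonal lines *)

Section Walks.
Variables (R : realFieldType) (V : eqType) (pos : V -> R * R).
Variable E : V -> V -> seq (R * R).

Fixpoint walk_poly (u : V) (w : seq V) : seq (R * R) :=
  if w is v :: w' then E u v ++ walk_poly v w' else [::].

Lemma segments_cat (a : R * R) L M :
  segments a (L ++ M) = segments a L ++ segments (last a L) M.
Proof. by elim: L a => //= b L IH a; rewrite IH. Qed.

Variable e : rel V.
Hypothesis Elast : forall u v, e u v -> last (pos u) (E u v) = pos v.

Lemma last_walk_poly u w : path e u w ->
  last (pos u) (walk_poly u w) = pos (last u w).
Proof. by elim: w u => //= v w IH u /andP[uv pw]; rewrite last_cat Elast // IH. Qed.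

Lemma segments_walk_poly u w s : path e u w -> s \in segments (pos u) (walk_poly u w) ->
  exists x y, [/\ x \in u :: w, y \in u :: w, e x y & s \in segments (pos x) (E x y)].
Proof.
elim: w u => //= v w IH u /andP[uv pw].
rewrite segments_cat Elast // mem_cat => /orP[hs|/(IH _ pw)[x [y [hx hy xy hs]]]].
  by exists u, v; rewrite !inE !eqxx orbT.
by exists x, y; split=> //; rewrite inE (hx, hy) orbT.
Qed.

(** A trivial walk is excluded because its only point need not belong to any edge. *)
Lemma mem_walk_poly u w q : path e u w -> w != [::] -> q \in pos u :: walk_poly u w ->
  exists x y, [/\ x \in u :: w, y \in u :: w, e x y & q \in pos x :: E x y].
Proof.
elim: w u => //= v w IH u /andP[uv pw] _.
rewrite inE mem_cat orbA -in_cons => /orP[hq|hq].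
  by exists u, v; rewrite !inE !eqxx orbT.
case: w pw IH hq => [|x w] pw IH hq //.
have [|x' [y' [hx hy xy hs]]] := IH v pw isT; first by rewrite inE hq orbT.
by exists x', y'; split=> //; rewrite inE (hx, hy) orbT.
Qed.

End Walks.

Section Sample.
Variables (R : realType) (f : R -> R * R) (N : nat).

Definition grid (i : nat) : R := i%:R / N.+1%:R.

Definition sample : seq (R * R) := [seq f (grid i) | i <- iota 1 N.+1].

Lemma grid_unit i : (i <= N.+1)%N -> 0 <= grid i <= 1.
Proof. by move=> h; rewrite /grid divr_ge0 //= ler_pdivrMr // mul1r ler_nat. Qed.

Lemma grid_step i : `|grid i.+1 - grid i| <= N.+1%:R^-1.
Proof.
rewrite /grid -mulrBl -natrB ?leqnSn // subSnn mul1r ger0_norm //.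
Qed.

Lemma sample_last a : last a sample = f 1.
Proof.
rewrite /sample -[N.+1]addn1 iotaD map_cat last_cat /= /grid add1n.
by rewrite divff ?pnatr_eq0.
Qed.

Lemma mem_sample q : q \in f 0 :: sample -> exists2 s : R, 0 <= s <= 1 & q = f s.
Proof.
rewrite inE => /orP[/eqP->|/mapP[i]]; first by exists 0; rewrite // lexx ler01.
by rewrite mem_iota add1n ltnS => /andP[_ hi] ->; exists (grid i); rewrite ?grid_unit.
Qed.

Lemma segments_sample s : s \in segments (f 0) sample ->
  exists2 i, (i < N.+1)%N & s = (f (grid i), f (grid i.+1)).
Proof.
have -> : f 0 = f (grid 0) by rewrite /grid mul0r.
rewrite /sample; set m := N.+1; suff H k j : (j + k <= m)%N ->
    s \in segments (f (grid j)) [seq f (grid i) | i <- iota j.+1 k] ->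
    exists2 i, (i < m)%N & s = (f (grid i), f (grid i.+1)) by apply: H.
elim: k j => //= k IH j hjk; rewrite inE => /orP[/eqP->|]; last by apply: IH; rewrite addSnnS.
by exists j => //; apply: leq_trans hjk; rewrite addnS ltnS leq_addr.
Qed.

End Sample.

(** Choose a vertex [c i] in each branch set and a walk from [c i] to [c j] inside [B i] and [B j].
    The walks for disjoint pairs of indices use disjoint vertex sets, so no edge of one has a common
    end with an edge of the other, and the sampled drawings of these walks contradict
    [no_k5_poly]. *)
Lemma planar_no_k5 (R : realType) (V : finType) (G : sgraph V) (B : nat -> {set V}) :
  planar R G -> ~ k5_model G B.
Proof.
move=> [pos [draw [posI arcs onv cross]]] [cB dB aB].
(* The drawing attaches an arc to an unordered pair; a parametrisation is chosen separately for each
   of its two orientations. *)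
have [f hf] : {f : V -> V -> R -> R * R & forall u v, G u v ->
    [/\ {within `[0, 1], continuous (f u v)}%classic, f u v 0 = pos u, f u v 1 = pos v &
      draw [set u; v]%SET = [set f u v x | x in `[0, 1]%classic]%classic]}.
  suff H u v : {h : R -> R * R | G u v ->
    [/\ {within `[0, 1], continuous h}%classic, h 0 = pos u, h 1 = pos v &
      draw [set u; v]%SET = [set h x | x in `[0, 1]%classic]%classic]}.
    by exists (fun u v => sval (H u v)) => u v; case: (H u v).
  case: (boolP (G u v)) => [uv|_]; last by exists (fun=> 0).
  have [h [h1 _ h2 h3 h4]] := cid (arcs u v uv).
  by exists h.
have disf u v x y s t : G u v -> G x y -> [disjoint [set u; v] & [set x; y]]%SET ->
    0 <= s <= 1 -> 0 <= t <= 1 -> f u v s <> f x y t.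
  move=> uv xy dis hs ht e.
  have euv : [set u; v]%SET \in edges G by apply/imsetP; exists (u, v); rewrite ?inE.
  have exy : [set x; y]%SET \in edges G by apply/imsetP; exists (x, y); rewrite ?inE.
  have ne : [set u; v]%SET != [set x; y]%SET.
    apply: contraTneq dis => ->; rewrite -setI_eq0 setIid.
    by apply/set0Pn; exists x; rewrite !inE eqxx.
  have [_ _ _ D1] := hf _ _ uv; have [_ _ _ D2] := hf _ _ xy.
  have [] := cross _ _ euv exy ne (f u v s).
    by split; [rewrite D1; exists s|rewrite D2 e; exists t]; rewrite //= in_itv.
  by move=> w /=; rewrite disjoint_setI0 // inE.
(* As there are finitely many quadruples of vertices, one N serves all pairs of disjoint edges. *)
have near_dis : \forall N \near \oo%classic, forall (q : V * V * V * V),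
    let: (u, v, x, y) := q in G u v -> G x y ->
    [disjoint [set u; v] & [set x; y]]%SET ->
    poly_disjoint (pos u) (sample (f u v) N) (pos x) (sample (f x y) N).
  apply: filter_forall => -[[[u v] x] y].
  have [uv|nuv] := boolP (G u v); last exact: nearW.
  have [xy|nxy] := boolP (G x y); last by apply: nearW => N _.
  have [dis|ndis] := boolP [disjoint [set u; v] & [set x; y]]%SET; last first.
    by apply: nearW => N _ _.
  have [c1 p1 _ _] := hf _ _ uv; have [c2 p2 _ _] := hf _ _ xy.
  have nd := near_segments_disjoint c1 c2 (fun s t => disf u v x y s t uv xy dis).
  apply: filterS nd => N H _ _ _.
  move=> s t; rewrite -p1 -p2 => /segments_sample[i hi ->] /segments_sample[j hj ->].
  by apply: H; rewrite ?grid_unit ?grid_step // ltnW.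
have [N hN] := filter_ex near_dis.
pose E u v := sample (f u v) N.
have Elast u v : G u v -> last (pos u) (E u v) = pos v.
  by move=> /hf[_ _ <- _]; rewrite /E sample_last.
have /choice[c hc] : forall i, exists v, (i < 5)%N -> v \in B i.
  move=> i; case: (ltnP i 5) => [/cB[/set0Pn[v vB] _]|_]; first by exists v.
  by have [/set0Pn[v _] _] := cB 0%N isT; exists v.
have /choice[w hw] : forall ij : nat * nat, exists w, (ij.1 < ij.2 < 5)%N ->
   [/\ path G (c ij.1) w, last (c ij.1) w = c ij.2, w != [::] &
       {subset c ij.1 :: w <= (B ij.1 :|: B ij.2)%SET}].
  move=> [i j] /=; case: (boolP (i < j < 5)%N) => [hij|_]; last by exists [::].
  have /andP[ij j5] := hij; have i5 := ltn_trans ij j5.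
  have [u [v [uB vB uv]]] := aB i j hij.
  have [_ cU] := csetU (cB i i5) (cB j j5) uB vB (introT orP (or_intror uv)).
  have ciU : c i \in (B i :|: B j)%SET by rewrite inE hc.
  have := cU (c i) (c j) ciU; rewrite inE (hc j) ?orbT // => /(_ isT)/connectP[w pw ew].
  have disij := dB _ _ hij; exists w => _; split=> //.
  - by apply: sub_path pw => x y /and3P[].
  - apply: contraTneq disij => w0; move: ew; rewrite w0 /= => ec.
    by rewrite disjoint_sym; apply/pred0Pn; exists (c i); rewrite /= -{1}ec !hc.
  - have {ew} : path (res G (B i :|: B j)) (c i) w := pw.
    elim: w (c i) ciU {pw} => [|x w IH] u' hu' /=.
      by move=> _ z; rewrite inE => /eqP->.
    by case/andP => /and3P[_ hx _] /(IH _ hx) sw z; rewrite inE => /orP[/eqP->|/sw].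
have sep i j k l x y x' y' : (i < j < 5)%N -> (k < l < 5)%N -> uniq [:: i; j; k; l] ->
   x \in (B i :|: B j)%SET -> y \in (B i :|: B j)%SET ->
   x' \in (B k :|: B l)%SET -> y' \in (B k :|: B l)%SET ->
   [disjoint [set x; y] & [set x'; y']]%SET.
  move=> hij hkl hu hx hy hx' hy'.
  have dis a b : (a < 5)%N -> (b < 5)%N -> a != b -> [disjoint B a & B b].
    move=> a5 b5; case: (ltngtP a b) => // ab _; first by apply: dB; rewrite ab.
    by rewrite disjoint_sym; apply: dB; rewrite ab.
  have dU : [disjoint B i :|: B j & B k :|: B l]%SET.
    move: hij hkl hu => /andP[ij j5] /andP[kl l5] /=.
    rewrite !inE !negb_or !andbT => /and3P[/and3P[_ ik il] /andP[jk jl] _].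
    have i5 := ltn_trans ij j5; have k5 := ltn_trans kl l5.
    by rewrite -setI_eq0 setIUl !setIUr !disjoint_setI0 ?setU0 //; apply: dis.
  apply: disjointWl (disjointWr _ dU); apply/subsetP => z; rewrite in_set2;
  by case/orP=> /eqP->.
apply: (@no_k5_poly R (fun i => pos (c i)) (fun i j => walk_poly E (c i) (w (i, j)))).
  move=> i j hij; have [pw lw _ _] := hw (i, j) hij.
  by rewrite (last_walk_poly Elast pw) lw.
move=> i j k l hij hkl hu.
have [pw _ nw sw] := hw (i, j) hij; have [pw' _ nw' sw'] := hw (k, l) hkl; split.
  move=> q /(mem_walk_poly pw nw)[x [y [/sw hx /sw hy xy qxy]]].
  apply/negP => /(mem_walk_poly pw' nw')[x' [y' [/sw' hx' /sw' hy' xy' qxy']]].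
  have dis := sep _ _ _ _ _ _ _ _ hij hkl hu hx hy hx' hy'.
  have [_ p1 _ _] := hf _ _ xy; have [_ p2 _ _] := hf _ _ xy'.
  move: qxy qxy'; rewrite -p1 -p2 => /mem_sample[s hs e1] /mem_sample[t ht e2].
  by apply: (disf _ _ _ _ s t xy xy' dis hs ht); rewrite -e1.
move=> s t /(segments_walk_poly Elast pw)[x [y [/sw hx /sw hy xy hs]]].
move=> /(segments_walk_poly Elast pw')[x' [y' [/sw' hx' /sw' hy' xy' ht]]].
have dis := sep _ _ _ _ _ _ _ _ hij hkl hu hx hy hx' hy'.
exact: (hN (x, y, x', y') xy xy' dis) _ _ hs ht.
Qed.

(** * Balanced separators *)

Local Open Scope nat_scope.

(** * Small connected sets that meet given sets, or small separators *)

Section Layers.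
Variables (V : finType) (G : sgraph V) (B : {set V}) (k : nat) (A : nat -> {set V}).
Hypothesis k4 : 0 < k <= 4.
Hypothesis AB : forall i, i < k -> A i \subset B.

(* Walks that visit A 0, ..., A j in this order: the second component of a
   node is the index j of the last set visited so far. *)
Let node := (V * 'I_4)%type.

Definition layer_edge (x y : node) : bool :=
  (x.2 == y.2) && res G B x.1 y.1
  || [&& x.1 == y.1, y.2 == x.2.+1 :> nat, y.2 < k & y.1 \in A y.2].

Definition layer_start : {set node} := [set x : node | (x.2 == 0 :> nat) && (x.1 \in A 0)].

Definition layer_step (S : {set node}) : {set node} :=
  S :|: [set y : node | [exists x in S, layer_edge x y]].

Definition reach d := iter d layer_step layer_start.

(** The vertices of a walk form a connected set. A step along an edge of [G] adds at most one vertex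
    to it, and a step to the next index adds none. *)
Lemma reach_small_cset d x : x \in reach d ->
  x.2 < k /\ exists T, [/\ cset G T, T \subset B, #|T| <= d.+1, x.1 \in T &
    forall i, i <= x.2 -> ~~ [disjoint T & A i]].
Proof.
have k0 : 0 < k by case/andP: k4.
elim: d x => [|d IH] [u i] /=.
  rewrite inE /= => /andP[/eqP i0 uA]; rewrite i0; split=> //; exists [set u].
  rewrite cards1 sub1set inE eqxx (subsetP (AB k0)) //; split=> //.
    by split=> [|x y]; [apply/set0Pn; exists u; rewrite inE|
      rewrite !inE => /eqP-> /eqP->; apply: connect0].
  move=> j; rewrite leqn0 => /eqP->; apply/pred0Pn; exists u.
  by rewrite /= inE eqxx.
rewrite inE => /orP[/IH[ik [T [h1 h2 h3 h4 h5]]]|].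
  by split=> //; exists T; split=> //; apply: leq_trans h3 _.
rewrite inE => /existsP[[v j] /andP[/IH[/= jk [T [h1 h2 h3 h4 h5]]]]].
case/orP => /=.
  case/andP=> /eqP <- /and3P[vB uB vu]; split=> //; exists (u |: T); split.
  - rewrite setUC; apply: (csetU h1 _ h4 (set11 u)); last by rewrite vu orbT.
    by split=> [|x y]; [apply/set0Pn; exists u; rewrite inE|
      rewrite !inE => /eqP-> /eqP->; apply: connect0].
  - by rewrite subUset sub1set uB.
  - by rewrite cardsU1; case: (u \notin T); rewrite ?add1n ?add0n ?ltnS // ltnW.
  - by rewrite !inE eqxx.
  - move=> a /h5; apply: contra; apply: disjointWl.
    by apply/subsetP => x xT; rewrite inE xT orbT.
case/and4P=> /eqP evu /eqP ij ik uA; split=> //; exists T; split=> //.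
- exact: leq_trans h3 _.
- by rewrite -evu.
move=> a; rewrite leq_eqVlt => /orP[/eqP->|]; last by rewrite ij ltnS; apply: h5.
by apply/pred0Pn; exists u; rewrite /= uA -evu h4.
Qed.

Lemma reachS d : reach d \subset reach d.+1.
Proof. exact: subsetUl. Qed.

Lemma reach_mono d e : d <= e -> reach d \subset reach e.
Proof.
move=> /subnK <-; elim: (e - d) => // m IH; apply: subset_trans IH _.
by rewrite addSn; apply: reachS.
Qed.

Definition layer d : {set node} := if d is d'.+1 then reach d :\: reach d' else reach 0.

Lemma sum_layers d : \sum_(i < d.+1) #|layer i| = #|reach d|.
Proof.
elim: d => [|d IH]; first by rewrite big_ord1.
rewrite big_ord_recr /= IH -(cardsID (reach d) (reach d.+1)); congr (_ + _).
by rewrite setIC (setIidPl (reachS d)).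
Qed.

Lemma layer_in d x : x \in layer d -> x \in reach d.
Proof. by case: d => //= d; rewrite inE => /andP[]. Qed.

Lemma card_reach d : #|reach d| <= 4 * #|B|.
Proof.
have -> : 4 * #|B| = #|setX B [set: 'I_4]| by rewrite cardsX cardsT card_ord mulnC.
apply: subset_leq_card; apply/subsetP => -[u i] /reach_small_cset[_ [T [_ sTB _ uT _]]].
by rewrite !inE /= (subsetP sTB).
Qed.

(** Suppose that [K] meets every [A i]. Since [K] avoids the last layer, a node over [K] that is
    reached with the last step was reached before. So the reached part over [K] is closed under
    edges: it contains all of [K] at index 0, then at index 1 through a vertex of [A 1], and so on
    up to index k - 1, which no walk has reached. *)
Lemma layer_separates d K : (forall x, x \in reach d -> x.2.+1 != k :> nat) ->
  cset G K -> K \subset B :\: [set x.1 | x in layer d] ->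
  exists2 i, i < k & [disjoint K & A i].
Proof.
move=> notar [K0 cK] sK.
have [/'exists_idP [i hi]|] := boolP [exists i : 'I_4, (i < k) && [disjoint K & A i]].
  by case/andP: hi => hi1 hi2; exists i.
rewrite negb_exists => /forallP all_meet; exfalso.
have meet i : i < k -> exists2 a, a \in K & a \in A i.
  move=> ik; have i4 : i < 4 by case/andP: k4 => _; apply: leq_trans.
  have := all_meet (Ordinal i4); rewrite /= ik /= => /pred0Pn[a /andP[aK aA]].
  by exists a.
have outK u i : u \in K -> (u, i) \notin layer d.
  move=> uK; apply/negP => hl; have := subsetP sK _ uK; rewrite inE => /andP[/negP[]].
  by apply/imsetP; exists (u, i).
have KB u : u \in K -> u \in B by move/(subsetP sK); rewrite inE => /andP[].
have k0 : 0 < k by case/andP: k4.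
case: d notar sK outK => [|d] notar sK outK.
  have [a aK aA] := meet 0 k0; have := outK a ord0 aK.
  by rewrite inE /= aA.
have back u i : u \in K -> (u, i) \in reach d.+1 -> (u, i) \in reach d.
  move=> uK ub; have := outK u i uK; rewrite inE ub andbT negbK; exact.
have spread u v i : u \in K -> v \in K -> (u, i) \in reach d -> (v, i) \in reach d.
  move=> uK vK; have := @linked_closed _ G K [set w | (w, i) \in reach d]%SET u v.
  rewrite !inE; apply; last exact: cK.
  move=> x y xK yK xy; rewrite !inE => xb; apply: back => //.
  rewrite inE; apply/orP; right; rewrite inE; apply/existsP; exists (x, i).
  by rewrite xb /layer_edge /res /= eqxx !KB ?xy.
have all_in i (i4 : i < 4) : i < k -> forall u, u \in K -> (u, Ordinal i4) \in reach d.
  elim: i i4 => [|i IH] i4 ik u uK.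
    have [a aK aA] := meet 0 ik; apply: (spread a) => //.
    apply: (subsetP (reach_mono (leq0n d))); rewrite inE /= aA.
    by apply/eqP.
  have [a aK aA] := meet _ ik; apply: (spread a) => //; apply: back => //.
  have ab := IH (ltn_trans (ltnSn i) i4) (ltn_trans (ltnSn i) ik) a aK.
  rewrite inE; apply/orP; right; rewrite inE; apply/existsP.
  by exists (a, Ordinal (ltn_trans (ltnSn i) i4)); rewrite ab /layer_edge /= !eqxx ik aA orbT.
have k4' : k.-1 < 4 by rewrite prednK //; case/andP: k4.
have [a aK _] := meet 0 k0.
have := notar (a, Ordinal k4') (subsetP (reachS d) _ (all_in _ k4' _ a aK)).
by rewrite /= prednK // eqxx => /(_ (leqnn k)).
Qed.

(** If no walk of fewer than [r] steps visits all the sets, then one of the first [r] layers is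
    thin, and its projection is the separator [Z]. *)
Lemma small_hitting_or_separator r : 0 < r ->
  (exists T : {set V}, [/\ cset G T, T \subset B, #|T| <= r & forall i, i < k -> ~~ [disjoint T & A i]])
  \/ (exists Z : {set V}, [/\ Z \subset B, r * #|Z| <= 4 * #|B| &
       forall K, cset G K -> K \subset B :\: Z -> exists2 i, i < k & [disjoint K & A i]]).
Proof.
move=> r0.
have [/existsP[x /andP[xb /eqP xk]]|] := boolP [exists x in reach r.-1, x.2.+1 == k].
  left; have [_ [T [h1 h2 h3 h4 h5]]] := reach_small_cset xb.
  exists T; split=> //; first by rewrite prednK in h3.
  by move=> i; rewrite -xk ltnS; apply: h5.
rewrite negb_exists => /forallP notar; right.
have [/existsP[d hd]|] := boolP [exists d : 'I_r, r * #|layer d| <= 4 * #|B|].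
  exists [set x.1 | x in layer d]; split.
  - apply/subsetP => u /imsetP[x /layer_in xl ->].
    by have [_ [T [_ sTB _ uT _]]] := reach_small_cset xl; apply: (subsetP sTB).
  - by apply: leq_trans hd; rewrite leq_mul2l leq_imset_card orbT.
  - move=> K; apply: layer_separates => x xb; have := notar x.
    rewrite (subsetP (reach_mono _) _ xb) //.
    by rewrite -ltnS prednK.
(* Pigeonhole: the [r] layers are disjoint parts of [reach r.-1], which has at most 4 |B| nodes. *)
rewrite negb_exists => /forallP big; exfalso.
have : \sum_(d < r) (4 * #|B|).+1 <= \sum_(d < r) r * #|layer d|.
  by apply: leq_sum => d _; have := big d; rewrite -ltnNge.
rewrite sum_nat_const card_ord -big_distrr /= leq_pmul2l //.
by rewrite -(prednK r0) sum_layers ltnNge card_reach.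
Qed.

End Layers.

(** * Coveys: the argument of Alon, Seymour and Thomas *)

Section Separator.
Variables (V : finType) (G : sgraph V) (A : {set V}) (q : nat).

Definition boundary (B : {set V}) : {set V} :=
  [set v in A :\: B | [exists u in B, G u v]].

(* If there is no separator, then the measure 5 |B| + k of a covey can be decreased. *)
Record covey (k : nat) (C : nat -> {set V}) (B : {set V}) : Prop := Covey {
  covey_k : k <= 4;
  covey_cset : forall i, i < k -> cset G (C i) /\ C i \subset A;
  covey_dis : forall i j, i < j < k -> [disjoint C i & C j];
  covey_adj : forall i j, i < j < k -> exists u v, [/\ u \in C i, v \in C j & G u v];
  covey_B : [/\ cset G B, B \subset A & #|A| < 2 * #|B|];
  covey_disB : forall i, i < k -> [disjoint C i & B];
  covey_cover : forall v, v \in boundary B -> exists2 i, i < k & v \in C i;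
  covey_small : forall i, i < k -> #|boundary B :&: C i| <= 2 * q }.

Lemma card_boundary k C B : covey k C B -> #|boundary B| <= k * (2 * q).
Proof.
move=> [_ _ _ _ _ _ cover small].
have sub : boundary B \subset \bigcup_(i < k) (boundary B :&: C i).
  apply/subsetP => v vB; have [i ik vC] := cover v vB.
  by apply/bigcupP; exists (Ordinal ik) => //; rewrite inE vB.
apply: leq_trans (subset_leq_card sub) _.
have -> : k * (2 * q) = \sum_(i < k) 2 * q by rewrite sum_nat_const card_ord.
have : #|\bigcup_(i < k) (boundary B :&: C i)| <= \sum_(i < k) #|boundary B :&: C i|.
  elim/big_rec2: _ => [|i y1 y2 _ IH]; first by rewrite cards0.
  by apply: leq_trans (leq_card_setU _ _) _; rewrite leq_add2l.
by move=> h; apply: leq_trans h _; apply: leq_sum => i _; apply: small.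
Qed.

Lemma covey_adjC k C B i j : covey k C B -> i < k -> j < k -> i != j ->
  exists u v, [/\ u \in C i, v \in C j & G u v].
Proof.
move=> cv ik jk; case: (ltngtP i j) => // ij _; first by apply: (covey_adj cv); rewrite ij.
have [u [v [uC vC uv]]] := covey_adj cv (introT andP (conj ij ik)).
by exists v, u; rewrite adj_sym.
Qed.

Lemma covey_disC k C B i j : covey k C B -> i < k -> j < k -> i != j ->
  [disjoint C i & C j].
Proof.
move=> cv ik jk; case: (ltngtP i j) => // ij _; first by apply: (covey_dis cv); rewrite ij.
by rewrite disjoint_sym; apply: (covey_dis cv); rewrite ij.
Qed.

(** A member that misses the boundary can be given up, as the others still cover the boundary. The
    last member moves to the free index. *)
Lemma covey_drop k C B i : covey k C B -> i < k -> [disjoint boundary B & C i] ->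
  covey k.-1 (fun j => if j == i then C k.-1 else C j) B.
Proof.
move=> cv ik disB; have k0 : 0 < k by apply: leq_ltn_trans ik.
have kk : k.-1 < k by rewrite prednK.
have lt j : j < k.-1 -> j < k by move/ltn_trans; apply.
pose s j := if j == i then k.-1 else j.
have sE j : (if j == i then C k.-1 else C j) = C (s j) by rewrite /s; case: ifP.
have sk j : j < k.-1 -> s j < k by rewrite /s; case: ifP => // _ /lt.
have sI j l : j < l < k.-1 -> s j != s l.
  case/andP=> jl lk; rewrite /s.
  have [ji|_] := eqVneq j i; have [li|_] := eqVneq l i.
  - by rewrite ji li ltnn in jl.
  - by rewrite gtn_eqF.
  - by rewrite ltn_eqF // (ltn_trans jl).
  - by rewrite ltn_eqF.
have [k4 h1 h2 h3 h4 h5 h6 h7] := cv.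
split=> //.
- by apply: leq_trans (leq_pred k) k4.
- by move=> j /sk; rewrite sE; apply: h1.
- move=> j l jl; rewrite !sE; have /andP[jl' lk] := jl.
  by apply: (covey_disC cv); rewrite ?sI ?sk // (ltn_trans jl').
- move=> j l jl; rewrite !sE; have /andP[jl' lk] := jl.
  by apply: (covey_adjC cv); rewrite ?sI ?sk // (ltn_trans jl').
- by move=> j /sk; rewrite sE; apply: h5.
- move=> v vB; have [j jk vC] := h6 v vB.
  have ji : j != i.
    by apply: contraTneq disB => ji; apply/pred0Pn; exists v; rewrite /= vB -ji.
  have [jk'|kj] := eqVneq j k.-1.
    exists i; last by rewrite sE /s eqxx -jk'.
    by rewrite ltn_neqAle -ltnS prednK // ik andbT -jk' eq_sym.
  exists j; last by rewrite sE /s (negPf ji).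
  by rewrite ltn_neqAle kj -ltnS prednK.
- by move=> j /sk; rewrite sE; apply: h7.
Qed.

Hypothesis no_model : forall C : nat -> {set V}, (forall i, i < 5 -> C i \subset A) -> ~ k5_model G C.

Hypothesis no_separator : forall X : {set V}, X \subset A -> #|X| <= 10 * q ->
  exists2 u, u \in A :\: X & #|A| < 2 * #|[set v | linked G (A :\: X) u v]|.

Hypothesis cardA : #|A| <= q * q.

(* A component of more than half of A meets B, and lies in B as it avoids the
   boundary of B. *)
Lemma big_component (B Z : {set V}) :
  [/\ cset G B, B \subset A & #|A| < 2 * #|B|] ->
  Z \subset B -> #|boundary B| + #|Z| <= 10 * q ->
  exists B1 : {set V}, [/\ cset G B1, B1 \subset B :\: Z, #|A| < 2 * #|B1| &
    forall u v, u \in B1 -> v \in B -> G u v -> v \notin B1 -> v \in Z].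
Proof.
move=> [cB sBA bigB] sZB szX; pose X := boundary B :|: Z.
have sbA : boundary B \subset A.
  by apply/subsetP => v; rewrite !inE => /andP[/andP[]].
have [||u uX big] := no_separator (X := X).
- by rewrite subUset sbA (subset_trans sZB).
- exact: leq_trans (leq_card_setU _ _) szX.
set B1 := [set v | _] in big; exists B1.
have cB1 : cset G B1 by apply: cset_component.
have sB1 : B1 \subset A :\: X.
  by apply/subsetP => v; rewrite inE => /linked_in; apply.
have [w wB wB1] : exists2 w, w \in B & w \in B1.
  have : 0 < #|B :&: B1|.
    rewrite lt0n; apply/eqP => c0; have := cardsUI B B1; rewrite c0 addn0 => cU.
    have : #|B :|: B1| <= #|A|.
      apply: subset_leq_card; rewrite subUset sBA.
      by apply: subset_trans sB1 _; apply: subsetDl.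
    by rewrite cU; lia.
  by rewrite card_gt0 => /set0Pn[w]; rewrite inE => /andP[]; exists w.
have sB1B : B1 \subset B.
  apply/subsetP => v vB1; case: cB1 => _ /(_ _ _ wB1 vB1) lwv.
  apply: (linked_closed _ lwv wB) => x y xB1 yB1 xy xB.
  apply: contraT => yB; have := subsetP sB1 _ yB1; rewrite !inE negb_or.
  case/andP=> /andP[nb _] yA; case/negP: nb; rewrite yB yA /=.
  by apply/existsP; exists x; rewrite xB.
split=> //.
- apply/subsetP => v vB1; have := subsetP sB1 _ vB1.
  by rewrite !inE negb_or (subsetP sB1B _ vB1) andbT => /andP[/andP[]].
- move=> x v xB1 vB xv vB1; apply: contraT => vZ.
  case/negP: vB1; rewrite inE; move: (xB1); rewrite inE => lx.
  apply: linked_trans lx (linked1 _ _ xv); first exact: subsetP sB1 _ xB1.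
  by rewrite !inE negb_or (subsetP sBA) // vZ vB.
Qed.

Lemma boundary_sub (B B1 : {set V}) v : B1 \subset B -> v \in boundary B1 ->
  v \in boundary B \/ v \in B.
Proof.
move=> sB; rewrite !inE => /andP[/andP[vB1 ->] /existsP[u /andP[uB1 uv]]].
have [vB|vB] := boolP (v \in B); [by right|left].
by apply/existsP; exists u; rewrite (subsetP sB).
Qed.

(** For [k = 4] the sets [C i] and [T] form a model of K_5. Otherwise [T] becomes a new member, and
    [B] shrinks to a big component of what is left. That component has lost all of [T], which
    outweighs the growth of [k] by one. *)
Lemma covey_extend k C (B T : {set V}) : covey k C B -> cset G T -> T \subset B ->
  #|T| <= 2 * q -> (forall i, i < k -> exists u v, [/\ u \in C i, v \in T & G u v]) ->
  exists k' C' B', covey k' C' B' /\ 5 * #|B'| + k' < 5 * #|B| + k.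
Proof.
move=> cv cT sTB szT adjT; have [k4 h1 h2 h3 h4 h5 h6 h7] := cv.
have [cB sBA bigB] := h4.
have disT i : i < k -> [disjoint C i & T] by move/h5; apply: disjointWr.
have sTA := subset_trans sTB sBA.
have [k_eq|k_lt] : k = 4 \/ k < 4 by case: ltngtP k4 => // ? _; [right|left].
  exfalso; apply: (@no_model (fun i => if i < 4 then C i else T)).
    by move=> i _; case: ifP => // i4; rewrite k_eq in h1; case: (h1 _ i4).
  rewrite k_eq in h1 h2 h3 adjT disT; split.
  - by move=> i _; case: ifP => // i4; case: (h1 _ i4).
  - move=> i j /andP[ij j5]; have i4 : i < 4 by apply: leq_trans ij _.
    by rewrite i4; case: ifP => j4; [apply: h2; rewrite ij|apply: disT].
  - move=> i j /andP[ij j5]; have i4 : i < 4 by apply: leq_trans ij _.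
    by rewrite i4; case: ifP => j4; [apply: h3; rewrite ij|apply: adjT].
have szX : #|boundary B| + #|T| <= 10 * q.
  have := card_boundary cv; have : k * (2 * q) <= 4 * (2 * q) by rewrite leq_mul2r k4 orbT.
  by lia.
have [B1 [cB1 sB1 big1 bd1]] := big_component h4 sTB szX.
have sB1B : B1 \subset B by apply: subset_trans sB1 (subsetDl _ _).
exists k.+1, (fun i => if i < k then C i else T), B1; split; last first.
  have : #|B1| < #|B|.
    apply: proper_card; rewrite properE sB1B /=; have [/set0Pn[t tT] _] := cT.
    apply/subsetPn; exists t; first exact: subsetP sTB _ tT.
    by apply: contraL tT => /(subsetP sB1); rewrite inE => /andP[].
  by lia.
have lt i : i < k.+1 -> (i < k) = false -> i = k.
  by move=> i1 /negbT; rewrite -leqNgt => i2; apply/eqP; rewrite eqn_leq -ltnS i1.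
split=> //.
- by move=> i ik; case: ifP => // ik'; apply: h1.
- move=> i j /andP[ij jk]; have ik : i < k by apply: leq_trans ij _.
  by rewrite ik; case: ifP => jk'; [apply: h2; rewrite ij|apply: disT].
- move=> i j /andP[ij jk]; have ik : i < k by apply: leq_trans ij _.
  by rewrite ik; case: ifP => jk'; [apply: h3; rewrite ij|apply: adjT].
- by split=> //; apply: subset_trans sB1B sBA.
- move=> i ik; case: ifP => ik'; first exact: disjointWr sB1B (h5 _ ik').
  rewrite disjoint_sym disjoints_subset; apply: subset_trans sB1 _.
  by apply/subsetP => v; rewrite !inE => /andP[].
- move=> v vB1; have [/h6[i ik vC]|vB] := boundary_sub sB1B vB1.
    by exists i; rewrite ?ik // ltnW.
  exists k; rewrite ?ltnn //; move: vB1; rewrite !inE.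
  by case/andP=> /andP[vB1 _] /existsP[u /andP[uB1 uv]]; apply: bd1 uB1 vB uv vB1.
- move=> i ik; case: ifP => ik'; last first.
    by apply: leq_trans szT; apply: subset_leq_card; apply: subsetIr.
  apply: leq_trans (h7 i ik'); apply: subset_leq_card; apply/subsetP => v.
  rewrite inE => /andP[/(boundary_sub sB1B)[vB|vB] vC]; first by rewrite inE vB.
  by have /pred0P/(_ v) := h5 i ik'; rewrite /= vC vB.
Qed.

Definition contacts (C B : {set V}) : {set V} := [set v in B | [exists u in C, G u v]].

(** As [B1] contains no contact of [C i], the set [C i] can swallow [K], the union of the components
    of [B] minus [B1] that contain its contacts. The rest of [B] stays connected through [B1], and
    its boundary inside the enlarged member lies in [Z], hence is small. *)
Lemma covey_absorb k C (B Z B1 : {set V}) i : covey k C B -> Z \subset B -> #|Z| <= 2 * q ->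
  [/\ cset G B1, B1 \subset B :\: Z, #|A| < 2 * #|B1| &
    forall u v, u \in B1 -> v \in B -> G u v -> v \notin B1 -> v \in Z] ->
  i < k -> contacts (C i) B != set0 -> [disjoint B1 & contacts (C i) B] ->
  exists C' B', covey k C' B' /\ #|B'| < #|B|.
Proof.
move=> cv sZB szZ [cB1 sB1 big1 bd1] ik /set0Pn[a aA] disB1.
have [k4 h1 h2 h3 h4 h5 h6 h7] := cv; have [cB sBA bigB] := h4.
have sB1B : B1 \subset B by apply: subset_trans sB1 (subsetDl _ _).
pose K := [set v in B :\: B1 |
  [exists b in contacts (C i) B, linked G (B :\: B1) b v]].
have sKB : K \subset B :\: B1 by apply/subsetP => v; rewrite inE => /andP[].
have clK : {in B :\: B1 &, forall x y, G x y -> x \in K -> y \in K}.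
  move=> x y xB yB xy; rewrite [x \in K]inE [y \in K]inE xB yB /=.
  move=> /existsP[b /andP[bA lbx]]; apply/existsP; exists b; rewrite bA /=.
  by apply: linked_trans lbx (linked1 _ _ xy).
have contK b : b \in contacts (C i) B -> b \in K.
  move=> bA; have bB1 : b \notin B1.
    by apply/negP => bB1; have /pred0P/(_ b) := disB1; rewrite /= bB1 bA.
  have bB : b \in B by move: bA; rewrite inE => /andP[].
  by rewrite !inE bB1 bB /=; apply/existsP; exists b; rewrite bA; apply: connect0.
have B1K v : v \in B1 -> v \notin K by apply: contraL => /(subsetP sKB); rewrite inE => /andP[].
pose B' := B :\: K.
have sB'B : B' \subset B by apply: subsetDl.
have sB1B' : B1 \subset B'.
  by apply/subsetP => v vB1; rewrite inE B1K // (subsetP sB1B).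
have [C0 lC] := (h1 _ ik).1; have [c0 c0C] := set0Pn _ C0.
pose C' j := if j == i then C i :|: K else C j.
have subC j : C j \subset C' j by rewrite /C'; case: eqP => // ->; apply: subsetUl.
have disK j : j < k -> [disjoint C j & K].
  by move/h5; apply: disjointWr; apply: subset_trans sKB (subsetDl _ _).
exists C', B'; split; last first.
  apply: proper_card; rewrite properE sB'B /=; apply/subsetPn; exists a.
    by move: aA; rewrite inE => /andP[].
  by rewrite inE contK.
split=> //.
- move=> j jk; rewrite /C'; case: eqP => // _; last exact: h1.
  split; last first.
    rewrite subUset (h1 _ ik).2; apply: subset_trans sKB _.
    by apply: subset_trans (subsetDl _ _) sBA.
  split; first by apply/set0Pn; exists c0; rewrite inE c0C.
  suff l0 v : v \in C i :|: K -> linked G (C i :|: K) c0 v.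
    by move=> x y /l0 lx /l0 ly; apply: linked_trans (linkedC lx) ly.
  rewrite inE => /orP[vC|vK].
    by apply: linkedS (lC _ _ c0C vC); apply: subsetUl.
  have := vK; rewrite {1}inE => /andP[vB /existsP[b /andP[bA lbv]]].
  have bK := contK b bA.
  have lbv' : linked G (C i :|: K) b v.
    apply: linkedS (linked_within clK lbv (subsetP sKB _ bK) bK).
    by apply: subset_trans (subsetIr _ _) (subsetUr _ _).
  move: bA; rewrite inE => /andP[_ /existsP[u /andP[uC ub]]].
  apply: linked_trans (linkedS (subsetUl _ _) (lC _ _ c0C uC)) _.
  by apply: linked_trans (linked1 _ _ ub) lbv'; rewrite inE ?uC ?bK ?orbT.
- move=> j l jl; have /andP[jl' lk] := jl; have jk := ltn_trans jl' lk.
  rewrite /C'; case: eqP => [ji|_]; case: eqP => [li|_].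
  + by rewrite ji li ltnn in jl'.
  + by rewrite -setI_eq0 setIUl setU_eq0 !setI_eq0 -ji h2 // disjoint_sym disK.
  + by rewrite -setI_eq0 setIUr setU_eq0 !setI_eq0 -li h2 // disK.
  + exact: h2.
- move=> j l jl; have [u [v [uC vC uv]]] := h3 _ _ jl.
  by exists u, v; rewrite (subsetP (subC j)) // (subsetP (subC l)).
- split; [split|by apply: subset_trans sB'B sBA|]; last first.
  + by apply: leq_trans big1 _; rewrite leq_mul2l subset_leq_card.
  (* A walk in [B] from [v] to [B1] stays in [B'] until it meets [B1]: outside of [B1], a step into
     [K] would have to start in [K]. *)
  + suff to_B1 v : v \in B' -> exists2 b, b \in B1 & linked G B' v b.
      move=> x y /to_B1[b bB lxb] /to_B1[b' bB' lyb'].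
      apply: linked_trans lxb (linked_trans _ (linkedC lyb')).
      by case: cB1 => _ l1; apply: linkedS sB1B' (l1 _ _ bB bB').
    move=> vB'; case: cB1 => /set0Pn[b bB1] _.
    have := cB.2 _ _ (subsetP sB'B _ vB') (subsetP sB1B _ bB1).
    case/connectP=> p; elim: p v vB' => [|w p IH] v vB' /=.
      by move=> _ eb; exists v; [rewrite -eb|apply: connect0].
    case/andP=> /and3P[vB wB vw] pw eb.
    have [vB1|vB1] := boolP (v \in B1); first by exists v => //; apply: connect0.
    have wB' : w \in B'.
      rewrite inE wB andbT; apply/negP => wK.
      have vBB1 : v \in B :\: B1 by rewrite inE vB1.
      have := clK _ _ (subsetP sKB _ wK) vBB1; rewrite adj_sym => /(_ vw wK) vK.
      by move: vB'; rewrite inE vK.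
    have [b' b'B1 lwb] := IH w wB' pw eb.
    by exists b' => //; apply: linked_trans (linked1 vB' wB' vw) lwb.
  + by case: cB1 => /set0Pn[b bB1] _; apply/set0Pn; exists b; apply: subsetP sB1B' _ bB1.
- move=> j jk; rewrite /C'; case: eqP => [_|_]; last exact: disjointWr sB'B (h5 _ jk).
  rewrite -setI_eq0 setIUl setU_eq0 !setI_eq0 (disjointWr sB'B (h5 _ ik)) /=.
  by rewrite disjoint_sym disjoints_subset; apply/subsetP => v; rewrite !inE => /andP[].
- move=> v vB'; have [/h6[j jk vC]|vB] := boundary_sub sB'B vB'.
    by exists j => //; apply: subsetP (subC j) _ vC.
  exists i => //; rewrite /C' eqxx inE; apply/orP; right.
  by move: vB'; rewrite inE => /andP[]; rewrite inE => /andP[+ _]; rewrite inE vB andbT negbK.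
- move=> j jk; rewrite /C'; case: eqP => [_|_]; last first.
    apply: leq_trans (h7 j jk); apply: subset_leq_card; apply/subsetP => v.
    rewrite inE => /andP[/(boundary_sub sB'B)[vB|vB] vC]; first by rewrite inE vB.
    by have /pred0P/(_ v) := h5 j jk; rewrite /= vC vB.
  (* A vertex of [C i] has all its neighbours of [B] in [K]. A vertex of [K] with a neighbour in
     [B'] has it in [B1], since otherwise both would lie in the same component, and so it belongs to
     [Z]. *)
  apply: leq_trans szZ; apply: subset_leq_card; apply/subsetP => v.
  rewrite inE => /andP[+ vCK]; rewrite inE => /andP[_ /existsP[u /andP[uB' uv]]].
  have uB := subsetP sB'B _ uB'; have uK : u \notin K by move: uB'; rewrite inE => /andP[].
  move: vCK; rewrite inE => /orP[vC|vK].
    case/negP: uK; apply: contK; rewrite inE uB; apply/existsP; exists v.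
    by rewrite vC adj_sym.
  have := subsetP sKB _ vK; rewrite inE => /andP[vB1 vB].
  have [uB1|uB1] := boolP (u \in B1); first exact: bd1 uB1 vB uv vB1.
  case/negP: uK; apply: (clK v u) => //; last by rewrite adj_sym.
    exact: subsetP sKB _ vK.
  by rewrite inE uB1.
Qed.

(** The constant 10 arises here: the boundary has at most 4 * 2q vertices, 2q for each member, and
    [T] or [Z] adds at most 2q. The contacts of the members are the sets that [T] has to meet, so a
    [T] of at most 2q vertices extends the covey, and a separator [Z] leads to an absorption. *)
Lemma covey_step k C B : covey k C B ->
  exists k' C' B', covey k' C' B' /\ 5 * #|B'| + k' < 5 * #|B| + k.
Proof.
move=> cv; have [k4 h1 h2 h3 h4 h5 h6 h7] := cv; have [cB sBA bigB] := h4.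
have [b bB] := set0Pn _ cB.1.
have q0 : 0 < q.
  rewrite lt0n; apply: contraTneq cardA => ->; rewrite -ltnNge card_gt0.
  by apply/set0Pn; exists b; apply: subsetP bB.
have [/existsP[i /andP[_ disi]]|] := boolP [exists i : 'I_k, true && [disjoint boundary B & C i]].
  exists k.-1, (fun j => if j == i :> nat then C k.-1 else C j), B.
  split; first exact: covey_drop cv (ltn_ord i) disi.
  by rewrite ltn_add2l prednK // (leq_ltn_trans _ (ltn_ord i)).
rewrite negb_exists => /forallP touch.
have cont i : i < k -> contacts (C i) B != set0.
  move=> ik; have := touch (Ordinal ik); rewrite /= => /pred0Pn[v /=].
  rewrite inE => /andP[/andP[_ /existsP[u /andP[uB uv]]] vC].
  by apply/set0Pn; exists u; rewrite inE uB; apply/existsP; exists v; rewrite vC adj_sym.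
have [k0|k0] := posnP k.
  apply: (covey_extend cv (T := [set b])).
  - split=> [|x y]; first by apply/set0Pn; exists b; rewrite inE.
    by rewrite !inE => /eqP-> /eqP->; apply: connect0.
  - by rewrite sub1set.
  - by rewrite cards1; lia.
  - by move=> i; rewrite k0.
have kk : 0 < k <= 4 by rewrite k0.
have subc i : i < k -> contacts (C i) B \subset B.
  by move=> _; apply/subsetP => v; rewrite inE => /andP[].
have r0 : 0 < 2 * q by lia.
have [[T [cT sTB szT hitT]]|[Z [sZB szZ sepZ]]] :=
  small_hitting_or_separator G kk subc r0.
  apply: (covey_extend cv cT sTB szT) => i ik.
  have /pred0Pn[v /= /andP[vT]] := hitT i ik.
  by rewrite inE => /andP[_ /existsP[u /andP[uC uv]]]; exists u, v.
(* From 2q |Z| <= 4 |B| <= 4 q^2. *)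
have szZ' : #|Z| <= 2 * q.
  rewrite -(leq_pmul2l r0); apply: leq_trans szZ _.
  have := subset_leq_card sBA; lia.
have szX : #|boundary B| + #|Z| <= 10 * q.
  have := card_boundary cv; have : k * (2 * q) <= 4 * (2 * q) by rewrite leq_mul2r k4 orbT.
  by lia.
have [B1 hB1] := big_component h4 sZB szX; have [cB1 sB1 _ _] := hB1.
have [i ik disi] := sepZ B1 cB1 sB1.
have [C' [B' [cv' lt]]] := covey_absorb cv sZB szZ' hB1 ik (cont i ik) disi.
by exists k, C', B'; split=> //; lia.
Qed.

Lemma no_covey k C B : ~ covey k C B.
Proof.
have [m] := ubnP (5 * #|B| + k); elim: m k C B => // m IH k C B.
rewrite ltnS => le_m /covey_step[k' [C' [B' [cv' lt]]]].
by apply: IH cv'; apply: leq_trans lt le_m.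
Qed.

(** The empty set is not a separator, so some component has more than half of the vertices. Its
    boundary is empty, which makes it a covey without members. *)
Lemma separator_absurd : False.
Proof.
have [||u uA big] := no_separator (X := set0).
- exact: sub0set.
- by rewrite cards0.
rewrite setD0 in uA big.
apply: (@no_covey 0 (fun=> set0) [set v | linked G A u v]); split=> //.
- by move=> i j; rewrite andbC.
- by move=> i j; rewrite andbC.
- split=> //; first exact: cset_component.
  by apply/subsetP => v; rewrite inE => /linked_in; apply.
- move=> v; rewrite 2!inE => /andP[/andP[nv vA] /existsP[w /andP[wB wv]]].
  case/negP: nv; move: wB; rewrite !inE => luw.
  exact: linked_trans luw (linked1 (linked_in luw uA) vA wv).
Qed.

End Separator.

Theorem balanced_separator (V : finType) (G : sgraph V) (A : {set V}) (q : nat) :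
  (forall C : nat -> {set V}, (forall i, i < 5 -> C i \subset A) -> ~ k5_model G C) ->
  #|A| <= q * q ->
  exists X : {set V}, [/\ X \subset A, #|X| <= 10 * q &
    forall u, u \in A :\: X -> 2 * #|[set v | linked G (A :\: X) u v]| <= #|A|].
Proof.
move=> nomod cardA; apply: contrapT => nosep.
apply: (separator_absurd nomod _ cardA) => X sXA szX.
apply: contrapT => nobig; apply: nosep; exists X; split=> // u uA.
by rewrite leqNgt; apply/negP => big; apply: nobig; exists u.
Qed.

Lemma k5_model_del (V : finType) (G : sgraph V) (v0 : V) (C : nat -> {set V}) :
  (forall i, i < 5 -> v0 \notin C i) -> k5_model G C ->
  k5_model (del_vertex G v0) (fun i => [set x | val x \in C i]).
Proof.
move=> nv [cC dC aC].
have lift i u : i < 5 -> u \in C i -> u != v0.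
  by move=> i5; apply: contraTneq => ->; apply: nv.
split.
- move=> i i5; have [/set0Pn[u uC] lC] := cC i i5; split.
    by apply/set0Pn; exists (exist _ u (lift i u i5 uC)); rewrite inE.
  move=> x y; rewrite !inE => xC yC; have /connectP[p pp ep] := lC _ _ xC yC.
  elim: p x xC pp ep => [|w p IH] x xC /=.
    by move=> _ /val_inj ->; apply: connect0.
  case/andP => /and3P[_ wC xw] pw ep.
  have := IH (exist _ w (lift i w i5 wC)) wC pw ep.
  by apply: linked_trans; apply: linked1; rewrite ?inE.
- move=> i j ij; rewrite -setI_eq0; apply/eqP/setP => x; rewrite !inE.
  by have /pred0P/(_ (val x)) := dC i j ij.
- move=> i j ij; have [u [v [uC vC uv]]] := aC i j ij; have /andP[ij' j5] := ij.
  exists (exist _ u (lift i u (ltn_trans ij' j5) uC)), (exist _ v (lift j v j5 vC)).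
  by rewrite !inE.
Qed.

(** The rest of [A] lies in a plane graph, and the apex vertex, if it is in [A], is added to the
    separator; hence the summand 1. *)
Lemma apex_separator (R : realType) (V : finType) (G : sgraph V) (A : {set V}) (q : nat) :
  apex R G -> #|A| <= q * q ->
  exists X : {set V}, [/\ X \subset A, #|X| <= 10 * q + 1 &
    forall u, u \in A :\: X -> 2 * #|[set v | linked G (A :\: X) u v]| <= #|A|].
Proof.
move=> [v0 pl] cardA.
have sA : A :\ v0 \subset A by apply: subsetDl.
have [||X [sXA szX half]] := @balanced_separator V G (A :\ v0) q.
- move=> C sC /(k5_model_del (v0 := v0)) mod; apply: (planar_no_k5 pl (mod _)) => i i5.
  by apply/negP => /(subsetP (sC i i5)); rewrite !inE eqxx.
- exact: leq_trans (subset_leq_card sA) cardA.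
exists (X :|: (A :&: [set v0])).
have e : A :\: (X :|: (A :&: [set v0])) = (A :\ v0) :\: X.
  apply/setP => v; rewrite !inE negb_or negb_and.
  by case: (v \in A); rewrite ?andbF // !andbT.
split.
- by rewrite subUset (subset_trans sXA) // subsetIl.
- apply: leq_trans (leq_card_setU _ _) _; apply: leq_add => //.
  by apply: leq_trans (subset_leq_card (subsetIr _ _)) _; rewrite cards1.
- rewrite e => u uA; apply: leq_trans (half u uA) _; exact: subset_leq_card.
Qed.

(** * A while language and its compiler *)

Inductive atom :=
| SetC (d k : nat)
| AddV (d a b : nat)
| SubV (d a b : nat)
| Inp (d a : nat)
| Get (d A i : nat)
| Put (A i b : nat).

Inductive cmd :=
| CSkip
| CAtom (a : atom)
| CSeq (c1 c2 : cmd)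
| CIf (a : nat) (c1 c2 : cmd)
| CWhile (a : nat) (c : cmd).

Record store := Store { var : nat -> nat; arr : nat -> nat -> nat }.

Definition setv (s : store) (d k : nat) : store :=
  Store (fun i => if i == d then k else var s i) (arr s).

Definition seta (s : store) (A i k : nat) : store :=
  Store (var s) (fun B j => if (B == A) && (j == i) then k else arr s B j).

Definition exec_atom (x : seq nat) (a : atom) (s : store) : store :=
  match a with
  | SetC d k => setv s d k
  | AddV d a b => setv s d (var s a + var s b)
  | SubV d a b => setv s d (var s a - var s b)
  | Inp d a => setv s d (nth 0 x (var s a))
  | Get d A i => setv s d (arr s A (var s i))
  | Put A i b => seta s A (var s i) (var s b)
  end.

Definition asize (a : atom) : nat :=
  match a with Get _ _ _ | Put _ _ _ => 7 | _ => 1 end.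

(* [run x c s t s']: on input x the command c leads from s to s', and its
   compiled code takes exactly t machine steps. *)
Inductive run (x : seq nat) : cmd -> store -> nat -> store -> Prop :=
| RSkip s : run x CSkip s 0 s
| RAtom a s : run x (CAtom a) s (asize a) (exec_atom x a s)
| RSeq c1 c2 s1 s2 s3 t1 t2 :
    run x c1 s1 t1 s2 -> run x c2 s2 t2 s3 -> run x (CSeq c1 c2) s1 (t1 + t2) s3
| RIfT a c1 c2 s s' t :
    var s a != 0 -> run x c1 s t s' -> run x (CIf a c1 c2) s (t + 2) s'
| RIfF a c1 c2 s s' t :
    var s a = 0 -> run x c2 s t s' -> run x (CIf a c1 c2) s (t + 1) s'
| RWhileF a c s : var s a = 0 -> run x (CWhile a c) s 1 s
| RWhileT a c s s' s'' t t' :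
    var s a != 0 -> run x c s t s' -> run x (CWhile a c) s' t' s'' ->
    run x (CWhile a c) s (t + t' + 2) s''.

(* Registers 0 to 47 hold the variables, 48 and 49 are scratch, 50 stays 0, and
   entry i of array A is kept in register 64 + A + 16 i. *)
Definition address (A i : nat) : seq instr :=
  [:: Add 48 i i; Add 48 48 48; Add 48 48 48; Add 48 48 48; Const 49 (64 + A);
      Add 48 48 49].

Fixpoint csize (c : cmd) : nat :=
  match c with
  | CSkip => 0
  | CAtom a => asize a
  | CSeq c1 c2 => csize c1 + csize c2
  | CIf _ c1 c2 => csize c1 + csize c2 + 2
  | CWhile _ c1 => csize c1 + 2
  end.

Definition compile_atom (a : atom) : seq instr :=
  match a with
  | SetC d k => [:: Const d k]
  | AddV d a b => [:: Add d a b]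
  | SubV d a b => [:: Defs.Sub d a b]
  | Inp d a => [:: Input d a]
  | Get d A i => address A i ++ [:: Read d 48]
  | Put A i b => address A i ++ [:: Write 48 b]
  end.

(** Jump targets are absolute, hence the parameter [off]. As register 50 stays 0, [JumpZ 50] is an
    unconditional jump. *)
Fixpoint compile (c : cmd) (off : nat) : seq instr :=
  match c with
  | CSkip => [::]
  | CAtom a => compile_atom a
  | CSeq c1 c2 => compile c1 off ++ compile c2 (off + csize c1)
  | CIf a c1 c2 =>
      JumpZ a (off + csize c1 + 2) :: compile c1 off.+1 ++
      JumpZ 50 (off + csize c1 + csize c2 + 2) :: compile c2 (off + csize c1 + 2)
  | CWhile a c1 =>
      JumpZ a (off + csize c1 + 2) :: compile c1 off.+1 ++ [:: JumpZ 50 off]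
  end.

Definition wf_atom (a : atom) : bool :=
  match a with
  | SetC d k => d < 48
  | AddV d a b | SubV d a b => [&& d < 48, a < 48 & b < 48]
  | Inp d a => (d < 48) && (a < 48)
  | Get d A i => [&& d < 48, A < 16 & i < 48]
  | Put A i b => [&& A < 16, i < 48 & b < 48]
  end.

Fixpoint wf (c : cmd) : bool :=
  match c with
  | CSkip => true
  | CAtom a => wf_atom a
  | CSeq c1 c2 => wf c1 && wf c2
  | CIf a c1 c2 => [&& a < 48, wf c1 & wf c2]
  | CWhile a c1 => (a < 48) && wf c1
  end.

Lemma size_compile c off : size (compile c off) = csize c.
Proof.
elim: c off => //= [[]//|c1 IH1 c2 IH2|a c1 IH1 c2 IH2|a c IH] off;
  rewrite ?size_cat /= ?size_cat /= ?IH1 ?IH2 ?IH //=; lia.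
Qed.

Definition sim (m : nat -> nat) (s : store) : Prop :=
  [/\ forall v, v < 48 -> m v = var s v, m 50 = 0 &
      forall A i, A < 16 -> m (64 + A + 16 * i) = arr s A i].

Definition code_at (P : program) (off : nat) (code : seq instr) : Prop :=
  forall i, i < size code -> onth P (off + i) = onth code i.

Lemma code_at_cat P off c1 c2 : code_at P off (c1 ++ c2) ->
  code_at P off c1 /\ code_at P (off + size c1) c2.
Proof.
move=> H; split=> i hi.
  rewrite H ?size_cat ?ltn_addr //.
  by rewrite onth_cat hi.
rewrite -addnA H ?size_cat ?ltn_add2l //.
by rewrite onth_cat ltnNge leq_addr /= addKn.
Qed.

Lemma code_at_cons P off i c : code_at P off (i :: c) ->
  onth P off = Some i /\ code_at P off.+1 c.
Proof.
move=> H; split; first by have := H 0 isT; rewrite addn0.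
by move=> j hj; rewrite addSnnS; apply: H.
Qed.

Lemma step_at P x pc m i : onth P pc = Some i ->
  step P x (Config pc m) = exec x i (Config pc m).
Proof. by rewrite /step /= => ->. Qed.

Definition reaches (P : program) (x : seq nat) (t pc pc' : nat) (m m' : nat -> nat) :=
  iter t (step P x) (Config pc m) = Config pc' m'.

Lemma reaches_trans P x t1 t2 pc1 pc2 pc3 m1 m2 m3 :
  reaches P x t1 pc1 pc2 m1 m2 -> reaches P x t2 pc2 pc3 m2 m3 ->
  reaches P x (t1 + t2) pc1 pc3 m1 m3.
Proof. by rewrite /reaches addnC iterD => -> ->. Qed.

Lemma sim_setv m s d k : d < 48 -> sim m s -> sim (set_reg m d k) (setv s d k).
Proof.
move=> d48 [h1 h2 h3]; split=> [v v48||A i hA]; rewrite /set_reg /=.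
- by case: eqP => // _; apply: h1.
- by case: eqP => // e; rewrite -e in d48.
- by case: eqP => [e|_]; [lia|apply: h3].
Qed.

Lemma sim_scratch m s d k : d = 48 \/ d = 49 -> sim m s -> sim (set_reg m d k) s.
Proof.
move=> hd [h1 h2 h3]; split=> [v v48||A i hA]; rewrite /set_reg /=.
- by case: eqP => [e|_]; [lia|apply: h1].
- by case: eqP => [e|_]; [lia|].
- by case: eqP => [e|_]; [lia|apply: h3].
Qed.

Lemma reaches_address P x off m s A i : code_at P off (address A i) -> i < 48 ->
  sim m s -> exists m', [/\ reaches P x 6 off (off + 6) m m', sim m' s &
    m' 48 = 64 + A + 16 * var s i].
Proof.
move=> cd i48 sm.
have [h1 {}cd] := code_at_cons cd; have [h2 {}cd] := code_at_cons cd.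
have [h3 {}cd] := code_at_cons cd; have [h4 {}cd] := code_at_cons cd.
have [h5 {}cd] := code_at_cons cd; have [h6 _] := code_at_cons cd.
have mi : m i = var s i by case: sm => h _ _; apply: h.
eexists; split.
- rewrite /reaches (_ : off + 6 = off.+4.+2) /=; last by lia.
  rewrite (step_at _ _ h1) /= (step_at _ _ h2) /= (step_at _ _ h3) /=.
  rewrite (step_at _ _ h4) /= (step_at _ _ h5) /= (step_at _ _ h6) /=.
  reflexivity.
- by do 6!(apply: sim_scratch; first by [left|right]).
- by rewrite /set_reg /= mi; lia.
Qed.

Lemma compile_atom_correct P x a s : wf_atom a -> forall off m,
  code_at P off (compile_atom a) -> sim m s ->
  exists m', reaches P x (asize a) off (off + asize a) m m' /\ sim m' (exec_atom x a s).
Proof.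
case: a.
- move=> d k /= d48 off m /code_at_cons[c _] sm; exists (set_reg m d k); split.
    by rewrite /reaches /= (step_at _ _ c) addn1.
  exact: sim_setv.
- move=> d a b /= /and3P[d48 a48 b48] off m /code_at_cons[c _] sm.
  exists (set_reg m d (m a + m b)); split; first by rewrite /reaches /= (step_at _ _ c) addn1.
  by have [h _ _] := sm; rewrite !h //; apply: sim_setv.
- move=> d a b /= /and3P[d48 a48 b48] off m /code_at_cons[c _] sm.
  exists (set_reg m d (m a - m b)); split; first by rewrite /reaches /= (step_at _ _ c) addn1.
  by have [h _ _] := sm; rewrite !h //; apply: sim_setv.
- move=> d a /= /andP[d48 a48] off m /code_at_cons[c _] sm.
  exists (set_reg m d (nth 0 x (m a))); split; first by rewrite /reaches /= (step_at _ _ c) addn1.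
  by have [h _ _] := sm; rewrite !h //; apply: sim_setv.
- move=> d A i /= /and3P[d48 A16 i48] off m cd sm.
  have [cd1 /code_at_cons[cd2 _]] := code_at_cat (c1 := address A i) cd.
  have [m' [r1 sm' e]] := reaches_address x cd1 i48 sm.
  exists (set_reg m' d (m' (m' 48))); split.
    rewrite -[7]/(6 + 1); apply: reaches_trans r1 _.
    by rewrite /reaches /= (step_at _ _ cd2) /= -addnS.
  by have [_ _ h] := sm'; rewrite e h //; apply: sim_setv.
- move=> A i b /= /and3P[A16 i48 b48] off m cd sm.
  have [cd1 /code_at_cons[cd2 _]] := code_at_cat (c1 := address A i) cd.
  have [m' [r1 sm' e]] := reaches_address x cd1 i48 sm.
  exists (set_reg m' (m' 48) (m' b)); split.
    rewrite -[7]/(6 + 1); apply: reaches_trans r1 _.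
    by rewrite /reaches /= (step_at _ _ cd2) /= -addnS.
  have [h1 h2 h3] := sm'; rewrite e h1 // /set_reg.
  set w := 64 + A + 16 * var s i; split=> [v v48||B j B16].
  + by case: (v =P w) => [ev|_]; [lia|apply: h1].
  + by case: (50 =P w) => [ev|_]; [lia|].
  + rewrite /=; case: (_ =P w) => [ev|ne].
      have [-> ->] : B = A /\ j = var s i by lia.
      by rewrite !eqxx.
    have [eB|_] := eqVneq B A; have [ej|_] := eqVneq j (var s i) => /=; try exact: h3.
    by case: ne; rewrite eB ej.
Qed.

Theorem compile_correct P x c s t s' : run x c s t s' -> wf c -> forall off m,
  code_at P off (compile c off) -> sim m s ->
  exists m', reaches P x t off (off + csize c) m m' /\ sim m' s'.
Proof.
elim=> {c s t s'}.
- by move=> s _ off m _ sm; exists m; rewrite addn0.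
- by move=> a s /=; apply: compile_atom_correct.
- move=> c1 c2 s1 s2 s3 t1 t2 _ IH1 _ IH2 /= /andP[w1 w2] off m.
  move=> /code_at_cat[cd1 cd2] sm; rewrite size_compile in cd2.
  have [m1 [r1 sm1]] := IH1 w1 off m cd1 sm.
  have [m2 [r2 sm2]] := IH2 w2 _ m1 cd2 sm1.
  by exists m2; rewrite addnA; split=> //; apply: reaches_trans r1 r2.
- move=> a c1 c2 s s' t a0 _ IH /= /and3P[a48 w1 w2] off m.
  move=> /code_at_cons[cd0 /code_at_cat[cd1 /code_at_cons[cd2 cd3]]] sm.
  rewrite size_compile in cd2.
  have [m1 [r1 sm1]] := IH w1 _ m cd1 sm; exists m1; split=> //.
  have -> : t + 2 = 1 + (t + 1) by lia.
  apply: (@reaches_trans _ _ _ _ _ off.+1 _ _ m).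
    rewrite /reaches /= (step_at _ _ cd0) /=; have [h _ _] := sm.
    by rewrite h // (negPf a0).
  apply: reaches_trans r1 _; rewrite /reaches /= (step_at _ _ cd2) /=.
  by have [_ -> _] := sm1; rewrite eqxx; congr Config; lia.
- move=> a c1 c2 s s' t a0 _ IH /= /and3P[a48 w1 w2] off m.
  move=> /code_at_cons[cd0 /code_at_cat[cd1 /code_at_cons[cd2 cd3]]] sm.
  rewrite size_compile in cd3.
  have e : (off.+1 + csize c1).+1 = off + csize c1 + 2 by lia.
  rewrite e in cd3.
  have [m1 [r1 sm1]] := IH w2 _ m cd3 sm; exists m1; split=> //.
  rewrite addnC.
  apply: (@reaches_trans _ _ _ _ _ (off + csize c1 + 2) _ _ m).
    rewrite /reaches /= (step_at _ _ cd0) /=; have [h _ _] := sm.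
    by rewrite h // a0.
  by have -> : off + (csize c1 + csize c2 + 2) = off + csize c1 + 2 + csize c2 by lia.
- move=> a c s a0 /= /andP[a48 w1] off m /code_at_cons[cd0 _] sm; exists m; split=> //.
  rewrite /reaches /= (step_at _ _ cd0) /=; have [h _ _] := sm.
  by rewrite h // a0 /= addnA.
- move=> a c s s' s'' t t' a0 _ IH1 _ IH2 /= w off m cd sm; have /andP[a48 w1] := w.
  have /code_at_cons[cd0 /code_at_cat[cd1 /code_at_cons[cd2 _]]] := cd.
  rewrite size_compile in cd2.
  have [m1 [r1 sm1]] := IH1 w1 _ m cd1 sm.
  have [m2 [r2 sm2]] := IH2 w off m1 cd sm1; exists m2; split=> //.
  have -> : t + t' + 2 = 1 + (t + (1 + t')) by lia.
  apply: (@reaches_trans _ _ _ _ _ off.+1 _ _ m).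
    rewrite /reaches /= (step_at _ _ cd0) /=; have [h _ _] := sm.
    by rewrite h // (negPf a0).
  apply: reaches_trans r1 _; apply: (@reaches_trans _ _ _ _ _ off _ _ m1) r2.
  by rewrite /reaches /= (step_at _ _ cd2) /=; have [_ -> _] := sm1.
Qed.

Definition modv_atom (a : atom) (v : nat) : bool :=
  match a with
  | SetC d _ | AddV d _ _ | SubV d _ _ | Inp d _ | Get d _ _ => v == d
  | Put _ _ _ => false
  end.

Definition moda_atom (a : atom) (A : nat) : bool :=
  if a is Put B _ _ then A == B else false.

(* Commands without unbounded loops.  [BFor i N d b] runs b for i = 0, ..., N - 1
   and uses d as a scratch variable. *)
Inductive blk :=
| BSkip
| BAtom (a : atom)
| BSeq (b1 b2 : blk)
| BIf (a : nat) (b1 b2 : blk)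
| BFor (i N d : nat) (b : blk).

Coercion BAtom : atom >-> blk.

Fixpoint to_cmd (b : blk) : cmd :=
  match b with
  | BSkip => CSkip
  | BAtom a => CAtom a
  | BSeq b1 b2 => CSeq (to_cmd b1) (to_cmd b2)
  | BIf a b1 b2 => CIf a (to_cmd b1) (to_cmd b2)
  | BFor i N d b =>
      CSeq (CAtom (SetC i 0)) (CSeq (CAtom (SubV d N i)) (CWhile d
        (CSeq (to_cmd b) (CSeq (CAtom (SetC d 1)) (CSeq (CAtom (AddV i i d))
          (CAtom (SubV d N i)))))))
  end.

(** The variable [d] first serves as the constant 1 and then holds the number of remaining rounds,
    which is the test of the loop. *)
Definition next_round (i N d : nat) (s : store) : store :=
  let s' := setv (setv s d 1) i (var s i + 1) in setv s' d (var s' N - var s' i).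

Fixpoint eval (x : seq nat) (b : blk) (s : store) : store :=
  match b with
  | BSkip => s
  | BAtom a => exec_atom x a s
  | BSeq b1 b2 => eval x b2 (eval x b1 s)
  | BIf a b1 b2 => if var s a != 0 then eval x b1 s else eval x b2 s
  | BFor i N d b => iter (var s N) (fun s' => next_round i N d (eval x b s'))
                      (setv (setv s i 0) d (var s N))
  end.

Fixpoint modv (b : blk) (v : nat) : bool :=
  match b with
  | BSkip => false
  | BAtom a => modv_atom a v
  | BSeq b1 b2 | BIf _ b1 b2 => modv b1 v || modv b2 v
  | BFor i N d b => [|| v == i, v == d | modv b v]
  end.

Fixpoint moda (b : blk) (A : nat) : bool :=
  match b with
  | BSkip => false
  | BAtom a => moda_atom a A
  | BSeq b1 b2 | BIf _ b1 b2 => moda b1 A || moda b2 A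
  | BFor i N d b => moda b A
  end.

Fixpoint wfb (b : blk) : bool :=
  match b with
  | BSkip => true
  | BAtom a => wf_atom a
  | BSeq b1 b2 => wfb b1 && wfb b2
  | BIf a b1 b2 => [&& a < 48, wfb b1 & wfb b2]
  | BFor i N d b => [&& i < 48, N < 48, d < 48, i != N, i != d, N != d,
      ~~ modv b i, ~~ modv b N & wfb b]
  end.

Fixpoint bounds (b : blk) : seq nat :=
  match b with
  | BSkip | BAtom _ => [::]
  | BSeq b1 b2 | BIf _ b1 b2 => bounds b1 ++ bounds b2
  | BFor i N d b => N :: bounds b
  end.

Fixpoint cost (p : nat) (b : blk) : nat :=
  match b with
  | BSkip => 0
  | BAtom a => asize a
  | BSeq b1 b2 => cost p b1 + cost p b2
  | BIf a b1 b2 => cost p b1 + cost p b2 + 2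
  | BFor i N d b => p * (cost p b + 5) + 3
  end.

(** The two frame conditions on the body are hypotheses because the proof of [eval_frame] itself
    goes through this lemma. *)
Lemma eval_for_ind x i N d b s (I : nat -> store -> Prop) :
  wfb (BFor i N d b) ->
  (forall s, ~~ modv b i -> var (eval x b s) i = var s i) ->
  (forall s, ~~ modv b N -> var (eval x b s) N = var s N) ->
  I 0 (setv (setv s i 0) d (var s N)) ->
  (forall j s', j < var s N -> var s' i = j -> var s' N = var s N -> I j s' ->
     I j.+1 (next_round i N d (eval x b s'))) ->
  forall k, k <= var s N -> let s' := iter k (fun s' => next_round i N d (eval x b s'))
        (setv (setv s i 0) d (var s N)) in
    [/\ var s' i = k, var s' N = var s N, var s' d = var s N - k & I k s'].
Proof.
case/and5P=> i48 N48 d48 iN /and5P[id Nd bi bN _] fi fN I0 IS.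
have Ni : (N == i) = false by rewrite eq_sym (negPf iN).
elim=> [|k IH] kN /=.
  by rewrite !eqxx /= Ni (negPf id) (negPf Nd) subn0.
have [h1 h2 h3 h4] := IH (ltnW kN); have := IS k _ kN h1 h2 h4.
set s' := iter k _ _ in h1 h2 h3 h4 *; move=> h5; split=> //; rewrite /next_round /= !eqxx;
  by rewrite ?(negPf id) ?Ni ?(negPf Nd) ?fN ?fi ?h1 ?h2 ?addn1.
Qed.

Lemma eval_frame x b s : wfb b ->
  (forall v, ~~ modv b v -> var (eval x b s) v = var s v) /\
  (forall A j, ~~ moda b A -> arr (eval x b s) A j = arr s A j).
Proof.
elim: b s => //= [a|b1 IH1 b2 IH2|a b1 IH1 b2 IH2|i N d b IH] s.
- by case: a => /= *; split=> //= v; [..|move=> j]; move=> /negPf ->.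
- case/andP=> /IH1 f1 /IH2 f2; split=> [v|A j]; rewrite negb_or => /andP[m1 m2].
    by rewrite (f2 _).1 // (f1 _).1.
  by rewrite (f2 _).2 // (f1 _).2.
- case/and3P=> _ /IH1 f1 /IH2 f2; split=> [v|A j]; rewrite negb_or => /andP[m1 m2];
    by case: ifP => _; rewrite ?(f1 s).1 ?(f2 s).1 ?(f1 s).2 ?(f2 s).2.
move=> w; have /and5P[i48 N48 d48 iN /and5P[id Nd bi bN wb]] := w.
have := @eval_for_ind x i N d b s (fun k s' =>
  (forall v, ~~ [|| v == i, v == d | modv b v] -> var s' v = var s v) /\
  (forall A j, ~~ moda b A -> arr s' A j = arr s A j)) w.
move=> /(_ (fun s => (IH s wb).1 i) (fun s => (IH s wb).1 N)) H.
have [||_ _ _] // := H _ _ (var s N) (leqnn _).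
  split=> // v; rewrite !negb_or => /and3P[vi vd _] /=.
  by rewrite (negPf vi) (negPf vd).
move=> j s' _ _ _ [h1 h2]; split=> [v mv|A k mA] /=; last by rewrite (IH s' wb).2 // h2.
have := mv; rewrite !negb_or => /and3P[vi vd vb].
by rewrite (negPf vi) (negPf vd) (IH s' wb).1 // h1.
Qed.

Lemma evalv x b s v : wfb b -> ~~ modv b v -> var (eval x b s) v = var s v.
Proof. by move=> /(eval_frame x s)[h _]; apply: h. Qed.

Lemma evala x b s A j : wfb b -> ~~ moda b A -> arr (eval x b s) A j = arr s A j.
Proof. by move=> /(eval_frame x s)[_ h]; apply: h. Qed.

(** The loop itself changes [i] and [d] between rounds; the two stability conditions let the
    invariant ignore this. *)
Lemma eval_for x i N d b s (I : nat -> store -> Prop) :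
  wfb (BFor i N d b) -> I 0 s ->
  (forall j s' k, I j s' -> I j (setv s' i k)) ->
  (forall j s' k, I j s' -> I j (setv s' d k)) ->
  (forall j s', j < var s N -> var s' i = j ->
     (forall v, ~~ modv (BFor i N d b) v -> var s' v = var s v) ->
     (forall A k, ~~ moda (BFor i N d b) A -> arr s' A k = arr s A k) ->
     I j s' -> I j.+1 (eval x b s')) ->
  I (var s N) (eval x (BFor i N d b) s).
Proof.
move=> w I0 stab_i stab_d IS; have /and5P[i48 N48 d48 iN /and5P[id Nd bi bN wb]] := w.
have := @eval_for_ind x i N d b s (fun k s' => I k s' /\
  (forall v, ~~ [|| v == i, v == d | modv b v] -> var s' v = var s v) /\
  (forall A j, ~~ moda b A -> arr s' A j = arr s A j)) w.
move=> /(_ (fun s m => evalv x s wb m) (fun s m => evalv x s wb m)) H.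
have [||_ _ _ []] // := H _ _ (var s N) (leqnn _).
  split; first by apply: stab_d; apply: stab_i.
  split=> // v; rewrite !negb_or => /and3P[vi vd _] /=.
  by rewrite (negPf vi) (negPf vd).
move=> j s' jN e1 e2 [h0 [h1 h2]]; split; last first.
  split=> [v mv|A k mA] /=; last by rewrite evala // h2.
  have := mv; rewrite !negb_or => /and3P[vi vd vb].
  by rewrite (negPf vi) (negPf vd) evalv // h1.
by apply: (stab_d); apply: (stab_i); apply: (stab_d); apply: IS.
Qed.

Lemma run_while_iter x c a s f (k B : nat) :
  (forall j, j < k -> var (iter j f s) a != 0 /\
     exists2 t, t <= B & run x c (iter j f s) t (f (iter j f s))) ->
  var (iter k f s) a = 0 ->
  exists2 t, t <= k * (B + 2) + 1 & run x (CWhile a c) s t (iter k f s).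
Proof.
elim: k s => [|k IH] s H h0; first by exists 1 => //; apply: RWhileF.
have [a0 [t tB r]] := H 0 isT; rewrite iterSr in h0 *.
have [j jk|t' t'B r'] := IH (f s) _ h0; first by rewrite -iterSr; apply: H.
by exists (t + t' + 2); [nia|apply: RWhileT a0 r r'].
Qed.

(** No loop bound is modified by [b], so its value in the initial store is the one that every inner
    loop finds. *)
Lemma run_blk x b s p : wfb b ->
  (forall N, N \in bounds b -> ~~ modv b N /\ var s N <= p) ->
  exists2 t, t <= cost p b & run x (to_cmd b) s t (eval x b s).
Proof.
elim: b s => /= [|a|b1 IH1 b2 IH2|a b1 IH1 b2 IH2|i N d b IH] s.
- by exists 0 => //; apply: RSkip.
- by exists (asize a) => //; apply: RAtom.
- case/andP=> w1 w2 bd.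
  have [|t1 t1b r1] := IH1 s w1.
    move=> N hN; have := bd N; rewrite mem_cat hN => /(_ isT)[].
    by rewrite negb_or => /andP[-> _].
  have [|t2 t2b r2] := IH2 (eval x b1 s) w2.
    move=> N hN; have := bd N; rewrite mem_cat hN orbT => /(_ isT)[].
    by rewrite negb_or => /andP[m1 ->]; rewrite evalv.
  by exists (t1 + t2); [apply: leq_add|apply: RSeq r1 r2].
- case/and3P=> _ w1 w2 bd; have [a0|a0] := eqVneq (var s a) 0 => /=.
    have [|t2 t2b r2] := IH2 s w2.
      move=> N hN; have := bd N; rewrite mem_cat hN orbT => /(_ isT)[].
      by rewrite negb_or => /andP[_ ->].
    by exists (t2 + 1); [lia|apply: RIfF].
  have [|t1 t1b r1] := IH1 s w1.
    move=> N hN; have := bd N; rewrite mem_cat hN => /(_ isT)[].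
    by rewrite negb_or => /andP[-> _].
  by exists (t1 + 2); [lia|apply: RIfT].
move=> w bd; have /and5P[i48 N48 d48 iN /and5P[id Nd bi bN wb]] := w.
have [_ Np] := bd N (mem_head _ _).
pose f s' := next_round i N d (eval x b s').
pose s0 := setv (setv s i 0) d (var s N).
have inv := @eval_for_ind x i N d b s (fun k s' =>
  forall v, v != i -> v != d -> ~~ modv b v -> var s' v = var s v) w
  (fun s m => evalv x s wb m) (fun s m => evalv x s wb m).
have {}inv k : k <= var s N -> [/\ var (iter k f s0) i = k,
     var (iter k f s0) N = var s N, var (iter k f s0) d = var s N - k &
     forall v, v != i -> v != d -> ~~ modv b v -> var (iter k f s0) v = var s v].
  apply: inv.
    by move=> v /negPf vi /negPf vd _ /=; rewrite vi vd.
  move=> j s' _ _ _ h v vi vd vb /=.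
  by rewrite (negPf vi) (negPf vd) evalv // h.
have [||t tb r] := @run_while_iter x (CSeq (to_cmd b) (CSeq (CAtom (SetC d 1))
  (CSeq (CAtom (AddV i i d)) (CAtom (SubV d N i))))) d s0 f (var s N) (cost p b + 3).
- move=> j jN; have [e1 e2 e3 e4] := inv j (ltnW jN); split; first by rewrite e3 -lt0n subn_gt0.
  have [|t tb r] := IH (iter j f s0) wb.
    move=> M hM; have [] := bd M; first by rewrite inE hM orbT.
    by rewrite !negb_or => /and3P[mi md mb] Mp; rewrite mb e4.
  exists (t + (1 + (1 + 1))); first by lia.
  apply: RSeq r _; apply: RSeq; first exact: RAtom.
  apply: RSeq; first exact: RAtom.
  have nr s' : next_round i N d s' = exec_atom x (SubV d N i)
      (exec_atom x (AddV i i d) (exec_atom x (SetC d 1) s')).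
    by rewrite /next_round /= !eqxx (negPf id).
  by rewrite /f nr; apply: RAtom.
- by have [_ _ -> _] := inv _ (leqnn _); rewrite subnn.
exists (1 + (1 + t)).
  have : var s N * (cost p b + 3 + 2) <= p * (cost p b + 5) by rewrite -addnA leq_mul2r Np orbT.
  by lia.
apply: RSeq; first exact: RAtom.
apply: RSeq; first exact: RAtom.
by rewrite /= eqxx subn0 eq_sym (negPf iN).
Qed.

Fixpoint depth (b : blk) : nat :=
  match b with
  | BSkip | BAtom _ => 0
  | BSeq b1 b2 | BIf _ b1 b2 => maxn (depth b1) (depth b2)
  | BFor _ _ _ b => (depth b).+1
  end.

Fixpoint weight (b : blk) : nat :=
  match b with
  | BSkip => 0
  | BAtom a => asize a
  | BSeq b1 b2 => weight b1 + weight b2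
  | BIf _ b1 b2 => weight b1 + weight b2 + 2
  | BFor _ _ _ b => weight b + 8
  end.

Lemma cost_bound p b : 0 < p -> cost p b <= weight b * p ^ depth b.
Proof.
move=> p0; have pw k : 0 < p ^ k by rewrite expn_gt0 p0.
have pm k l : p ^ k <= p ^ maxn k l /\ p ^ l <= p ^ maxn k l.
  by rewrite !leq_pexp2l // ?leq_maxl ?leq_maxr.
elim: b => //= [a|b1 IH1 b2 IH2|a b1 IH1 b2 IH2|i N d b IH].
- by rewrite muln1.
- by have [] := pm (depth b1) (depth b2); nia.
- by have [] := pm (depth b1) (depth b2); have := pw (maxn (depth b1) (depth b2)); nia.
- by rewrite expnS; have := pw (depth b); nia.
Qed.

Fixpoint cmodv (c : cmd) (v : nat) : bool :=
  match c with
  | CSkip => false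
  | CAtom a => modv_atom a v
  | CSeq c1 c2 | CIf _ c1 c2 => cmodv c1 v || cmodv c2 v
  | CWhile _ c1 => cmodv c1 v
  end.

Fixpoint cmoda (c : cmd) (A : nat) : bool :=
  match c with
  | CSkip => false
  | CAtom a => moda_atom a A
  | CSeq c1 c2 | CIf _ c1 c2 => cmoda c1 A || cmoda c2 A
  | CWhile _ c1 => cmoda c1 A
  end.

Lemma run_frame x c s t s' : run x c s t s' ->
  (forall v, ~~ cmodv c v -> var s' v = var s v) /\
  (forall A j, ~~ cmoda c A -> arr s' A j = arr s A j).
Proof.
elim=> {c s t s'} //=.
- by move=> a s; case: a => /= *; split=> //= v; [..|move=> j]; move=> /negPf ->.
- move=> c1 c2 s1 s2 s3 t1 t2 _ [v1 a1] _ [v2 a2]; split=> [v|A j].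
    by rewrite negb_or => /andP[m1 m2]; rewrite v2 // v1.
  by rewrite negb_or => /andP[m1 m2]; rewrite a2 // a1.
- move=> a c1 c2 s s' t _ _ [v1 a1]; split=> [v|A j]; rewrite negb_or => /andP[m1 m2];
    by [apply: v1|apply: a1].
- move=> a c1 c2 s s' t _ _ [v1 a1]; split=> [v|A j]; rewrite negb_or => /andP[m1 m2];
    by [apply: v1|apply: a1].
- move=> a c s s' s'' t t' _ _ [v1 a1] _ [v2 a2]; split=> [v m|A j m].
    by rewrite v2 // v1.
  by rewrite a2 // a1.
Qed.

(** * The program *)

Notation v_res := 0 (only parsing).
Notation v_n := 1 (only parsing).
Notation v_r := 2 (only parsing).
Notation v_one := 3 (only parsing).
Notation v_n1 := 4 (only parsing).
Notation v_t := 5 (only parsing).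
Notation v_w := 6 (only parsing).
Notation v_y := 7 (only parsing).
Notation v_z := 8 (only parsing).
Notation v_i := 9 (only parsing).
Notation v_di := 10 (only parsing).
Notation v_j := 11 (only parsing).
Notation v_dj := 12 (only parsing).
Notation v_l := 13 (only parsing).
Notation v_dl := 14 (only parsing).
Notation v_cnt := 16 (only parsing).
Notation v_top := 17 (only parsing).
Notation v_size := 18 (only parsing).
Notation v_bad := 19 (only parsing).
Notation v_ca := 20 (only parsing).
Notation v_cb := 21 (only parsing).
Notation v_k := 22 (only parsing).
Notation v_carry := 23 (only parsing).
Notation v_lo := 24 (only parsing).
Notation v_hi := 25 (only parsing).
Notation v_lim := 26 (only parsing).
Notation v_e := 27 (only parsing).
Notation v_d := 28 (only parsing).
Notation v_cur := 29 (only parsing).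
Notation v_ok := 30 (only parsing).
Notation v_found := 31 (only parsing).
Notation v_f := 32 (only parsing).
Notation v_df := 33 (only parsing).
Notation v_same := 34 (only parsing).
Notation v_zero := 35 (only parsing).
Notation v_step := 36 (only parsing).
Notation v_dstep := 37 (only parsing).

Notation a_row := 0 (only parsing).
Notation a_blk := 1 (only parsing).
Notation a_dig := 2 (only parsing).
Notation a_rem := 3 (only parsing).
Notation a_cl := 4 (only parsing).
Notation a_ord := 5 (only parsing).
Notation a_done := 6 (only parsing).
Notation a_closed := 7 (only parsing).
Notation a_deg := 8 (only parsing).
Notation a_tab := 9 (only parsing).
Notation a_tmp := 10 (only parsing).

Infix ";;" := BSeq (at level 61, right associativity).
Notation BWhen a b := (BIf a b BSkip).
Notation BUnless a b := (BIf a BSkip b).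

(* a_row holds the offsets of the rows of the adjacency matrix in the input. *)
Definition get_adj d u v : blk := Get d a_row u ;; AddV d d v ;; Inp d d.

(** The sum of the two truncated differences is |a - b|. *)
Definition differ d t a b : blk := SubV d a b ;; SubV t b a ;; AddV d d t.

Definition p_init : blk :=
  SetC v_one 1 ;; Inp v_n v_zero ;; Inp v_r v_one ;; AddV v_n1 v_n v_one ;;
  SetC v_t 2 ;;
  BFor v_i v_n v_di (Put a_row v_i v_t ;; AddV v_t v_t v_n) ;;
  BFor v_i v_n v_di (Put a_blk v_i v_one).

(** The number 0 marks placed vertices, so the loop of [c_order] on [v_top] ends when all are
    placed. *)
Definition p_top : blk :=
  SetC v_top 0 ;;
  BFor v_i v_n v_di (Get v_t a_blk v_i ;; SubV v_w v_t v_top ;;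
    BWhen v_w (AddV v_top v_t v_zero)).

(** [a_dig] is a counter in base n + 1 that lists the candidate separators: the digit 0 selects
    nothing and the digit u + 1 selects the vertex u. Setting [v_bad] to 1 makes the search loop
    start. *)
Definition p_block_start : blk :=
  SetC v_size 0 ;; SetC v_bad 1 ;;
  BFor v_i v_n v_di (Put a_dig v_i v_zero ;; Get v_t a_blk v_i ;;
    SubV v_w v_top v_t ;; BUnless v_w (AddV v_size v_size v_one)).

(** The convention is inverted: the entry 0 marks the vertices that remain in the block. *)
Definition p_mark : blk :=
  BFor v_i v_n v_di (Get v_t a_blk v_i ;; SubV v_w v_top v_t ;; Put a_rem v_i v_w) ;;
  BFor v_i v_n v_di (Get v_t a_dig v_i ;;
    BWhen v_t (SubV v_t v_t v_one ;; Put a_rem v_t v_one)).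

(** Both labels are saved beforehand, as the loop overwrites them. *)
Definition p_merge : blk :=
  Get v_ca a_cl v_i ;; Get v_cb a_cl v_j ;;
  BFor v_l v_n v_dl (Get v_t a_cl v_l ;; differ v_y v_z v_t v_ca ;;
    BUnless v_y (Put a_cl v_l v_cb)).

Definition p_comp : blk :=
  BFor v_i v_n v_di (Put a_cl v_i v_i) ;;
  BFor v_i v_n v_di (Get v_t a_rem v_i ;; BUnless v_t
    (BFor v_j v_n v_dj (Get v_t a_rem v_j ;; BUnless v_t
      (get_adj v_t v_i v_j ;; BWhen v_t p_merge)))).

Definition p_test : blk :=
  SetC v_bad 0 ;;
  BFor v_i v_n v_di (Get v_t a_rem v_i ;; BUnless v_t
    (Get v_ca a_cl v_i ;; SetC v_k 0 ;;
     BFor v_j v_n v_dj (Get v_t a_rem v_j ;; BUnless v_t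
       (Get v_t a_cl v_j ;; differ v_y v_z v_t v_ca ;;
        BUnless v_y (AddV v_k v_k v_one ;; AddV v_k v_k v_one))) ;;
     SubV v_y v_k v_size ;; BWhen v_y (SetC v_bad 1))).

Definition p_next : blk :=
  SetC v_carry 1 ;;
  BFor v_i v_n v_di (Get v_t a_dig v_i ;; AddV v_t v_t v_carry ;;
    SubV v_y v_t v_n ;; SetC v_carry 0 ;;
    BWhen v_y (SetC v_t 0 ;; SetC v_carry 1) ;; Put a_dig v_i v_t).

(** The counter advances even after a success. This is harmless, as [p_split] reads the result from
    [a_rem] and [a_cl]. *)
Definition p_try : blk := p_mark ;; p_comp ;; p_test ;; p_next.

(** The new block numbers exceed [v_top]; so they differ from all numbers in use, and the parts of
    this block are treated before the older blocks. *)
Definition p_split : blk :=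
  BFor v_i v_n v_di (Get v_t a_blk v_i ;; SubV v_w v_top v_t ;; BUnless v_w
    (Get v_t a_rem v_i ;; BIf v_t
      (Put a_blk v_i v_zero ;; Put a_ord v_cnt v_i ;; AddV v_cnt v_cnt v_one)
      (Get v_t a_cl v_i ;; AddV v_t v_t v_top ;; AddV v_t v_t v_one ;;
       Put a_blk v_i v_t))).

Definition c_order : cmd :=
  CSeq (to_cmd p_top) (CWhile v_top
    (CSeq (to_cmd p_block_start) (CSeq (CWhile v_bad (to_cmd p_try))
      (CSeq (to_cmd p_split) (to_cmd p_top))))).

(** With [v_hi] set to n + 1, the untouched zeros of [a_tab] become the first table, whose only
    record is that of the empty set. *)
Definition p_degrees : blk :=
  BFor v_i v_n v_di (SetC v_k 0 ;;
    BFor v_j v_n v_dj (get_adj v_t v_i v_j ;; AddV v_k v_k v_t) ;;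
    Put a_deg v_i v_k) ;;
  AddV v_hi v_n1 v_zero.

(** The current table fills the cells from [v_lo] to [v_lim], and the next one grows right behind
    it, from [v_lim] to [v_hi]. *)
Definition p_stage_start : blk :=
  Get v_cur a_ord v_step ;; Put a_done v_cur v_one ;;
  BFor v_i v_n v_di (Get v_k a_done v_i ;;
    BFor v_j v_n v_dj (get_adj v_t v_i v_j ;;
      BWhen v_t (Get v_t a_done v_j ;; BUnless v_t (SetC v_k 0))) ;;
    Put a_closed v_i v_k) ;;
  AddV v_lim v_hi v_zero ;; AddV v_e v_lo v_zero ;; SubV v_d v_lim v_e.

Definition p_copy : blk :=
  BFor v_i v_n1 v_di (AddV v_t v_e v_i ;; Get v_t a_tab v_t ;; Put a_tmp v_i v_t).

Definition p_select : blk :=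
  BFor v_i v_n v_di (get_adj v_t v_cur v_i ;; Get v_y a_tmp v_i ;;
    AddV v_y v_y v_t ;; Put a_tmp v_i v_y) ;;
  Get v_y a_tmp v_cur ;; AddV v_y v_y v_n ;; Put a_tmp v_cur v_y ;;
  Get v_y a_tmp v_n ;; AddV v_y v_y v_one ;; Put a_tmp v_n v_y.

(** After its condition is checked, the counter of a closed vertex is set to 0, so that partial
    alliances with the same future share one record. *)
Definition p_check : blk :=
  SetC v_ok 1 ;;
  BFor v_i v_n v_di (Get v_t a_closed v_i ;; BWhen v_t
    (Get v_y a_tmp v_i ;; BWhen v_y
       (Get v_z a_deg v_i ;; AddV v_z v_z v_one ;; AddV v_z v_z v_one ;;
        AddV v_y v_y v_y ;; SubV v_z v_z v_y ;; BWhen v_z (SetC v_ok 0)) ;;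
     Put a_tmp v_i v_zero)) ;;
  SetC v_found 0 ;; AddV v_f v_lim v_zero ;; SubV v_df v_hi v_f.

Definition p_compare : blk :=
  SetC v_same 1 ;;
  BFor v_i v_n1 v_di (AddV v_t v_f v_i ;; Get v_t a_tab v_t ;; Get v_y a_tmp v_i ;;
    differ v_z v_w v_t v_y ;; BWhen v_z (SetC v_same 0)) ;;
  BWhen v_same (SetC v_found 1) ;;
  AddV v_f v_f v_n1 ;; SubV v_df v_hi v_f.

Definition p_append : blk :=
  BWhen v_ok (BUnless v_found
    (BFor v_i v_n1 v_di (AddV v_t v_hi v_i ;; Get v_y a_tmp v_i ;; Put a_tab v_t v_y) ;;
     AddV v_hi v_hi v_n1)).

(** Used twice for each record: [pre] produces either a plain copy, where the current vertex is left
    out, or the copy in which it is selected. *)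
Definition c_insert (pre : blk) : cmd :=
  CSeq (to_cmd (pre ;; p_check)) (CSeq (CWhile v_df (to_cmd p_compare)) (to_cmd p_append)).

Definition p_advance : blk := AddV v_e v_e v_n1 ;; SubV v_d v_lim v_e.

Definition c_stage : cmd :=
  CSeq (to_cmd p_stage_start) (CSeq (CWhile v_d
    (CSeq (c_insert p_copy) (CSeq (c_insert (p_copy ;; p_select)) (to_cmd p_advance))))
    (to_cmd (AddV v_lo v_lim v_zero ;; AddV v_step v_step v_one ;;
             SubV v_dstep v_n v_step))).

Definition p_accept_start : blk := AddV v_e v_lo v_zero ;; SubV v_d v_hi v_e.

Definition p_accept : blk :=
  AddV v_t v_e v_n ;; Get v_t a_tab v_t ;;
  BWhen v_t (SubV v_y v_t v_r ;; BUnless v_y (SetC v_res 1)) ;;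
  AddV v_e v_e v_n1 ;; SubV v_d v_hi v_e.

Definition c_main : cmd :=
  CSeq (to_cmd p_init) (CSeq c_order (CSeq (to_cmd (p_degrees ;; SubV v_dstep v_n v_step))
    (CSeq (CWhile v_dstep c_stage) (CSeq (to_cmd p_accept_start)
      (CWhile v_d (to_cmd p_accept)))))).

Lemma wf_main : wf c_main.
Proof. by []. Qed.

(** * The vertex order *)

Section Blocks.
Variables (n : nat) (G : sgraph 'I_n) (r : nat).
Let x := encode G r.

Definition adjn (u v : nat) : nat := nth 0 x (2 + u * n + v).

Lemma adjnE (u v : 'I_n) : adjn u v = G u v.
Proof.
rewrite /adjn /x /encode -addnA /=.
set e := enum 'I_n; have se : size e = n by rewrite size_enum_ord.
have gen (E : seq 'I_n) k : k < size E ->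
    nth 0 [seq nat_of_bool (G i j) | i <- E, j <- e] (k * n + v) = G (nth u E k) v.
  elim: E k => //= a E IH [|k] hk.
    by rewrite nth_cat size_map se ltn_ord (nth_map v) ?se ?ltn_ord // nth_ord_enum.
  rewrite nth_cat size_map se ltnNge mulSn -addnA leq_addr /= addKn.
  exact: IH.
by rewrite (gen e u) ?se // nth_ord_enum.
Qed.

Definition ctx (s : store) : Prop :=
  [/\ var s v_n = n, var s v_n1 = n.+1, var s v_one = 1, var s v_zero = 0 &
      var s v_r = r /\ forall u, u < n -> arr s a_row u = 2 + u * n].

Lemma ctx_same s s' :
  (forall v, v \in [:: v_n; v_n1; v_one; v_zero; v_r] -> var s' v = var s v) ->
  (forall k, arr s' a_row k = arr s a_row k) -> ctx s -> ctx s'.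
Proof.
move=> h1 h2 [e1 e2 e3 e4 [e5 e6]].
by split; rewrite ?h1 //; split=> [|u un]; rewrite ?h1 // h2 e6.
Qed.

Lemma ctx_eval b s : wfb b ->
  all (fun v => ~~ modv b v) [:: v_n; v_n1; v_one; v_zero; v_r] -> ~~ moda b a_row ->
  ctx s -> ctx (eval x b s).
Proof.
move=> w /allP mv ma; apply: ctx_same => [v /mv hv|k]; [exact: evalv|exact: evala].
Qed.

Lemma evalS b1 b2 s : eval x (b1 ;; b2) s = eval x b2 (eval x b1 s).
Proof. by []. Qed.

Lemma evalF a b1 b2 s : var s a = 0 -> eval x (BIf a b1 b2) s = eval x b2 s.
Proof. by move=> /= ->. Qed.

Lemma evalT a b1 b2 s : var s a != 0 -> eval x (BIf a b1 b2) s = eval x b1 s.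
Proof. by move=> /= ->. Qed.

Lemma eval_forn i N d b s m (I : nat -> store -> Prop) :
  wfb (BFor i N d b) -> var s N = m -> I 0 s ->
  (forall j s' k, I j s' -> I j (setv s' i k)) ->
  (forall j s' k, I j s' -> I j (setv s' d k)) ->
  (forall j s', j < m -> var s' i = j ->
     (forall v, ~~ modv (BFor i N d b) v -> var s' v = var s v) ->
     (forall A k, ~~ moda (BFor i N d b) A -> arr s' A k = arr s A k) ->
     I j s' -> I j.+1 (eval x b s')) ->
  I m (eval x (BFor i N d b) s).
Proof. by move=> w <-; apply: eval_for. Qed.

Lemma get_adjE d u v s : d != v -> ctx s -> var s u < n ->
  var (eval x (get_adj d u v) s) d = adjn (var s u) (var s v).
Proof.
move=> dv [_ _ _ _ [_ row]] un; rewrite /get_adj !evalS /= !eqxx eq_sym (negPf dv).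
by rewrite row.
Qed.

Lemma differE d t a b s : t != a -> t != b -> d != a -> d != b -> d != t ->
  (var (eval x (differ d t a b) s) d == 0) = (var s a == var s b).
Proof.
move=> ta tb da db dt; rewrite /differ !evalS /= !eqxx.
by rewrite [b == d]eq_sym [a == d]eq_sym (negPf da) (negPf db) (negPf dt); lia.
Qed.

Lemma p_topP s : ctx s -> let s' := eval x p_top s in
  (forall u, u < n -> arr s a_blk u <= var s' v_top) /\
  (var s' v_top = 0 \/ exists2 u, u < n & arr s a_blk u = var s' v_top).
Proof.
move=> [hn _ _ hz _]; rewrite /p_top evalS; set s1 := eval x (SetC _ _) s.
pose I j s' := (forall u, u < j -> arr s a_blk u <= var s' v_top) /\
  (var s' v_top = 0 \/ exists2 u, u < j & arr s a_blk u = var s' v_top).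
apply: (@eval_forn _ _ _ _ s1 n I) => //; first by split=> //; left.
move=> j s' jn ij fv fa [h1 h2] /=; rewrite ij fa //= (fv v_zero isT) /= hz addn0.
case: eqP => /= e; split=> /=.
- by move=> u; rewrite ltnS leq_eqVlt => /orP[/eqP->|/h1//]; lia.
- by case: h2 => [->|[u uj hu]]; [left|right; exists u => //; apply: ltnW].
- move=> u; rewrite ltnS leq_eqVlt => /orP[/eqP->//|/h1]; lia.
- by right; exists j.
Qed.

Lemma count_iotaS (P : pred nat) j : count P (iota 0 j.+1) = count P (iota 0 j) + P j.
Proof. by rewrite -addn1 iotaD count_cat /= addn0. Qed.

Lemma has_iotaS (P : pred nat) j : has P (iota 0 j.+1) = has P (iota 0 j) || P j.
Proof. by rewrite -addn1 iotaD has_cat /= orbF. Qed.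

Lemma ltnS_cases (P : nat -> Prop) j : (forall u, u < j -> P u) -> P j ->
  forall u, u < j.+1 -> P u.
Proof. by move=> h1 h2 u; rewrite ltnS leq_eqVlt => /orP[/eqP->|/h1]. Qed.

Lemma p_block_startP s : ctx s -> let s' := eval x p_block_start s in
  [/\ var s' v_size = count (fun u => var s v_top <= arr s a_blk u) (iota 0 n),
      var s' v_bad = 1 & forall u, u < n -> arr s' a_dig u = 0].
Proof.
move=> [hn _ h1 hz _]; rewrite /p_block_start 2!evalS; set s1 := eval x _ (eval x _ s).
pose I j s' :=
  [/\ var s' v_size = count (fun u => var s v_top <= arr s a_blk u) (iota 0 j),
      var s' v_bad = 1 & forall u, u < j -> arr s' a_dig u = 0].
apply: (@eval_forn _ _ _ _ s1 n I) => // j s' jn ij fv fa [e1 e2 e3].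
rewrite /= (fv v_top isT) (fa a_blk _ isT) ij /= /I count_iotaS.
case: (posnP (var s v_top - arr s a_blk j)) => /= e; split=> //=.
- by rewrite e1 (fv v_one isT) /= h1 -subn_eq0 e.
- by apply: ltnS_cases => [u uj|]; rewrite ?eqxx /= (fv v_zero isT) /= hz // e3 ?if_same.
- rewrite -subn_eq0; case: eqP => [e0|_]; first by rewrite e0 in e.
  by rewrite /= e1 addn0.
- by apply: ltnS_cases => [u uj|]; rewrite ?eqxx /= (fv v_zero isT) /= hz // e3 ?if_same.
Qed.

Lemma p_markP s : ctx s -> let s' := eval x p_mark s in
  forall u, u < n -> (arr s' a_rem u == 0) =
    (var s v_top <= arr s a_blk u) && ~~ has (fun i => arr s a_dig i == u.+1) (iota 0 n).
Proof.
move=> cs; have [hn _ h1 hz _] := cs; rewrite /p_mark evalS; set s1 := eval x _ s.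
have r1 u : u < n -> arr s1 a_rem u = var s v_top - arr s a_blk u.
  move: u; pose I j s' := forall u, u < j -> arr s' a_rem u = var s v_top - arr s a_blk u.
  apply: (@eval_forn _ _ _ _ s n I) => // j s' jn ij fv fa e u.
  rewrite ltnS leq_eqVlt /= ij => /orP[/eqP->|uj].
    by rewrite eqxx (fa a_blk _ isT) (fv v_top isT).
  by rewrite ltn_eqF // e.
pose I j s' := forall u, u < n -> (arr s' a_rem u == 0) =
   (var s v_top <= arr s a_blk u) && ~~ has (fun i => arr s a_dig i == u.+1) (iota 0 j).
apply: (@eval_forn _ _ _ _ s1 n I) => //.
- by rewrite evalv.
- by move=> u un; rewrite r1 //= andbT subn_eq0.
move=> j s' jn ij fv fa e u un; rewrite has_iotaS negb_or andbA -e //=.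
rewrite ij (fa a_dig _ isT) /s1 evala //.
case: (posnP (arr s a_dig j)) => [->|dj] /=; first by rewrite andbT.
rewrite (fv v_one isT) evalv // h1 subn1 -{2}(prednK dj) eqSS [_ == u]eq_sym.
by case: (u =P _); rewrite ?andbF ?andbT.
Qed.

Lemma p_mergeP s : ctx s -> let s' := eval x p_merge s in
  forall w, w < n -> arr s' a_cl w =
    if arr s a_cl w == arr s a_cl (var s v_i) then arr s a_cl (var s v_j)
    else arr s a_cl w.
Proof.
move=> cs; have [hn _ h1 hz _] := cs; rewrite /p_merge 2!evalS; set s1 := eval x _ (eval x _ s).
pose upd w := if arr s a_cl w == arr s a_cl (var s v_i) then arr s a_cl (var s v_j)
    else arr s a_cl w.
pose I j s' := forall w, w < n -> arr s' a_cl w = if w < j then upd w else arr s a_cl w.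
suff : I n (eval x (BFor v_l v_n v_dl (Get v_t a_cl v_l ;; differ v_y v_z v_t v_ca ;;
    BUnless v_y (Put a_cl v_l v_cb))) s1) by move=> h w wn; rewrite h // wn.
apply: (@eval_forn _ _ _ _ s1 n I) => // j s' jn ij fv fa e w wn.
rewrite 2!evalS; set s2 := eval x (Get _ _ _) s'.
have dE := @differE v_y v_z v_t v_ca s2 isT isT isT isT isT.
rewrite [eval x (BIf _ _ _) _]/= dE /= ij e // ltnn (fv v_ca isT) /=.
rewrite ltnS leq_eqVlt; case: (eqVneq w j) => [->|wj] /=.
  by rewrite /upd; case: eqP => /= _; rewrite ?eqxx ?(fv v_cb isT) //= e // ltnn.
by case: eqP => /= _; rewrite ?(negPf wj) e.
Qed.

(** The carry out of the last digit stays in the equation, so that overflow is a matter for the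
    caller. *)
Lemma p_nextP s : ctx s -> (forall i, i < n -> arr s a_dig i <= n) ->
  let s' := eval x p_next s in
  (forall i, i < n -> arr s' a_dig i <= n) /\
  \sum_(i < n) arr s' a_dig i * n.+1 ^ i + var s' v_carry * n.+1 ^ n =
  \sum_(i < n) arr s a_dig i * n.+1 ^ i + 1.
Proof.
move=> cs dn; have [hn _ h1 hz _] := cs; rewrite /p_next evalS; set s1 := eval x _ s.
pose I j s' := [/\ forall i, i < n -> arr s' a_dig i <= n,
   forall i, j <= i -> arr s' a_dig i = arr s a_dig i, var s' v_carry <= 1 &
  \sum_(i < j) arr s' a_dig i * n.+1 ^ i + var s' v_carry * n.+1 ^ j =
  \sum_(i < j) arr s a_dig i * n.+1 ^ i + 1].
suff : I n (eval x (BFor v_i v_n v_di (Get v_t a_dig v_i ;; AddV v_t v_t v_carry ;;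
    SubV v_y v_t v_n ;; SetC v_carry 0 ;;
    BWhen v_y (SetC v_t 0 ;; SetC v_carry 1) ;; Put a_dig v_i v_t)) s1) by case.
apply: (@eval_forn _ _ _ _ s1 n I) => //.
move=> j s' jn ij fv fa [e1 e2 e3 e4]; rewrite /= ij (fv v_n isT) /= hn e2 //.
have ne (F : nat -> nat) k (H : forall i, i < j -> F i = arr s' a_dig i) :
    \sum_(i < j) F i * k ^ i = \sum_(i < j) arr s' a_dig i * k ^ i.
  by apply: eq_bigr => i _; rewrite H.
have pS : n.+1 ^ j.+1 = n.+1 * n.+1 ^ j by rewrite expnS.
have := dn j jn => dj.
case: (posnP (arr s a_dig j + var s' v_carry - n)) => /= h.
  have h' : arr s a_dig j + var s' v_carry <= n by rewrite -subn_eq0 h.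
  split=> //=; rewrite ?ij.
  - by move=> i iN; case: eqP => // _; apply: e1.
  - by move=> i ji; rewrite gtn_eqF // e2 // ltnW.
  - rewrite !big_ord_recr /= eqxx addn0 mulnDl.
    rewrite (ne (fun i => if i == j then _ else arr s' a_dig i)) => [|i ij']; last by rewrite ltn_eqF.
    by rewrite addnCA e4 addnCA addnA.
have h' : arr s a_dig j = n /\ var s' v_carry = 1 by lia.
split=> //=; rewrite ?ij.
- by move=> i iN; case: eqP => // _; apply: e1.
- by move=> i ji; rewrite gtn_eqF // e2 // ltnW.
- rewrite !big_ord_recr /= eqxx mul0n addn0 mul1n pS.
  rewrite (ne (fun i => if i == j then _ else arr s' a_dig i)) => [|i ij']; last by rewrite ltn_eqF.
  by case: h' => hd hc; move: e4; rewrite hd hc mul1n mulSn addnA => ->; rewrite addnAC.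
Qed.

End Blocks.

(** * Labelling components and splitting a block *)

Section Components.
Variables (n : nat) (G : sgraph 'I_n) (r : nat).
Let x := encode G r.

Lemma count_iota_card (P : pred nat) : count P (iota 0 n) = #|[set u : 'I_n | P u]|.
Proof.
rewrite -val_enum_ord count_map cardE size_filter /= enumT.
by apply: eq_count => u; rewrite /= inE.
Qed.

(** The invariant of the merging loops: equal labels occur only within a component of [D], and the
    ends of the edges in [P], those already treated, have equal labels. Once [P] holds for all
    pairs, the label classes are the components. *)
Definition good_classes (D : {set 'I_n}) (P : 'I_n -> 'I_n -> bool) (c : nat -> nat) : Prop :=
  [/\ forall u, u < n -> c u < n,
      {in D &, forall u v : 'I_n, c u = c v -> linked G D u v} &
      {in D &, forall u v : 'I_n, G u v -> P u v -> c u = c v}].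

Lemma good_classes_sub (D : {set 'I_n}) (P P' : 'I_n -> 'I_n -> bool) c : {in D &, forall u v : 'I_n, G u v -> P' u v -> P u v} ->
  good_classes D P c -> good_classes D P' c.
Proof.
move=> sP [h1 h2 h3]; split=> // u v uD vD uv p; apply: h3 => //; exact: sP.
Qed.

Lemma good_classes_merge (D : {set 'I_n}) P c c' (i j : 'I_n) : good_classes D P c ->
  i \in D -> j \in D -> G i j ->
  (forall w, w < n -> c' w = if c w == c i then c j else c w) ->
  good_classes D (fun u v => P u v || (u == i) && (v == j)) c'.
Proof.
move=> [h1 h2 h3] iD jD ij hc; have lij := linked1 iD jD ij; split.
- by move=> u un; rewrite hc //; case: ifP => _; apply: h1.
- move=> u v uD vD; rewrite !hc //.
  case: eqP => [ui|_]; case: eqP => [vi|_] e.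
  + by apply: h2; rewrite ?ui ?vi.
  + by apply: linked_trans (h2 _ _ uD iD ui) (linked_trans lij (h2 _ _ jD vD e)).
  + apply: linked_trans (h2 _ _ uD jD e) (linked_trans (linkedC lij) _).
    by apply: h2; rewrite ?vi.
  + exact: h2.
- move=> u v uD vD uv /orP[p|/andP[/eqP-> /eqP->]]; first by rewrite !hc // (h3 u v).
  by rewrite !hc // eqxx if_same.
Qed.

Lemma p_compP s (D : {set 'I_n}) : ctx n r s ->
  (forall u : 'I_n, (arr s a_rem u == 0) = (u \in D)) ->
  let s' := eval x p_comp s in
  (forall u, u < n -> arr s' a_cl u < n) /\
  {in D &, forall u v : 'I_n, (arr s' a_cl u == arr s' a_cl v) = linked G D u v}.
Proof.
move=> cs remD; have [hn _ h1 hz _] := cs; rewrite /p_comp evalS; set s1 := eval x _ s.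
have cs1 : ctx n r s1 by apply: ctx_eval.
have c1 u : u < n -> arr s1 a_cl u = u.
  move: u; pose I j s' := forall u, u < j -> arr s' a_cl u = u.
  apply: (@eval_forn _ G r _ _ _ _ s n I) => // j s' jn ij fv fa e.
  by apply: ltnS_cases => [u uj|] /=; rewrite ij ?eqxx // ltn_eqF // e.
pose I j s' := good_classes D (fun u v : 'I_n => u < j) (arr s' a_cl).
suff : I n (eval x (BFor v_i v_n v_di (Get v_t a_rem v_i ;; BUnless v_t
    (BFor v_j v_n v_dj (Get v_t a_rem v_j ;; BUnless v_t
      (get_adj v_t v_i v_j ;; BWhen v_t p_merge))))) s1).
  move=> [k1 k2 k3]; split=> // u v uD vD; apply/eqP/idP; first exact: k2.
  set c := arr _ a_cl in k1 k2 k3 * => luv.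
  suff cl : {in D &, forall w w', G w w' -> w \in [set w : 'I_n | c u == c w] ->
      w' \in [set w : 'I_n | c u == c w]}.
    by have := linked_closed cl luv; rewrite !inE eqxx => /(_ isT)/eqP.
  move=> w w' wD wD' ww'; rewrite !inE => /eqP->.
  by apply/eqP; apply: k3.
apply: (@eval_forn _ G r _ _ _ _ s1 n I) => //.
- by have [] := cs1.
- by split=> // [u un|u v uD vD]; rewrite !c1 // => /val_inj ->; apply: connect0.
move=> i s' i_n ei fv fa IH; have cs' : ctx n r s'.
  by apply: ctx_same cs1 => [v|k]; [rewrite !inE => /or4P[|||/orP[]] /eqP->; apply: fv|apply: fa].
pose oi := Ordinal i_n.
have rem1 u : arr s1 a_rem u = arr s a_rem u by rewrite evala.
rewrite evalS; set s2 := eval x (Get _ _ _) s'.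
have [iD|iD] := boolP (oi \in D); last first.
  rewrite evalT; last by rewrite /= ei (fa a_rem _ isT) rem1 (remD oi) iD.
  apply: good_classes_sub IH => u v uD vD _; rewrite ltnS leq_eqVlt => /orP[/eqP ui|//].
  by move: uD; rewrite (_ : u = oi) ?(negPf iD) //; apply: val_inj.
rewrite evalF; last first.
  by apply/eqP; rewrite /= ei (fa a_rem _ isT) rem1 (remD oi).
have cs2 : ctx n r s2 by apply: ctx_eval.
pose I' j s' := good_classes D (fun u v : 'I_n => (u < i) || (u == oi) && (v < j)) (arr s' a_cl).
suff : I' n (eval x (BFor v_j v_n v_dj (Get v_t a_rem v_j ;; BUnless v_t
      (get_adj v_t v_i v_j ;; BWhen v_t p_merge))) s2).
  apply: good_classes_sub => u v uD vD _; rewrite ltnS leq_eqVlt orbC => /orP[->//|/eqP ui].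
  by rewrite ltn_ord andbT -val_eqE /= ui eqxx orbT.
apply: (@eval_forn _ G r _ _ _ _ s2 n I') => //.
- by have [] := cs2.
- by apply: good_classes_sub IH => u v _ _ _; rewrite andbF orbF.
move=> j s3 j_n ej fv' fa' IH'; have cs3 : ctx n r s3.
  by apply: ctx_same cs2 => [v|k]; [rewrite !inE => /or4P[|||/orP[]] /eqP->; apply: fv'|apply: fa'].
pose oj := Ordinal j_n.
have ei3 : var s3 v_i = i by rewrite (fv' v_i isT).
have skip : (oj \in D -> G oi oj -> False) -> I' j.+1 s3.
  move=> nj; apply: good_classes_sub IH' => u v uD vD uv /orP[->//|/andP[/eqP ui]].
  rewrite ltnS leq_eqVlt ui eqxx /= => /orP[/eqP vj|->]; last by rewrite orbT.
  have evj : v = oj by apply: val_inj.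
  by case: nj; rewrite -evj // -ui.
rewrite evalS; set s4 := eval x (Get _ _ _) s3.
have rem3 : arr s3 a_rem j = arr s a_rem j.
  by rewrite (fa' a_rem _ isT) evala // (fa a_rem _ isT) rem1.
have [jD|jD] := boolP (oj \in D); last first.
  rewrite evalT; last by rewrite /= ej rem3 (remD oj) jD.
  by apply: skip; rewrite (negPf jD).
rewrite evalF; last by apply/eqP; rewrite /= ej rem3 (remD oj).
have cs4 : ctx n r s4 by apply: ctx_eval.
rewrite evalS; set s5 := eval x (get_adj _ _ _) s4.
have cs5 : ctx n r s5 by apply: ctx_eval.
have t5 : var s5 v_t = G oi oj.
  rewrite /s5 (@get_adjE n G r) // [var s4 v_i]ei3 // [var s4 v_j]ej.
  by rewrite -(adjnE G r oi oj).
have [ij|ij] := boolP (G oi oj); last first.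
  by rewrite evalF ?t5 ?(negPf ij) //; apply: skip => _; rewrite (negPf ij).
rewrite evalT ?t5 ?ij //.
have hc w : w < n -> arr (eval x p_merge s5) a_cl w =
    if arr s3 a_cl w == arr s3 a_cl oi then arr s3 a_cl oj else arr s3 a_cl w.
  by move=> wn; rewrite (p_mergeP G cs5 wn) [var s5 v_i]ei3 [var s5 v_j]ej.
apply: good_classes_sub (good_classes_merge IH' iD jD ij hc) => u v uD vD uv /=.
rewrite -[v == oj]val_eqE /= => /orP[->//|/andP[->]] /=.
by rewrite ltnS leq_eqVlt => /orP[] ->; rewrite ?orbT.
Qed.

Lemma p_testP s : ctx n r s ->
  (var (eval x p_test s) v_bad == 0) =
  all (fun u => (arr s a_rem u == 0) ==>
    (2 * count (fun v => (arr s a_rem v == 0) && (arr s a_cl v == arr s a_cl u)) (iota 0 n)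
       <= var s v_size)) (iota 0 n).
Proof.
move=> cs; have [hn _ h1 hz _] := cs; rewrite /p_test evalS; set s1 := eval x _ s.
pose cnt u m := count (fun v => (arr s a_rem v == 0) && (arr s a_cl v == arr s a_cl u)) (iota 0 m).
pose I j s' := (var s' v_bad == 0) =
  all (fun u => (arr s a_rem u == 0) ==> (2 * cnt u n <= var s v_size)) (iota 0 j).
apply: (@eval_forn _ G r _ _ _ _ s1 n I) => // i s' i_n ei fv fa IH.
have allS P m : all P (iota 0 m.+1) = all P (iota 0 m) && P m.
  by rewrite -addn1 iotaD all_cat /= andbT.
rewrite /I allS -IH evalS; set s2 := eval x (Get _ _ _) s'.
have t2 : var s2 v_t = arr s a_rem i by rewrite /= ei (fa a_rem _ isT).
have [ri|ri] := eqVneq (arr s a_rem i) 0; last by rewrite evalT ?t2 // andbT.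
rewrite evalF ?t2 // implyTb 2!evalS; set s3 := eval x _ (eval x _ s2); rewrite evalS.
have ca3 : var s3 v_ca = arr s a_cl i by rewrite /= ei (fa a_cl _ isT).
set s4 := eval x (BFor _ _ _ _) s3.
have k4 : var s4 v_k = 2 * cnt i n.
  pose I' j s' := var s' v_k = 2 * cnt i j.
  apply: (@eval_forn _ G r _ _ _ _ s3 n I') => //.
    by rewrite [var s3 v_n](fv v_n isT).
  move=> j s5 j_n ej fv' fa' IH'; rewrite /I' /cnt count_iotaS mulnDr -IH'.
  rewrite evalS; set s6 := eval x (Get _ _ _) s5.
  have t6 : var s6 v_t = arr s a_rem j.
    by rewrite /= ej (fa' a_rem _ isT) [arr s3 a_rem j](fa a_rem _ isT).
  have [rj|rj] := eqVneq (arr s a_rem j) 0; last by rewrite evalT ?t6 //= muln0 addn0.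
  rewrite evalF ?t6 // evalS; set s7 := eval x (Get _ _ _) s6.
  have t7 : var s7 v_t = arr s a_cl j.
    by rewrite /= ej (fa' a_cl _ isT) [arr s3 a_cl j](fa a_cl _ isT).
  rewrite evalS.
  have y8 := @differE n G r v_y v_z v_t v_ca s7 isT isT isT isT isT.
  set s8 := eval x (differ _ _ _ _) s7 in y8 *.
  have ca7 : var s7 v_ca = arr s a_cl i by rewrite [LHS](fv' v_ca isT).
  rewrite t7 ca7 in y8; have [ej'|nj] := eqVneq (arr s a_cl j) (arr s a_cl i).
    rewrite evalF; last by apply/eqP; rewrite y8 ej' eqxx.
    by rewrite /= [var s5 v_one](fv' v_one isT) [var s3 v_one](fv v_one isT) [var s1 v_one]h1 -addnA.
  by rewrite evalT ?y8 //= muln0 addn0.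
have sz : var s4 v_size = var s v_size by rewrite /s4 evalv // [LHS](fv v_size isT).
have bad4 : var s4 v_bad = var s' v_bad by rewrite /s4 evalv.
rewrite evalS; set s5 := eval x (SubV _ _ _) s4.
have y5 : var s5 v_y = 2 * cnt i n - var s v_size by rewrite /= k4 sz.
have [le|gt] := leqP (2 * cnt i n) (var s v_size).
  by rewrite evalF ?y5 ?(eqP le) //= bad4 andbT.
by rewrite evalT ?y5 -?lt0n ?subn_gt0 //= andbF.
Qed.

Lemma p_splitP s : ctx n r s -> let s' := eval x p_split s in
  [/\ forall u, u < n -> arr s' a_blk u =
        if var s v_top <= arr s a_blk u then
          if arr s a_rem u == 0 then arr s a_cl u + var s v_top + 1 else 0
        else arr s a_blk u &
      mkseq (arr s' a_ord) (var s' v_cnt) = mkseq (arr s a_ord) (var s v_cnt) ++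
        [seq u <- iota 0 n | (var s v_top <= arr s a_blk u) && (arr s a_rem u != 0)]].
Proof.
move=> cs; have [hn _ h1 hz _] := cs; rewrite /p_split.
pose nb u := if var s v_top <= arr s a_blk u then
  if arr s a_rem u == 0 then arr s a_cl u + var s v_top + 1 else 0 else arr s a_blk u.
pose sel u := (var s v_top <= arr s a_blk u) && (arr s a_rem u != 0).
pose I j s' := [/\ forall u, u < j -> arr s' a_blk u = nb u,
  forall u, j <= u -> arr s' a_blk u = arr s a_blk u &
  mkseq (arr s' a_ord) (var s' v_cnt) =
    mkseq (arr s a_ord) (var s v_cnt) ++ [seq u <- iota 0 j | sel u]].
suff : I n (eval x p_split s) by case.
apply: (@eval_forn _ G r _ _ _ _ s n I) => //; first by split=> //=; rewrite cats0.
move=> i s' i_n ei fv fa [I1 I2 I3].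
have filtS : [seq u <- iota 0 i.+1 | sel u] =
    [seq u <- iota 0 i | sel u] ++ (if sel i then [:: i] else [::]).
  by rewrite -addn1 iotaD filter_cat.
rewrite /I filtS 2!evalS; set s2 := eval x (SubV _ _ _) _.
have w2 : var s2 v_w = var s v_top - arr s a_blk i.
  by rewrite /= ei I2 // (fv v_top isT).
have [lt|le] := ltnP (arr s a_blk i) (var s v_top).
  rewrite evalT ?w2 -?lt0n ?subn_gt0 // /sel leqNgt lt /= cats0; split=> //=.
    by apply: ltnS_cases => // ; rewrite I2 // /nb leqNgt lt.
  by move=> u iu; rewrite I2 // ltnW.
rewrite evalF ?w2 ?(eqP le) // evalS; set s3 := eval x (Get _ _ _) s2.
have t3 : var s3 v_t = arr s a_rem i by rewrite /= ei (fa a_rem _ isT).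
have nbi : nb i = if arr s a_rem i == 0 then arr s a_cl i + var s v_top + 1 else 0.
  by rewrite /nb le.
have [ri|ri] := eqVneq (arr s a_rem i) 0.
  rewrite ri eqxx in nbi; rewrite evalF ?t3 // /sel ri andbF cats0; split.
  - move=> u ui; rewrite /= ei; case: eqP => [->|ne].
      by rewrite nbi (fa a_cl _ isT) (fv v_top isT) (fv v_one isT) h1.
    by apply: I1; move: ui; rewrite ltnS leq_eqVlt => /orP[/eqP|].
  - by move=> u iu; rewrite /= ei gtn_eqF // I2 // ltnW.
  - by rewrite -I3.
rewrite (negPf ri) in nbi; rewrite evalT ?t3 // /sel le ri /=.
rewrite (fv v_one isT) h1 addn1 mkseqS /= eqxx -cats1 catA; split.
- move=> u ui; rewrite ei; case: eqP => [->|ne].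
    by rewrite nbi (fv v_zero isT).
  by apply: I1; move: ui; rewrite ltnS leq_eqVlt => /orP[/eqP|].
- by move=> u iu; rewrite ei gtn_eqF // I2 // ltnW.
- rewrite -I3 ei; congr (_ ++ _); apply/eq_in_map => u.
  by rewrite mem_iota add0n => /andP[_ ucnt]; rewrite ltn_eqF.
Qed.

End Components.

Lemma digits_lt p (a : nat -> nat) m : (forall i, i < m -> a i < p) ->
  \sum_(i < m) a i * p ^ i < p ^ m.
Proof.
elim: m => [|m IH] h; first by rewrite big_ord0.
rewrite big_ord_recr /= expnS.
have := IH (fun i im => h i (ltnW im)); have := h m (leqnn _); set S := bigop _ _ _.
by move: (p ^ m) => P; nia.
Qed.

Lemma digits_unique p (a b : nat -> nat) m :
  (forall i, i < m -> a i < p) -> (forall i, i < m -> b i < p) ->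
  \sum_(i < m) a i * p ^ i = \sum_(i < m) b i * p ^ i ->
  forall i, i < m -> a i = b i.
Proof.
elim: m => // m IH ha hb; rewrite !big_ord_recr /= => e.
have la := digits_lt (fun i im => ha i (ltnW im)).
have lb := digits_lt (fun i im => hb i (ltnW im)).
have am : a m = b m.
  by move: e la lb; set S := bigop _ _ _; set S' := bigop _ _ _; move: (p ^ m) => P; nia.
move=> i; rewrite ltnS leq_eqVlt => /orP[/eqP->//|]; move: i.
apply: IH => [i im|i im|]; [exact/ha/ltnW|exact/hb/ltnW|].
by move: e; rewrite am => /addIn.
Qed.

(** * Exhaustive search for a separator *)

Section Search.
Variables (n : nat) (G : sgraph 'I_n) (r : nat).
Let x := encode G r.

Definition block s : {set 'I_n} := [set u : 'I_n | var s v_top <= arr s a_blk u].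

Definition candidate s : {set 'I_n} :=
  [set u in block s | ~~ has (fun i => arr s a_dig i == u.+1) (iota 0 n)].

Definition halves (A D : {set 'I_n}) : bool :=
  [forall u in D, 2 * #|[set v | linked G D u v]| <= #|A|].

Lemma p_tryP s : ctx n r s -> (forall i, i < n -> arr s a_dig i <= n) ->
  var s v_size = #|block s| -> let s' := eval x p_try s in
  [/\ ctx n r s' /\ (forall u : 'I_n, (arr s' a_rem u == 0) = (u \in candidate s)),
      (forall u, u < n -> arr s' a_cl u < n) /\
      {in candidate s &, forall u v : 'I_n,
        (arr s' a_cl u == arr s' a_cl v) = linked G (candidate s) u v},
      (var s' v_bad == 0) = halves (block s) (candidate s),
      forall i, i < n -> arr s' a_dig i <= n &
      exists c, \sum_(i < n) arr s' a_dig i * n.+1 ^ i + c * n.+1 ^ n =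
                \sum_(i < n) arr s a_dig i * n.+1 ^ i + 1].
Proof.
move=> cs dn sz; rewrite /p_try 3!evalS.
set s1 := eval x p_mark s; set s2 := eval x p_comp s1; set s3 := eval x p_test s2.
have cs1 : ctx n r s1 by apply: ctx_eval.
have cs2 : ctx n r s2 by apply: ctx_eval.
have cs3 : ctx n r s3 by apply: ctx_eval.
have rem1 (u : 'I_n) : (arr s1 a_rem u == 0) = (u \in candidate s).
  by rewrite /s1 (p_markP G cs) // !inE.
have [cl_lt cl_eq] := p_compP G cs1 rem1; rewrite -/s2 in cl_lt cl_eq.
have test := p_testP G cs2; rewrite -/s3 in test.
have d3 i : arr s3 a_dig i = arr s a_dig i by rewrite /s3 /s2 /s1 !evala.
have dn3 i : i < n -> arr s3 a_dig i <= n by rewrite d3; apply: dn.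
have [dn4 sum4] := p_nextP G cs3 dn3; move: dn4 sum4.
set s4 := eval x p_next s3 => dn4 sum4.
have rem4 u : arr s4 a_rem u = arr s1 a_rem u by do 3!rewrite evala //.
have cl4 u : arr s4 a_cl u = arr s2 a_cl u by do 2!rewrite evala //.
split=> //.
- by split=> [|u]; [apply: ctx_eval|rewrite rem4].
- by split=> [u un|u v uD vD]; rewrite !cl4 ?cl_lt ?cl_eq.
- rewrite /s4 evalv // test; apply/allP/forall_inP => [h u uD|h u].
    have := h u; rewrite mem_iota add0n ltn_ord => /(_ isT)/implyP.
    rewrite [arr s2 a_rem u]evala // rem1 => /(_ uD).
    rewrite count_iota_card [var s2 v_size]evalv // [var s1 v_size]evalv // sz.
    congr (2 * _ <= _); apply: eq_card => v; rewrite !inE evala // rem1.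
    have [vD|vD] := boolP (v \in candidate s); first by rewrite eq_sym cl_eq.
    by apply/esym/negbTE; apply: contra vD => /linked_in; apply.
  rewrite mem_iota add0n => /andP[_ un]; apply/implyP.
  rewrite evala // (rem1 (Ordinal un)) => uD.
  rewrite count_iota_card [var s2 v_size]evalv // [var s1 v_size]evalv // sz.
  apply: leq_trans (h _ uD); rewrite leq_mul2l /=; apply: subset_leq_card.
  apply/subsetP => v; rewrite !inE evala // rem1 => /andP[vD].
  by rewrite eq_sym (cl_eq (Ordinal un) v).
- exists (var s4 v_carry); rewrite sum4; congr (_ + 1).
  by apply: eq_bigr => i _; rewrite d3.
Qed.

(** The loop knows neither [X] nor [k]. In round j the counter has the value j, so the loop ends at
    the latest with the round whose digits spell [X]. The set found may be another one, but it does
    not come later. *)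
Lemma p_search s (X : {set 'I_n}) (k : nat) : ctx n r s ->
  (forall i, i < n -> arr s a_dig i = 0) -> var s v_bad = 1 ->
  var s v_size = #|block s| -> #|X| <= k -> k <= n -> halves (block s) (block s :\: X) ->
  exists t s' (D : {set 'I_n}), [/\ run x (CWhile v_bad (to_cmd p_try)) s t s',
     t <= n.+1 ^ k * (cost n.+1 p_try + 2) + 1,
     [/\ D \subset block s, #|block s :\: D| <= k & halves (block s) D],
     (forall u : 'I_n, (arr s' a_rem u == 0) = (u \in D)) &
     (forall u, u < n -> arr s' a_cl u < n) /\
      {in D &, forall u v : 'I_n, (arr s' a_cl u == arr s' a_cl v) = linked G D u v}].
Proof.
move=> cs d0 bad0 sz Xk kn hX.
pose f s := eval x p_try s; pose st j := iter j f s.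
pose vl j := \sum_(i < n) arr (st j) a_dig i * n.+1 ^ i.
have blkE j : block (st j) = block s /\ var (st j) v_size = var s v_size.
  elim: j => // j [IH1 IH2]; rewrite -IH1 -IH2 /st iterS /f; split; last by rewrite evalv.
  by apply/setP => u; rewrite !inE evalv // evala.
have inv j : ctx n r (st j) /\ (forall i, i < n -> arr (st j) a_dig i <= n).
  elim: j => [|j [c1 d1]]; first by split=> // i un; rewrite d0.
  have [b1 b2] := blkE j.
  have := p_tryP c1 d1; rewrite b2 b1 => /(_ sz)[[c' _] _ _ d' _].
  by rewrite /st iterS.
have try j := p_tryP (inv j).1 (inv j).2 (etrans (blkE j).2 (etrans sz (congr1 (fun S : {set 'I_n} => #|S|) (esym (blkE j).1)))).
have val0 : vl 0 = 0 by rewrite /vl big1 // => i _; rewrite d0.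
have val_lt j : vl j < n.+1 ^ n by apply: digits_lt => i un; rewrite ltnS (inv j).2.
have valS j : j < n.+1 ^ n -> vl j = j.
  elim: j => // j IH jn; have vj := IH (ltnW jn).
  have [_ _ _ _ [c e]] := try j.
  have : vl j.+1 + c * n.+1 ^ n = vl j + 1 by rewrite /vl /st iterS.
  have := val_lt j.+1; rewrite vj; case: c {e} => [|c]; first by rewrite mul0n addn0 addn1.
  by rewrite mulSn; move: (n.+1 ^ n) jn => P; lia.
(* The digits that select [X], put in the lowest positions; the counter value [w] that they spell is
   below (n + 1)^k. *)
pose e := [seq (val u).+1 | u <- enum X].
have se : size e = #|X| by rewrite size_map cardE.
pose y i := nth 0 e i.
have y_lt i : y i < n.+1.
  have [ie|ie] := ltnP i (size e); last by rewrite /y nth_default.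
  by have /mapP[u _ eu] := mem_nth 0 ie; rewrite /y eu ltnS; apply: ltn_ord.
have y0 i : k <= i -> y i = 0.
  by move=> ki; rewrite /y nth_default // se (leq_trans Xk).
have mem_y (u : 'I_n) : has (fun i => y i == u.+1) (iota 0 n) = (u \in X).
  apply/hasP/idP => [[i _ /eqP yi]|uX].
    have [ie|ie] := ltnP i (size e); last by rewrite /y nth_default in yi.
    have := mem_nth 0 ie; rewrite -/(y i) yi => /mapP[v].
    by rewrite mem_enum => vX [] /val_inj ->.
  have ue : u.+1 \in e by apply: map_f; rewrite mem_enum.
  exists (index u.+1 e); last by rewrite /y nth_index.
  by rewrite mem_iota add0n (leq_trans _ kn) // (leq_trans _ Xk) // -se index_mem.
pose w := \sum_(i < n) y i * n.+1 ^ i.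
have wE : w = \sum_(i < k) y i * n.+1 ^ i.
  rewrite /w (big_ord_widen n (fun i => y i * n.+1 ^ i) kn) [RHS]big_mkcond.
  by apply: eq_bigr => i _; case: ltnP => // /y0 ->; rewrite mul0n.
have w_lt : w < n.+1 ^ k by rewrite wE; apply: digits_lt.
have kn_pow : n.+1 ^ k <= n.+1 ^ n by rewrite leq_pexp2l.
have bad_w : var (st w.+1) v_bad == 0.
  have vw : vl w = w by apply: valS; apply: leq_trans w_lt kn_pow.
  have dig i : i < n -> arr (st w) a_dig i = y i.
    by apply: (@digits_unique n.+1) => // i' hi'; rewrite ltnS (inv w).2.
  have [_ _ bd _ _] := try w; rewrite /st iterS -/(f _) -/(st w) {}bd.
  rewrite (blkE w).1.
  have -> : candidate (st w) = block s :\: X; last exact: hX.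
  apply/setP => u; rewrite inE (blkE w).1 !inE andbC -mem_y; congr (~~ _ && _).
  by apply: eq_in_has => i; rewrite mem_iota add0n => /andP[_ hi]; rewrite dig.
have ex : exists m, var (st m) v_bad == 0 by exists w.+1.
case: (ex_minnP ex) => m /eqP bad_m min_m.
have m_w : m <= w.+1 by apply: min_m.
have m0 : 0 < m by rewrite lt0n; apply: contra_eq_neq bad_m => ->; rewrite /st /= bad0.
have [|t tb r1] := @run_while_iter x (to_cmd p_try) v_bad s f m (cost n.+1 p_try) _ bad_m.
  move=> j jm; split.
    by apply/negP => /min_m; rewrite leqNgt jm.
  apply: run_blk => // N; rewrite !inE => hN.
  have [hn _ _ _ _] := (inv j).1.
  have -> : N = v_n by move: hN; rewrite /p_try /p_mark /p_comp /p_test /p_next /=; repeat case/orP; move=> /eqP.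
  by split=> //; rewrite -/(st j) hn.
(* The last round has already advanced the counter, so the set that it tested is read off from the
   store before it. *)
exists t, (st m), (candidate (st m.-1)).
have [[_ h2] h3 h4 _ _] := try m.-1.
have em : eval x p_try (st m.-1) = st m by rewrite -[in RHS](prednK m0) /st iterS.
rewrite em (blkE _).1 in h2 h3 h4.
split=> //.
- apply: leq_trans tb _; rewrite leq_add2r leq_mul2r; apply/orP; right.
  exact: leq_trans m_w w_lt.
- split; last by rewrite -h4 bad_m.
    by apply/subsetP => u; rewrite inE (blkE _).1 => /andP[].
  have vm : vl m.-1 = m.-1.
    by apply: valS; apply: leq_trans kn_pow; apply: leq_trans w_lt; rewrite prednK.
  (* A value below (n + 1)^k has no digits from position k on, so at most k vertices are
     selected. *)
  have dig0 i : k <= i -> i < n -> arr (st m.-1) a_dig i = 0.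
    move=> ki iN; apply/eqP; rewrite -leqn0 leqNgt; apply/negP => pos.
    have : n.+1 ^ k <= vl m.-1.
      rewrite /vl (bigD1 (Ordinal iN)) //=; apply: leq_trans (leq_addr _ _).
      by apply: leq_trans (leq_pmull _ pos); rewrite leq_pexp2l.
    by rewrite vm leqNgt; case/negP; apply: leq_trans w_lt; rewrite prednK.
  pose h (i : 'I_k) : {set 'I_n} := [set u : 'I_n | arr (st m.-1) a_dig i == u.+1].
  have sub : block s :\: candidate (st m.-1) \subset \bigcup_(i < k) h i.
    apply/subsetP => u; rewrite 2!inE (blkE _).1 => /andP[+ ub].
    rewrite ub /= negbK => /hasP[i]; rewrite mem_iota add0n => /andP[_ iN] di.
    have [ik|ki] := ltnP i k; last by rewrite dig0 // in di.
    by apply/bigcupP; exists (Ordinal ik); rewrite // inE.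
  apply: leq_trans (subset_leq_card sub) _.
  have : #|\bigcup_(i < k) h i| <= \sum_(i < k) #|h i|.
    elim/big_rec2: _ => [|i y1 y2 _ IH]; first by rewrite cards0.
    by apply: leq_trans (leq_card_setU _ _) _; rewrite leq_add2l.
  move=> le; apply: leq_trans le _.
  have ks : \sum_(i < k) 1 = k by rewrite sum_nat_const card_ord muln1.
  rewrite -[X in _ <= X]ks.
  apply: leq_sum => i _; apply/card_le1_eqP => u v; rewrite !inE => /eqP-> /eqP[].
  by move/val_inj.
Qed.

End Search.

(** * The frontier of the order and the budget of a block *)

Section Splitting.
Variables (n : nat) (G : sgraph 'I_n) (h f : nat -> nat) (K : nat).
Implicit Types (blk : nat -> nat) (out p : seq nat) (u v : 'I_n).

Definition frontier p : {set 'I_n} :=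
  [set u : 'I_n | (nat_of_ord u \in p) && [exists v : 'I_n, (nat_of_ord v \notin p) && G u v]].

Definition good_order p : Prop :=
  [/\ uniq p, forall w : nat, w \in p -> w < n &
      forall i, i <= size p -> #|frontier (take i p)| <= K].

(** Blocks with larger numbers are finished first, and their vertices have no neighbours in the
    other blocks. So these are the placed vertices that are still in the frontier when block [t] has
    its turn. *)
Definition blocks_below blk out t : {set 'I_n} :=
  [set u : 'I_n | (nat_of_ord u \in out) &&
    [exists v : 'I_n, [&& 0 < blk v, blk v <= t & G u v]]].

(* blk u is 0 once u is placed; before, it is the number of the block of u.  A block
   of a vertices may still contribute f a vertices to the frontier. *)
Record block_inv blk out : Prop := BlockInv {
  inv_order : good_order out;
  inv_out : forall u, (nat_of_ord u \in out) = (blk u == 0);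
  inv_edge : forall u v, G u v -> blk u != 0 -> blk v != 0 -> blk u = blk v;
  inv_budget : forall v, blk v != 0 ->
    #|blocks_below blk out (blk v)| + f #|[set u : 'I_n | blk u == blk v]| <= K }.

(** This counts the ordered pairs of unplaced vertices in a common block, and thus bounds the number
    of splits. *)
Definition potential blk : nat :=
  \sum_(u : 'I_n | blk u != 0) #|[set v : 'I_n | blk v == blk u]|.

Lemma potential_le blk : potential blk <= n * n.
Proof.
rewrite /potential big_mkcond /=; rewrite -[X in X * _]card_ord -sum_nat_const.
apply: leq_sum => u _; case: ifP => // _; by apply: leq_trans (max_card _) _; rewrite card_ord.
Qed.

Hypothesis hf : forall a b, 0 < a -> 2 * b <= a -> h a + f b <= f a.

(** Each part has at most half of the vertices of [A], so [hf] pays for the vertices placed now out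
    of the budget of [A] and leaves enough for every part. The other blocks see none of the newly
    placed vertices, because no edge joins two blocks; their budgets are unchanged. *)
Lemma block_inv_split blk out top (D : {set 'I_n}) cl blk' out' :
  block_inv blk out -> 0 < top -> (forall u, blk u <= top) ->
  let A := [set u : 'I_n | blk u == top] in
  A != set0 -> D \subset A -> #|A :\: D| <= h #|A| -> halves G A D ->
  {in D &, forall u v, (cl u == cl v) = linked G D u v} ->
  (forall u, blk' u = if u \in A then if u \in D then cl u + top + 1 else 0 else blk u) ->
  out' = out ++ [seq u <- iota 0 n | [exists v in A :\: D, nat_of_ord v == u]] ->
  block_inv blk' out' /\ potential blk' < potential blk.
Proof.
move=> [[uo lto fro] io ie ib] top0 max_top A A0 sDA szX hD clD blkE outE.
have AE u : (u \in A) = (blk u == top) by rewrite inE.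
have DA u : u \in D -> u \in A by apply: (subsetP sDA).
have memX u : (nat_of_ord u \in out') = (nat_of_ord u \in out) || (u \in A :\: D).
  rewrite outE mem_cat mem_filter mem_iota add0n ltn_ord leq0n !andbT; congr (_ || _).
  by apply/existsP/idP => [[v /andP[vX /eqP/val_inj <-]]|uX] //; exists u; rewrite uX eqxx.
have classD u : u \in D -> [set v : 'I_n | blk' v == blk' u] = [set v | linked G D u v].
  move=> uD; apply/setP => v; rewrite !inE [blk' u]blkE DA // uD blkE.
  case: (boolP (v \in A)) => [vA|vA].
    have [vD|vD] := boolP (v \in D).
      by rewrite -addnA -[X in _ == X]addnA eqn_add2r eq_sym clD.
    rewrite (_ : (0 == _) = false); last by apply/eqP; lia.
    by apply/esym/negbTE; apply: contra vD => /linked_in; apply.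
  rewrite (_ : (blk v == _) = false); last by apply/eqP; have := max_top v; lia.
  by apply/esym/negbTE; apply: contra vA => /linked_in; move=> /(_ uD)/DA.
have class_out u : u \notin A -> blk u != 0 ->
    [set v : 'I_n | blk' v == blk' u] = [set v : 'I_n | blk v == blk u].
  move=> uA u0; apply/setP => v; rewrite !inE !blkE (negPf uA).
  case: ifP => // vA; move: (uA); rewrite AE => /negPf ne.
  have -> : (blk v == blk u) = false by move: vA; rewrite AE => /eqP ->; rewrite eq_sym.
  by case: ifP => _; apply/eqP; [have := max_top u; lia|move=> e; rewrite -e in u0].
have small u : u \in D -> 2 * #|[set v : 'I_n | blk' v == blk' u]| <= #|A|.
  by move=> uD; rewrite classD //; move/forall_inP: hD; apply.
have tn0 : top != 0 by rewrite -lt0n.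
have Apos : 0 < #|A| by rewrite card_gt0.
have [a aA] := set0Pn _ A0.
have ea : blk a = top by apply/eqP; rewrite -AE.
have fA : #|blocks_below blk out top| + f #|A| <= K.
  by have := ib a; rewrite ea -/A => -> //; rewrite -lt0n.
(* Every vertex placed now or later lies in a block up to the top one, so the
   frontier of any prefix reached by this split is covered by this set. *)
pose F := blocks_below blk out top :|: (A :\: D).
have F_le b : 2 * b <= #|A| -> #|F| + f b <= K.
  move=> hb; have := hf Apos hb; have := (leq_card_setU (blocks_below blk out top) (A :\: D)).1.
  rewrite -/F; move: szX fA; move: #|F| #|blocks_below blk out top| #|A :\: D|.
  by move: (h #|A|) (f #|A|) (f b); lia.
have FK : #|F| <= K by have := F_le 0 isT; apply: leq_trans; apply: leq_addr.
have blk'0 u : (blk' u == 0) = (blk u == 0) || (u \in A :\: D).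
  rewrite blkE in_setD; case: (boolP (u \in A)) => [uA|uA]; last by rewrite andbF orbF.
  rewrite andbT; case: (u \in D); last by rewrite eqxx orbT.
  by rewrite orbF; move: uA; rewrite AE => /eqP ->; apply/eqP/eqP; lia.
have out_blk u : (nat_of_ord u \in out') = (blk' u == 0) by rewrite memX io blk'0.
split.
  split=> //.
  - split.
    + rewrite outE cat_uniq uo filter_uniq ?iota_uniq // andbT /=.
      apply/hasPn => w; rewrite mem_filter => /andP[/existsP[v /andP[vX /eqP <-]] _].
      rewrite io; move: vX; rewrite in_setD AE => /andP[_ /eqP ->].
      by rewrite -lt0n.
    + move=> w; rewrite outE mem_cat => /orP[/lto//|]; rewrite mem_filter => /andP[_].
      by rewrite mem_iota.
    + move=> i hi; have [io'|oi] := leqP i (size out).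
        by rewrite outE takel_cat //; apply: fro.
      apply: leq_trans FK; apply: subset_leq_card; apply/subsetP => u.
      rewrite inE => /andP[up /existsP[v /andP[vp uv]]].
      have eo : take i out' = out ++ take (i - size out)
          [seq u <- iota 0 n | [exists v in A :\: D, nat_of_ord v == u]].
        by rewrite outE take_cat ltnNge (ltnW oi).
      have vo : nat_of_ord v \notin out by move: vp; rewrite eo mem_cat negb_or => /andP[].
      have := mem_take up; rewrite memX in_setU => /orP[uo'|->]; last by rewrite orbT.
      apply/orP; left; rewrite inE uo' /=; apply/existsP; exists v.
      by rewrite uv max_top lt0n -io vo.
  - move=> u v uv; rewrite !blk'0 !negb_or => /andP[u0 uX] /andP[v0 vX].
    have e := ie _ _ uv u0 v0; rewrite !blkE.
    have eA : (v \in A) = (u \in A) by rewrite !AE e.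
    rewrite eA; case: (boolP (u \in A)) => [uA|] //.
    have uD : u \in D by move: uX; rewrite in_setD uA andbT negbK.
    have vD : v \in D by move: vX; rewrite in_setD eA uA andbT negbK.
    by rewrite uD vD; congr (_ + _ + _); apply/eqP; rewrite clD //; apply: linked1.
  - move=> v v0; have [vD|vD] := boolP (v \in D).
      apply: leq_trans (F_le _ (small v vD)); rewrite leq_add2r.
      apply: subset_leq_card; apply/subsetP => u.
      rewrite inE memX => /andP[uo' /existsP[w /and3P[w0 _ uw]]].
      rewrite in_setU; case/orP: uo' => [uo'|->]; last by rewrite orbT.
      apply/orP; left; rewrite inE uo'; apply/existsP; exists w.
      rewrite uw max_top !andbT lt0n; move: w0; rewrite lt0n blk'0 negb_or.
      by case/andP.
    move: v0; rewrite blk'0 negb_or => /andP[v0 vX].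
    have vA : v \notin A by move: vX; rewrite in_setD vD.
    rewrite class_out //; apply: leq_trans (ib v v0); rewrite leq_add2r.
    apply: subset_leq_card; apply/subsetP => u.
    rewrite inE memX => /andP[uo' /existsP[w /and3P[w0 wv uw]]].
    have bv : blk' v = blk v by rewrite blkE (negPf vA).
    have lt_v : blk v < top by rewrite ltn_neqAle max_top andbT -AE.
    have wA : w \notin A.
      apply/negP => wA; move: w0 wv; rewrite bv blkE wA; case: ifP => // _ _; clear -lt_v; lia.
    rewrite bv blkE (negPf wA) in wv; rewrite blkE (negPf wA) in w0.
    case/orP: uo' => [uo'|uX].
      by rewrite inE uo'; apply/existsP; exists w; rewrite w0 wv.
    have uA : u \in A by move: uX; rewrite in_setD => /andP[].
    have ut : blk u = top by apply/eqP; rewrite -AE.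
    have := ie _ _ uw; rewrite ut -!lt0n => /(_ top0 w0) e.
    by move: wA; rewrite AE -e eqxx.
rewrite /potential big_mkcond [X in _ < X]big_mkcond /= (bigD1 a) //= [X in _ < X](bigD1 a) //=.
have le u : (if blk' u != 0 then #|[set v : 'I_n | blk' v == blk' u]| else 0) <=
            (if blk u != 0 then #|[set v : 'I_n | blk v == blk u]| else 0).
  have [uA|uA] := boolP (u \in A).
    have eu : blk u = top by apply/eqP; rewrite -AE.
    rewrite eu tn0 -/A; case: ifP => //; rewrite blk'0 negb_or => /andP[_ uX].
    have uD : u \in D by move: uX; rewrite in_setD uA andbT negbK.
    by have := small u uD; lia.
  have [u0|u0] := eqVneq (blk u) 0; last by rewrite class_out //; case: ifP.
  by rewrite blk'0 u0.
rewrite -addSn leq_add //; last by apply: leq_sum => u _; apply: le.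
rewrite ea tn0 -/A; case: ifP => //; rewrite blk'0 negb_or => /andP[_ aX].
have aD : a \in D by move: aX; rewrite in_setD aA andbT negbK.
have half c k : 0 < k -> 2 * c <= k -> c < k by lia.
exact: half Apos (small a aD).
Qed.

End Splitting.

Lemma run_while_measure x c a (I : nat -> store -> Prop) B :
  (forall m s, I m s -> var s a != 0 ->
     exists t s', [/\ run x c s t s', t <= B & exists2 m', m' < m & I m' s']) ->
  forall m s, I m s -> exists t s',
    [/\ run x (CWhile a c) s t s', t <= m * (B + 2) + 1 & var s' a = 0 /\ exists m', I m' s'].
Proof.
move=> H m; elim/ltn_ind: m => m IH s Im.
have [a0|a0] := eqVneq (var s a) 0.
  by exists 1, s; split; [apply: RWhileF|rewrite leq_addl|split=> //; exists m].
have [t [s' [r tB [m' mm Im']]]] := H m s Im a0.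
have [t' [s'' [r' tB' h]]] := IH m' mm s' Im'.
exists (t + t' + 2), s''; split=> //; first exact: RWhileT a0 r r'.
have : m'.+1 * (B + 2) <= m * (B + 2) by rewrite leq_mul2r mm orbT.
by rewrite mulSn; lia.
Qed.

Section Ordering.
Variables (n : nat) (G : sgraph 'I_n) (r : nat) (h f : nat -> nat) (K : nat).
Let x := encode G r.

Lemma run_blk_ctx b s : wfb b -> all (fun N => (N == v_n) || (N == v_n1)) (bounds b) ->
  ~~ modv b v_n -> ~~ modv b v_n1 -> ctx n r s ->
  exists2 t, t <= cost n.+1 b & run x (to_cmd b) s t (eval x b s).
Proof.
move=> w /allP bd m1 m2 [hn hn1 _ _ _]; apply: run_blk => // N /bd /orP[] /eqP->.
  by rewrite hn leqnSn.
by rewrite hn1.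
Qed.

Lemma ctx_run c s t s' : run x c s t s' ->
  all (fun v => ~~ cmodv c v) [:: v_n; v_n1; v_one; v_zero; v_r] -> ~~ cmoda c a_row ->
  ctx n r s -> ctx n r s'.
Proof.
move=> /run_frame[fv fa] /allP mv ma; apply: ctx_same => [v /mv|k]; [exact: fv|exact: fa].
Qed.

Hypothesis hf : forall a b, 0 < a -> 2 * b <= a -> h a + f b <= f a.
Hypothesis fK : f n <= K.
Hypothesis f0 : forall a b, a <= b -> f a <= f b.
Hypothesis sep : forall A : {set 'I_n}, exists X : {set 'I_n},
  [/\ X \subset A, #|X| <= h #|A| & halves G A (A :\: X)].

Definition order_of s : seq nat := mkseq (arr s a_ord) (var s v_cnt).

Definition order_inv (m : nat) (s : store) : Prop :=
  [/\ ctx n r s, block_inv G f K (arr s a_blk) (order_of s),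
      forall u : 'I_n, arr s a_blk u <= var s v_top,
      var s v_top = 0 \/ (exists u : 'I_n, arr s a_blk u = var s v_top) &
      potential n (arr s a_blk) <= m].

Definition block_time : nat :=
  cost n.+1 p_block_start + (n.+1 ^ K * (cost n.+1 p_try + 2) + 1 +
    (cost n.+1 p_split + cost n.+1 p_top)).

Lemma order_step m s : order_inv m s -> var s v_top != 0 ->
  exists t s', [/\ run x (CSeq (to_cmd p_block_start) (CSeq (CWhile v_bad (to_cmd p_try))
      (CSeq (to_cmd p_split) (to_cmd p_top)))) s t s', t <= block_time &
    exists2 m', m' < m & order_inv m' s'].
Proof.
move=> [cs binv le_top ex_top pot] top0.
set s1 := eval x p_block_start s.
have cs1 : ctx n r s1 by apply: ctx_eval.
have [sz1 bad1 dig1] := p_block_startP G cs; rewrite -/x -/s1 in sz1 bad1 dig1.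
have top1 : var s1 v_top = var s v_top by rewrite /s1 evalv.
have blk1 u : arr s1 a_blk u = arr s a_blk u by rewrite /s1 evala.
pose A := [set u : 'I_n | arr s a_blk u == var s v_top].
have bA : block n s1 = A.
  by apply/setP => u; rewrite !inE top1 blk1 eqn_leq le_top.
have szA : var s1 v_size = #|block n s1|.
  rewrite sz1 count_iota_card; apply: eq_card => u.
  by rewrite !inE top1 blk1.
have [X [sXA szX hX]] := sep A.
have A0 : A != set0.
  case: ex_top => [e|[u eu]]; first by rewrite e in top0.
  by apply/set0Pn; exists u; rewrite inE eu.
have Apos : 0 < #|A| by rewrite card_gt0.
have Xn : #|X| <= n by apply: leq_trans (max_card _) _; rewrite card_ord.
have hX' : halves G (block n s1) (block n s1 :\: X) by rewrite bA.
have [t2 [s2 [D [r2 tb2 [sDA szD hD] rem2 [cl_lt cl_eq]]]]] :=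
  p_search cs1 dig1 bad1 szA (leqnn _) Xn hX'.
rewrite bA in sDA szD hD; have [fv2 fa2] := run_frame r2.
have cs2 : ctx n r s2 by apply: ctx_run r2 _ _ cs1.
have top2 : var s2 v_top = var s v_top by rewrite fv2.
have blk2 u : arr s2 a_blk u = arr s a_blk u by rewrite fa2.
have ord2 : mkseq (arr s2 a_ord) (var s2 v_cnt) = order_of s.
  rewrite fv2 // /order_of /s1 evalv //; apply: eq_mkseq => u.
  by rewrite fa2 // evala.
set s3 := eval x p_split s2; set s4 := eval x p_top s3.
have cs3 : ctx n r s3 by apply: ctx_eval.
have cs4 : ctx n r s4 by apply: ctx_eval.
have [blk3 ord3] := p_splitP G cs2; rewrite -/x -/s3 ord2 in blk3 ord3.
have [le4 ex4] := p_topP G cs3; rewrite -/x -/s4 in le4 ex4.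
have top_pos : 0 < var s v_top by rewrite lt0n.
have szD' : #|A :\: D| <= h #|A| by apply: leq_trans szD szX.
have blk3' (u : 'I_n) : arr s3 a_blk u = if u \in A then
   if u \in D then arr s2 a_cl u + var s v_top + 1 else 0 else arr s a_blk u.
  by rewrite blk3 // top2 blk2 rem2 inE eqn_leq le_top.
have ord3' : order_of s3 = order_of s ++
    [seq u <- iota 0 n | [exists v in A :\: D, nat_of_ord v == u]].
  rewrite /order_of ord3; congr (_ ++ _); apply: eq_in_filter => u.
  rewrite mem_iota add0n => /andP[_ un]; rewrite top2 blk2 (rem2 (Ordinal un)).
  apply/andP/existsP => [[h1 h2]|[v /andP[vX /eqP ev]]].
    exists (Ordinal un); rewrite !inE h2 /= eqxx andbT.
    by rewrite eqn_leq h1 (le_top (Ordinal un)).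
  have -> : Ordinal un = v by apply: val_inj.
  by move: vX; rewrite !inE -ev => /andP[-> /eqP ->].
have [binv' pot'] := block_inv_split hf binv top_pos le_top A0 sDA szD' hD cl_eq blk3' ord3'.
have blk4 : arr s4 a_blk =1 arr s3 a_blk by move=> u; rewrite /s4 evala.
have inv4 : order_inv (potential n (arr s3 a_blk)) s4.
  split=> //.
  - have -> : order_of s4 = order_of s3.
      by rewrite /order_of /s4 evalv //; apply: eq_mkseq => u; rewrite evala.
    have [i1 i2 i3 i4] := binv'; split=> //.
    + by move=> u; rewrite blk4.
    + by move=> u v; rewrite !blk4; apply: i3.
    + move=> v; rewrite blk4 => /i4; congr (_ + f _ <= _); apply: eq_card => u.
        by rewrite !inE; congr (_ && _); apply: eq_existsb => w; rewrite blk4.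
      by rewrite !inE !blk4.
  - by move=> u; rewrite blk4; apply: le4.
  - case: ex4 => [->|[u un eu]]; first by left.
    by right; exists (Ordinal un); rewrite blk4 /= eu.
  - rewrite leq_eqVlt; apply/orP; left; apply/eqP; rewrite /potential.
    apply: eq_big => [u|u _]; first by rewrite blk4.
    by apply: eq_card => v; rewrite !inE !blk4.
have [t1 tb1 r1] := run_blk_ctx (b := p_block_start) isT isT isT isT cs.
have [t3 tb3 r3] := run_blk_ctx (b := p_split) isT isT isT isT cs2.
have [t4 tb4 r4] := run_blk_ctx (b := p_top) isT isT isT isT cs3.
exists (t1 + (t2 + (t3 + t4))), s4; split.
- by apply: RSeq r1 (RSeq r2 (RSeq r3 r4)).
- rewrite /block_time; do 2?apply: leq_add => //; last exact: leq_add.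
  apply: leq_trans tb2 _; rewrite leq_add2r leq_mul2r; apply/orP; right.
  (* The recurrence with b = 0 gives h |A| <= f |A|, and f |A| <= f n <= K. *)
  rewrite leq_pexp2l //; apply: leq_trans szX _.
  apply: leq_trans (leq_trans (f0 _) fK); last first.
    by apply: leq_trans (max_card (mem A)) _; rewrite card_ord.
  by apply: leq_trans (hf Apos (b := 0) isT); apply: leq_addr.
- by exists (potential n (arr s3 a_blk)); first exact: leq_trans pot' pot.
Qed.

Lemma c_orderP s : ctx n r s -> (forall u, u < n -> arr s a_blk u = 1) -> var s v_cnt = 0 ->
  exists t s', [/\ run x c_order s t s',
    t <= cost n.+1 p_top + (n * n * (block_time + 2) + 1) &
    good_order G K (order_of s') /\ forall u : 'I_n, nat_of_ord u \in order_of s'].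
Proof.
move=> cs blk1 cnt0; set s1 := eval x p_top s.
have cs1 : ctx n r s1 by apply: ctx_eval.
have [le1 ex1] := p_topP G cs; rewrite -/x -/s1 in le1 ex1.
have blk1' (u : 'I_n) : arr s1 a_blk u = 1 by rewrite /s1 evala // blk1.
have ord1 : order_of s1 = [::] by rewrite /order_of /s1 evalv // cnt0.
have inv1 : order_inv (n * n) s1.
  split=> //.
  - rewrite ord1; split.
    + have fr0 : frontier G [::] = set0 by apply/setP => u; rewrite !inE.
      by split=> // i; rewrite leqn0 => /eqP->; rewrite fr0 cards0.
    + by move=> u; rewrite blk1'.
    + by move=> u v; rewrite !blk1'.
    + have bb0 t : blocks_below G (arr s1 a_blk) [::] t = set0.
        by apply/setP => u; rewrite !inE.
      move=> v _; rewrite bb0 cards0 add0n; apply: leq_trans fK; apply: f0.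
      by apply: leq_trans (max_card _) _; rewrite card_ord.
  - by move=> u; rewrite /s1 evala //; apply: le1.
  - case: ex1 => [->|[u un eu]]; first by left.
    by right; exists (Ordinal un); rewrite /s1 evala.
  - exact: potential_le.
have [t1 tb1 r1] := run_blk_ctx (b := p_top) isT isT isT isT cs.
have [t2 [s2 [r2 tb2 [top0 [m' inv2]]]]] := run_while_measure order_step inv1.
exists (t1 + t2), s2; split; [exact: RSeq r1 r2|exact: leq_add|].
have [_ [good io _ _] le2 _ _] := inv2; split=> // u.
by rewrite io -leqn0; have := le2 u; rewrite top0.
Qed.

End Ordering.

(** * Dynamic programming along the order *)

Section Records.
Variables (n : nat) (G : sgraph 'I_n) (r : nat).
Let x := encode G r.

(* A record is a vector of n + 1 numbers: one counter per vertex, followed by the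
   number of selected vertices. *)
Definition vec s (e : nat) : seq nat := mkseq (fun u => arr s a_tab (e + u)) n.+1.
Definition tmp s : seq nat := mkseq (arr s a_tmp) n.+1.

Definition add_vec (c : nat) (z : seq nat) : seq nat :=
  mkseq (fun u => nth 0 z u +
    (if u == n then 1 else adjn G r c u + (if u == c then n else 0))) n.+1.

Definition clear_vec (C : pred nat) (z : seq nat) : seq nat :=
  mkseq (fun u => if (u < n) && C u then 0 else nth 0 z u) n.+1.

(** The condition d_S >= d_{S^c} + 2 reads deg + 2 <= 2 d_S. A counter 0 belongs to a vertex without
    selected neighbours, or to one that was checked before. *)
Definition ok_vec (C : pred nat) (deg : nat -> nat) (z : seq nat) : bool :=
  all (fun u => C u ==> (nth 0 z u == 0) || (deg u + 2 <= 2 * nth 0 z u)) (iota 0 n).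

Lemma eq_mkseq_in (T : Type) (g h : nat -> T) m :
  (forall u, u < m -> g u = h u) -> mkseq g m = mkseq h m.
Proof.
by move=> e; apply/eq_in_map => u; rewrite mem_iota add0n => /andP[_]; apply: e.
Qed.

Lemma all_iotaS (P : pred nat) m : all P (iota 0 m.+1) = all P (iota 0 m) && P m.
Proof. by rewrite -addn1 iotaD all_cat /= andbT. Qed.

Lemma ctx_loop b s s' : (forall v, ~~ modv b v -> var s' v = var s v) ->
  (forall A k, ~~ moda b A -> arr s' A k = arr s A k) ->
  all (fun v => ~~ modv b v) [:: v_n; v_n1; v_one; v_zero; v_r] -> ~~ moda b a_row ->
  ctx n r s -> ctx n r s'.
Proof.
move=> fv fa /allP mv ma; apply: ctx_same => [v /mv|k]; [exact: fv|exact: fa].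
Qed.

Lemma p_copyP s : ctx n r s -> tmp (eval x p_copy s) = vec s (var s v_e).
Proof.
move=> [hn hn1 _ _ _]; apply: eq_mkseq_in; rewrite /p_copy.
pose I j s' := forall u, u < j -> arr s' a_tmp u = arr s a_tab (var s v_e + u).
apply: (@eval_forn _ G r _ _ _ _ s n.+1 I) => // j s' jn ej fv fa e.
apply: ltnS_cases => [u uj|] /=; rewrite ej ?eqxx ?(ltn_eqF uj) ?e //.
by rewrite (fv v_e isT) (fa a_tab _ isT).
Qed.

Lemma p_selectP s : ctx n r s -> var s v_cur < n ->
  tmp (eval x p_select s) = add_vec (var s v_cur) (tmp s).
Proof.
move=> cs cn; have [hn hn1 h1 hz _] := cs; apply: eq_mkseq_in => u un1.
rewrite nth_mkseq // /p_select evalS; set s1 := eval x (BFor _ _ _ _) s.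
have t1 v : v < n -> arr s1 a_tmp v = arr s a_tmp v + adjn G r (var s v_cur) v.
  pose I j s' := forall v, v < n ->
    arr s' a_tmp v = arr s a_tmp v + (if v < j then adjn G r (var s v_cur) v else 0).
  suff : I n s1 by move=> h vn; rewrite h // vn.
  apply: (@eval_forn _ G r _ _ _ _ s n I) => //; first by move=> w wn; rewrite addn0.
  move=> j s' jn ej fv fa e w wn; rewrite evalS; set s2 := eval x (get_adj _ _ _) s'.
  have cs2 : ctx n r s2.
    by apply: ctx_eval => //; apply: ctx_loop fv fa isT isT cs.
  have t2 : var s2 v_t = adjn G r (var s v_cur) j.
    have cs' := ctx_loop fv fa isT isT cs.
    by rewrite /s2 (@get_adjE n G r) ?ej ?(fv v_cur isT).
  have a2 q : arr s2 a_tmp q = arr s' a_tmp q by rewrite /s2 evala.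
  have i2 : var s2 v_i = j by rewrite /s2 evalv.
  clearbody s2; rewrite /= t2 i2 !a2 ltnS [w <= j]leq_eqVlt.
  by case: (eqVneq w j) => [->|ne] /=; rewrite !e // ltnn addn0.
have tn : arr s1 a_tmp n = arr s a_tmp n.
  pose I (j : nat) s' := arr s' a_tmp n = arr s a_tmp n.
  apply: (@eval_forn _ G r _ _ _ _ s n I) => // j s' jn ej fv fa e.
  by rewrite /I /= ej gtn_eqF.
have e1 v : ~~ modv (BFor v_i v_n v_di (get_adj v_t v_cur v_i ;; Get v_y a_tmp v_i ;;
    AddV v_y v_y v_t ;; Put a_tmp v_i v_y)) v -> var s1 v = var s v by move=> m; apply: evalv.
rewrite /= (e1 v_cur) // (e1 v_n) // (e1 v_one) // hn h1.
have [->|nu] := eqVneq u n; first by rewrite gtn_eqF // tn.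
have lt : u < n by rewrite ltn_neqAle nu -ltnS.
by case: eqP => [->|_]; rewrite t1 ?addn0 // addnA.
Qed.

Lemma p_checkP s : ctx n r s -> let s' := eval x p_check s in
  let C u := arr s a_closed u != 0 in
  [/\ (var s' v_ok != 0) = ok_vec C (arr s a_deg) (tmp s),
      tmp s' = clear_vec C (tmp s),
      var s' v_found = 0, var s' v_f = var s v_lim &
      var s' v_df = var s v_hi - var s v_lim].
Proof.
move=> cs; have [hn hn1 h1 hz _] := cs; move=> s' C; rewrite /s' /p_check 2!evalS.
set s1 := eval x (SetC _ _) s; set s2 := eval x (BFor _ _ _ _) s1.
pose good u := C u ==> (arr s a_tmp u == 0) || (arr s a_deg u + 2 <= 2 * arr s a_tmp u).
pose I j s' := (var s' v_ok != 0) = all good (iota 0 j) /\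
  forall u, arr s' a_tmp u = if (u < j) && C u then 0 else arr s a_tmp u.
have [I1 I2] : I n s2.
  apply: (@eval_forn _ G r _ _ _ _ s1 n I) => // j s3 jn ej fv fa [i1 i2].
  rewrite evalS; set s4 := eval x (Get _ _ _) s3.
  have t4 : var s4 v_t = arr s a_closed j by rewrite /= ej (fa a_closed _ isT).
  have tj : arr s3 a_tmp j = arr s a_tmp j by rewrite i2 ltnn.
  rewrite /I all_iotaS -i1; have [cj|ncj] := boolP (C j); last first.
    rewrite evalF ?t4; last by apply/eqP; rewrite negbK in ncj.
    rewrite /good (negPf ncj) andbT; split=> // u; rewrite i2 ltnS [u <= j]leq_eqVlt.
    by case: eqP => [->|//]; rewrite (negPf ncj) !andbF.
  rewrite evalT ?t4 // 2!evalS; set s6 := eval x (Get _ _ _) s4.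
  set s5 := eval x (BIf _ _ _) s6.
  have ok5 : (var s5 v_ok != 0) = (var s3 v_ok != 0) && good j.
    rewrite /s5; have y6 : var s6 v_y = arr s a_tmp j by rewrite /= ej tj.
    have [y0|y0] := eqVneq (arr s a_tmp j) 0.
      by rewrite evalF ?y6 // /good y0 eqxx implybT andbT.
    rewrite evalT ?y6 // /good cj (negPf y0) /= ej tj (fa a_deg _ isT) (fv v_one isT) /= h1.
    rewrite -addnA addn1; case: leqP => le.
      by rewrite (_ : arr s a_deg j + 2 - _ = 0) ?andbT //=; lia.
    by rewrite (_ : arr s a_deg j + 2 - _ != 0) ?andbF //=; lia.
  have tm5 u : arr s5 a_tmp u = arr s3 a_tmp u by rewrite /s5 evala.
  have i5 : var s5 v_i = j by rewrite /s5 evalv // -ej.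
  have z5 : var s5 v_zero = 0 by rewrite /s5 evalv // [LHS](fv v_zero isT).
  split; first exact: ok5.
  move=> u; rewrite /= i5 z5 tm5 i2 ltnS [u <= j]leq_eqVlt.
  by case: eqP => [->|//]; rewrite cj.
split=> /=.
- rewrite I1 /ok_vec; apply: eq_in_all => u; rewrite mem_iota add0n => /andP[_ un].
  by rewrite nth_mkseq // ltnW.
- by apply: eq_mkseq_in => u un; rewrite I2 nth_mkseq.
- by [].
- by rewrite [var s2 v_lim]evalv // [var s2 v_zero]evalv //= hz addn0.
- by rewrite [var s2 v_lim]evalv // [var s2 v_zero]evalv // [var s2 v_hi]evalv //= hz addn0.
Qed.

Lemma p_compareP s : ctx n r s -> let s' := eval x p_compare s in
  [/\ (var s' v_found != 0) = (vec s (var s v_f) == tmp s) || (var s v_found != 0),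
      var s' v_f = var s v_f + n.+1 & var s' v_df = var s v_hi - (var s v_f + n.+1)].
Proof.
move=> cs; have [hn hn1 h1 hz _] := cs; rewrite /p_compare 2!evalS.
set s1 := eval x (SetC _ _) s; set s2 := eval x (BFor _ _ _ _) s1.
pose I j s' := (var s' v_same != 0) =
  all (fun u => arr s a_tab (var s v_f + u) == arr s a_tmp u) (iota 0 j).
have I2 : I n.+1 s2.
  apply: (@eval_forn _ G r _ _ _ _ s1 n.+1 I) => // j s3 jn ej fv fa i1.
  rewrite /I all_iotaS -i1 4!evalS.
  set s4 := eval x (Get v_y _ _) _.
  have dE := @differE n G r v_z v_w v_t v_y s4 isT isT isT isT isT.
  set s5 := eval x (differ _ _ _ _) s4 in dE *.
  have t4 : var s4 v_t = arr s a_tab (var s v_f + j).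
    by rewrite /= ej (fa a_tab _ isT) (fv v_f isT).
  have y4 : var s4 v_y = arr s a_tmp j by rewrite /= ej (fa a_tmp _ isT).
  rewrite t4 y4 in dE; have [e|ne] := eqVneq (arr s a_tab (var s v_f + j)) (arr s a_tmp j).
    by rewrite evalF ?andbT //; apply/eqP; rewrite dE e eqxx.
  by rewrite evalT ?dE //= andbF.
have same2 : (var s2 v_same != 0) = (vec s (var s v_f) == tmp s).
  rewrite I2; apply/allP/eqP => [h|h u].
    apply: eq_mkseq_in => u un; apply/eqP; apply: h.
    by rewrite mem_iota add0n.
  rewrite mem_iota add0n => /andP[_ un].
  by have := congr1 (fun z => nth 0 z u) h; rewrite !nth_mkseq // => ->.
have e2 v : v \in [:: v_found; v_f; v_n1; v_hi] -> var s2 v = var s v.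
  by rewrite !inE => /or4P[] /eqP->; rewrite /s2 evalv.
rewrite -same2 evalS; case: (eqVneq (var s2 v_same) 0) => same0.
  by rewrite (evalF _ _ _ _ same0) /= !e2 ?inE // hn1.
by rewrite (evalT _ _ _ _ same0) /= !e2 ?inE // hn1.
Qed.

Lemma p_appendP s : ctx n r s -> let s' := eval x p_append s in
  let go := (var s v_ok != 0) && (var s v_found == 0) in
  [/\ forall j, j < var s v_hi -> arr s' a_tab j = arr s a_tab j,
      go -> vec s' (var s v_hi) = tmp s &
      var s' v_hi = if go then var s v_hi + n.+1 else var s v_hi].
Proof.
move=> cs; have [hn hn1 h1 hz _] := cs; rewrite /p_append.
have [ok0|ok0] := eqVneq (var s v_ok) 0; first by rewrite evalF.
rewrite evalT //; have [fo|fo] := eqVneq (var s v_found) 0; last by rewrite evalT.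
rewrite evalF // evalS; set s1 := eval x (BFor _ _ _ _) s.
pose I j s' := (forall k, k < var s v_hi -> arr s' a_tab k = arr s a_tab k) /\
  forall u, u < j -> arr s' a_tab (var s v_hi + u) = arr s a_tmp u.
have [I1 I2] : I n.+1 s1.
  apply: (@eval_forn _ G r _ _ _ _ s n.+1 I) => // j s3 jn ej fv fa [i1 i2]; split.
    move=> k kh; rewrite /= ej (fv v_hi isT) ltn_eqF ?i1 //.
    by apply: leq_trans kh _; apply: leq_addr.
  apply: ltnS_cases => [u uj|] /=; rewrite ej (fv v_hi isT) ?eqxx ?(fa a_tmp _ isT) //.
  by rewrite eqn_add2l ltn_eqF // i2.
have h1' : var s1 v_hi = var s v_hi by rewrite /s1 evalv.
have n1' : var s1 v_n1 = n.+1 by rewrite /s1 evalv.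
by split=> //= [_|]; [apply: eq_mkseq_in => u /I2|rewrite h1' n1'].
Qed.

Lemma p_degreesP s : ctx n r s -> let s' := eval x p_degrees s in
  (forall u, u < n -> arr s' a_deg u = \sum_(v < n) adjn G r u v) /\ var s' v_hi = n.+1.
Proof.
move=> cs; have [hn hn1 h1 hz _] := cs; rewrite /p_degrees evalS.
set s1 := eval x (BFor _ _ _ _) s; split; last first.
  by rewrite /= [var s1 v_n1]evalv // [var s1 v_zero]evalv // hz addn0.
move=> u un; rewrite [LHS]/=; move: u un.
pose I j s' := forall u, u < j -> arr s' a_deg u = \sum_(v < n) adjn G r u v.
apply: (@eval_forn _ G r _ _ _ _ s n I) => // j s2 jn ej fv fa i1.
rewrite 2!evalS; set s3 := eval x (SetC _ _) s2; set s4 := eval x (BFor _ _ _ _) s3.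
have cs2 : ctx n r s2.
    exact: ctx_loop fv fa isT isT cs.
have cs3 : ctx n r s3 by apply: ctx_eval.
have k4 : var s4 v_k = \sum_(v < n) adjn G r j v.
  pose I' m s' := var s' v_k = \sum_(v < m) adjn G r j v.
  apply: (@eval_forn _ G r _ _ _ _ s3 n I') => //.
  - by have [] := cs3.
  - by rewrite /I' big_ord0.
  move=> m s5 mn em fv' fa' i2; rewrite /I' evalS big_ord_recr -i2.
  set s6 := eval x (get_adj _ _ _) s5.
  have cs5 : ctx n r s5.
    exact: ctx_loop fv' fa' isT isT cs3.
  have i5 : var s5 v_i = j by rewrite (fv' v_i isT).
  have t6 : var s6 v_t = adjn G r j m by rewrite /s6 (@get_adjE n G r) // ?i5 ?em.
  have k6 : var s6 v_k = var s5 v_k by rewrite /s6 evalv.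
  by clearbody s6; rewrite /= t6 k6.
have i4 : var s4 v_i = j by rewrite /s4 evalv.
apply: ltnS_cases => [u uj|] /=; rewrite i4 ?eqxx // ltn_eqF //.
by rewrite evala // i1.
Qed.

Lemma p_stage_startP s : ctx n r s -> arr s a_ord (var s v_step) < n ->
  let s' := eval x p_stage_start s in let c := arr s a_ord (var s v_step) in
  let dn u := (u == c) || (arr s a_done u != 0) in
  [/\ var s' v_cur = c, forall u, (arr s' a_done u != 0) = dn u,
      forall u, u < n -> (arr s' a_closed u != 0) =
        dn u && all (fun v => (adjn G r u v != 0) ==> dn v) (iota 0 n),
      var s' v_lim = var s v_hi &
      var s' v_e = var s v_lo /\ var s' v_d = var s v_hi - var s v_lo].
Proof.
move=> cs cn; have [hn hn1 h1 hz _] := cs; move=> s' c dn.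
rewrite /s' /p_stage_start 3!evalS.
set s1 := eval x (Put _ _ _) _; set s2 := eval x (BFor _ _ _ _) s1.
have cs1 : ctx n r s1 by do 2!(apply: ctx_eval => //).
have dn1 u : (arr s1 a_done u != 0) = dn u.
  by rewrite /s1 /= -/c /dn; case: (u == c); rewrite ?h1.
have dn2 u : (arr s2 a_done u != 0) = dn u by rewrite /s2 evala.
have cl2 u : u < n -> (arr s2 a_closed u != 0) =
    dn u && all (fun v => (adjn G r u v != 0) ==> dn v) (iota 0 n).
  move: u; pose I j s' := forall u, u < j -> (arr s' a_closed u != 0) =
    dn u && all (fun v => (adjn G r u v != 0) ==> dn v) (iota 0 n).
  apply: (@eval_forn _ G r _ _ _ _ s1 n I) => //.
  move=> j s3 jn ej fv fa i1; rewrite 2!evalS.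
  set s4 := eval x (Get _ _ _) s3; set s5 := eval x (BFor _ _ _ _) s4.
  have cs3 : ctx n r s3.
    exact: ctx_loop fv fa isT isT cs1.
  have cs4 : ctx n r s4 by apply: ctx_eval.
  have k5 : (var s5 v_k != 0) =
      dn j && all (fun v => (adjn G r j v != 0) ==> dn v) (iota 0 n).
    pose I' m s' := (var s' v_k != 0) =
      dn j && all (fun v => (adjn G r j v != 0) ==> dn v) (iota 0 m).
    apply: (@eval_forn _ G r _ _ _ _ s4 n I') => //.
    - by have [] := cs4.
    - by rewrite /I' /= ej (fa a_done _ isT) dn1 andbT.
    move=> m s6 mn em fv' fa' i2; rewrite /I' all_iotaS andbA -i2 evalS.
    set s7 := eval x (get_adj _ _ _) s6.
    have cs6 : ctx n r s6.
    exact: ctx_loop fv' fa' isT isT cs4.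
    have i6 : var s6 v_i = j by rewrite (fv' v_i isT).
    have t7 : var s7 v_t = adjn G r j m by rewrite /s7 (@get_adjE n G r) // ?i6 ?em.
    have k7 : var s7 v_k = var s6 v_k by rewrite /s7 evalv.
    have j7 : var s7 v_j = m by rewrite /s7 evalv.
    have d7 : (arr s7 a_done m != 0) = dn m.
      by rewrite /s7 evala // (fa' a_done _ isT) [arr s4 _ _](fa a_done _ isT) dn1.
    clearbody s7.
    have [a0|a0] := eqVneq (adjn G r j m) 0; first by rewrite evalF ?t7 // k7 andbT.
    rewrite evalT ?t7 // evalS implyTb; set s8 := eval x (Get _ _ _) s7.
    have t8 : (var s8 v_t != 0) = dn m.
      by rewrite /= j7.
    case: (boolP (dn m)) => dm; first by rewrite evalT ?t8 //= k7 andbT.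
    by rewrite evalF /= ?andbF //; apply/eqP; rewrite -[_ == _]negbK t8.
  have i5 : var s5 v_i = j by rewrite /s5 evalv.
  apply: ltnS_cases => [u uj|] /=; rewrite i5 ?eqxx // (ltn_eqF uj).
  by rewrite /s5 evala // i1.
have f2 v : v \in [:: v_cur; v_hi; v_zero; v_lo] -> var s2 v = var s1 v.
  by rewrite !inE => /or4P[] /eqP->; rewrite /s2 evalv.
by split; rewrite //= !f2 ?inE //= hz ?addn0.
Qed.

Lemma p_acceptP s : ctx n r s -> let s' := eval x p_accept s in
  let k := arr s a_tab (var s v_e + n) in
  [/\ var s' v_res = if (1 <= k <= r) then 1 else var s v_res,
      var s' v_e = var s v_e + n.+1 & var s' v_d = var s v_hi - (var s v_e + n.+1)].
Proof.
move=> cs; have [hn hn1 h1 hz [hr _]] := cs; rewrite /p_accept 2!evalS evalS.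
set s1 := eval x (Get _ _ _) _.
have t1 : var s1 v_t = arr s a_tab (var s v_e + n) by rewrite /= hn.
have r1 : var s1 v_r = r by [].
have [k0|k0] := eqVneq (arr s a_tab (var s v_e + n)) 0.
  by rewrite evalF ?t1 // k0 /= hn1.
rewrite evalT ?t1 // 2!evalS lt0n k0; set s2 := eval _ (SubV _ _ _) s1.
have y2 : var s2 v_y = arr s a_tab (var s v_e + n) - r by rewrite /= hn hr.
have [le|gt] := leqP (arr s a_tab (var s v_e + n)) r.
  by rewrite evalF ?y2 ?(eqP le) //= hn1.
by rewrite evalT ?y2 -?lt0n ?subn_gt0 //= hn1.
Qed.

Lemma p_initP s : (forall v, var s v = 0) -> (forall A j, arr s A j = 0) ->
  let s' := eval x p_init s in
  ctx n r s' /\ forall u, u < n -> arr s' a_blk u = 1.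
Proof.
move=> v0 a0; rewrite /p_init 6!evalS.
set s1 := eval x (SetC v_t 2) _.
have n1 : var s1 v_n = n by rewrite /= v0.
set s2 := eval x (BFor _ _ _ _) s1.
have row2 : forall u, u < n -> arr s2 a_row u = 2 + u * n.
  pose I j s' := var s' v_t = 2 + j * n /\ forall u, u < j -> arr s' a_row u = 2 + u * n.
  have [] // : I n s2.
  apply: (@eval_forn _ G r _ _ _ _ s1 n I) => // j s3 jn ej fv fa [i1 i2]; split.
    by rewrite /= i1 (fv v_n isT) n1 mulSn -addnA [j * n + n]addnC.
  by apply: ltnS_cases => [u uj|] /=; rewrite ej ?eqxx // ltn_eqF // i2.
have cs2 : ctx n r s2.
  have e2 v : v != v_i -> v != v_di -> v != v_t -> var s2 v = var s1 v.
    move=> vi vd vt; rewrite /s2 evalv //=.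
    by rewrite (negPf vi) (negPf vd) (negPf vt).
  by split; rewrite ?e2 //= ?v0 ?addn1 //; split; rewrite ?e2.
split; first exact: ctx_eval.
pose I j s' := forall u, u < j -> arr s' a_blk u = 1.
apply: (@eval_forn _ G r _ _ _ _ s2 n I) => //; first by have [] := cs2.
move=> j s3 jn ej fv fa i1; apply: ltnS_cases => [u uj|] /=; rewrite ej ?eqxx.
  by rewrite ltn_eqF // i1.
by rewrite (fv v_one isT); have [] := cs2.
Qed.

End Records.

(** * The tables of the dynamic program as lists *)

Section Tables.
Variables (n : nat) (G : sgraph 'I_n) (r : nat).
Let x := encode G r.
Implicit Types (C : pred nat) (deg : nat -> nat) (L : seq (seq nat)) (z : seq nat).

(** The functional counterpart of [c_insert]; the order of insertion is kept, so that memory and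
    list agree position by position. *)
Definition insert_vec C deg L z : seq (seq nat) :=
  if ok_vec n C deg z && (clear_vec n C z \notin L) then rcons L (clear_vec n C z) else L.

Definition insert_both C deg c L z : seq (seq nat) :=
  insert_vec C deg (insert_vec C deg L z) (add_vec G r c z).

Definition next_table C deg c L : seq (seq nat) :=
  foldl (insert_both C deg c) [::] L.

Lemma eq_ok_vec C C' deg deg' z : (forall u, u < n -> C u = C' u) ->
  (forall u, u < n -> deg u = deg' u) -> ok_vec n C deg z = ok_vec n C' deg' z.
Proof.
move=> eC ed; apply: eq_in_all => u; rewrite mem_iota add0n => /andP[_ un].
by rewrite eC // ed.
Qed.

Lemma eq_clear_vec C C' z : (forall u, u < n -> C u = C' u) ->
  clear_vec n C z = clear_vec n C' z.
Proof.
move=> eC; apply: eq_mkseq_in => u _; case: ltnP => // un; by rewrite eC.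
Qed.

Lemma size_insert_vec C deg L z : size L <= size (insert_vec C deg L z).
Proof. by rewrite /insert_vec; case: ifP => // _; rewrite size_rcons. Qed.

Lemma size_insert_both C deg c L z : size L <= size (insert_both C deg c L z).
Proof. exact: leq_trans (size_insert_vec _ _ _ _) (size_insert_vec _ _ _ _). Qed.

Lemma size_foldl_insert C deg c L L' :
  size L' <= size (foldl (insert_both C deg c) L' L).
Proof.
elim: L L' => //= z L IH L'; exact: leq_trans (size_insert_both _ _ _ _ _) (IH _).
Qed.

Definition table_at s (a : nat) L : Prop :=
  forall k, k < size L -> vec n s (a + k * n.+1) = nth [::] L k.

Lemma table_at_same s s' a L b : a + size L * n.+1 <= b ->
  (forall j, j < b -> arr s' a_tab j = arr s a_tab j) ->
  table_at s a L -> table_at s' a L.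
Proof.
move=> ab e h k kL; rewrite -h //; apply: eq_mkseq_in => u un; apply: e.
apply: leq_trans ab; have : k.+1 * n.+1 <= size L * n.+1 by rewrite leq_mul2r kL orbT.
by rewrite mulSn; lia.
Qed.

Definition insert_time (M : nat) (pre : blk) : nat :=
  cost n.+1 (pre ;; p_check) + (M * (cost n.+1 p_compare + 2) + 1 + cost n.+1 p_append).

(** The data that [c_insert] still relies on after its preamble [pre]. *)
Definition preserves (b : blk) : bool :=
  all (fun v => ~~ modv b v) [:: v_n; v_n1; v_one; v_zero; v_r; v_lim; v_hi] &&
  all (fun A => ~~ moda b A) [:: a_row; a_tab; a_closed; a_deg].

Lemma c_insertP pre s C deg L M :
  wfb pre -> all (fun N => (N == v_n) || (N == v_n1)) (bounds pre) -> preserves pre ->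
  ctx n r s -> (forall u, u < n -> (arr s a_closed u != 0) = C u) ->
  (forall u, u < n -> arr s a_deg u = deg u) ->
  var s v_hi = var s v_lim + size L * n.+1 -> table_at s (var s v_lim) L ->
  size L <= M ->
  let L' := insert_vec C deg L (tmp n (eval x pre s)) in
  exists t s', [/\ run x (c_insert pre) s t s', t <= insert_time M pre,
    forall j, j < var s v_hi -> arr s' a_tab j = arr s a_tab j,
    var s' v_hi = var s v_lim + size L' * n.+1 & table_at s' (var s v_lim) L'].
Proof.
move=> wp bp /andP[/allP pv /allP pa] cs hC hdeg hi tab LM.
have pvv v : v \in [:: v_n; v_n1; v_one; v_zero; v_r; v_lim; v_hi] -> ~~ modv pre v.
  exact: pv.
have paa A : A \in [:: a_row; a_tab; a_closed; a_deg] -> ~~ moda pre A by apply: pa.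
set s1 := eval x pre s; set z := tmp n s1; move=> L'.
have cs1 : ctx n r s1.
  apply: ctx_eval => //; last exact: paa.
  by apply/allP => v hv; apply: pvv; move: hv; rewrite !inE; do 4!(case/orP=> [->|]; rewrite ?orbT //); move=> ->; rewrite ?orbT.
have e1 v : v \in [:: v_lim; v_hi] -> var s1 v = var s v.
  move=> hv; apply: evalv => //; apply: pvv; move: hv; rewrite !inE.
  by case/orP=> ->; rewrite ?orbT.
have a1 A j : A \in [:: a_row; a_tab; a_closed; a_deg] -> arr s1 A j = arr s A j.
  by move=> hA; apply: evala => //; apply: paa.
set s2 := eval x p_check s1.
have cs2 : ctx n r s2 by apply: ctx_eval.
have [ok2 tmp2 found2 f2 df2] := p_checkP G cs1.
rewrite -/x -/s2 in ok2 tmp2 found2 f2 df2.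
pose C1 u := arr s1 a_closed u != 0.
have okE : ok_vec n C1 (arr s1 a_deg) z = ok_vec n C deg z.
  by apply: eq_ok_vec => u un; rewrite /C1 a1 ?inE ?hC ?hdeg.
have clE : clear_vec n C1 z = clear_vec n C z.
  by apply: eq_clear_vec => u un; rewrite /C1 a1 ?inE ?hC.
rewrite -/C1 -/z okE in ok2; rewrite -/C1 -/z clE in tmp2.
have lim2 : var s2 v_lim = var s v_lim by rewrite /s2 evalv // e1.
have hi2 : var s2 v_hi = var s v_hi by rewrite /s2 evalv // e1.
have tab2 j : arr s2 a_tab j = arr s a_tab j by rewrite /s2 evala // a1.
rewrite e1 // in f2; rewrite !e1 // hi addKn in df2.
pose f s := eval x p_compare s; pose st k := iter k f s2.
have inv k : k <= size L -> [/\ ctx n r (st k), var (st k) v_f = var s v_lim + k * n.+1,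
    var (st k) v_df = (size L - k) * n.+1 &
    (var (st k) v_found != 0) = (clear_vec n C z \in take k L)] /\
    [/\ forall v, v \in [:: v_lim; v_hi; v_ok] -> var (st k) v = var s2 v,
    (forall j, arr (st k) a_tab j = arr s a_tab j) &
    tmp n (st k) = clear_vec n C z].
  elim: k => [|k IH] kL.
    by split; split=> //; rewrite ?found2 ?f2 ?df2 ?mul0n ?addn0 ?subn0 ?take0.
  have [[c ef edf efo] [ev ea et]] := IH (ltnW kL).
  have [fo' f' df'] := p_compareP G c; rewrite -/x -/(f _) -[f _]/(st k.+1) in fo' f' df'.
  split; split=> //.
  - exact: ctx_eval.
  - by rewrite f' ef mulSn; lia.
  - rewrite df' ef ev // hi2 hi mulnBl mulSn; lia.
  - rewrite fo' efo (take_nth [::] kL) mem_rcons inE et; congr (_ || _).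
    rewrite ef eq_sym; congr (_ == _); rewrite -tab //.
    by apply: eq_mkseq_in => u _; rewrite ea.
  - by move=> v hv; rewrite -ev // /st iterS /f evalv //; move: hv; rewrite !inE => /or3P[] /eqP->.
  - by move=> j; rewrite -ea /st iterS /f evala.
  - by rewrite -et; apply: eq_mkseq_in => u _; rewrite /st iterS /f evala.
have [[cs3 f3 df3 fo3] [ev3 ea3 et3]] := inv _ (leqnn (size L)).
have [k kL||t3 tb3 r3] := @run_while_iter x (to_cmd p_compare) v_df s2 f (size L) (cost n.+1 p_compare).
- have [[c ef edf efo] _] := inv k (ltnW kL); split.
    by rewrite -/(st k) edf -lt0n muln_gt0 subn_gt0 kL.
  by have [t tb rr] := @run_blk_ctx n G r p_compare _ isT isT isT isT c; exists t.
- by rewrite -/(st _) df3 subnn.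
set s3 := iter _ f s2 in r3; rewrite -/s3 -[s3]/(st (size L)) in r3.
have [tab4 vec4 hi4] := p_appendP G cs3; rewrite -/x in tab4 vec4 hi4.
set s4 := eval x p_append _ in tab4 vec4 hi4; rewrite take_size in fo3.
have fo3' : (var (st (size L)) v_found == 0) = (clear_vec n C z \notin L).
  by rewrite -fo3 negbK.
have ok3 : var (st (size L)) v_ok = var s2 v_ok by apply: ev3.
have hi3 : var (st (size L)) v_hi = var s v_hi by rewrite ev3 // hi2.
rewrite hi3 in tab4; rewrite hi3 ok3 ok2 fo3' in vec4; rewrite hi3 ok3 ok2 fo3' in hi4.
have goE : ok_vec n C deg z && (clear_vec n C z \notin L) =
   ok_vec n C deg z && ~~ (clear_vec n C z \in L) by [].
have [t4 tb4 r4] := @run_blk_ctx n G r p_append _ isT isT isT isT cs3.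
have [||||t2 tb2 r2] := @run_blk_ctx n G r (pre ;; p_check) s _ _ _ _ cs.
- by rewrite /= wp.
- by rewrite /= all_cat bp.
- by rewrite /= negb_or pvv.
- by rewrite /= negb_or pvv.
exists (t2 + (t3 + t4)), s4; split.
- exact: RSeq r2 (RSeq r3 r4).
- rewrite /insert_time; apply: leq_add => //; apply: leq_add => //.
  by apply: leq_trans tb3 _; rewrite leq_add2r leq_mul2r LM orbT.
- by move=> j jh; rewrite tab4 // ea3.
- rewrite hi4 /L' /insert_vec; case: ifP => // _.
  by rewrite size_rcons mulSn hi -addnA [_ + n.+1]addnC.
- have tab4' : table_at s4 (var s v_lim) L.
    apply: (@table_at_same s s4 _ _ (var s v_hi)) tab; first by rewrite -hi.
    by move=> j jh; rewrite tab4 // ea3.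
  rewrite /L' /insert_vec; case: ifP => // go k.
  rewrite size_rcons ltnS leq_eqVlt => /orP[/eqP->|kL].
    by rewrite nth_rcons ltnn eqxx -hi vec4 // et3.
  by rewrite nth_rcons kL tab4'.
Qed.

Definition stage_time (M : nat) : nat :=
  cost n.+1 p_stage_start +
  (M * (insert_time M p_copy + (insert_time M (p_copy ;; p_select) + cost n.+1 p_advance) + 2) + 1 +
   cost n.+1 (AddV v_lo v_lim v_zero ;; AddV v_step v_step v_one ;; SubV v_dstep v_n v_step)).

Lemma c_stageP s deg L M : ctx n r s -> let c := arr s a_ord (var s v_step) in c < n ->
  let dn u := (u == c) || (arr s a_done u != 0) in
  let C u := dn u && all (fun v => (adjn G r u v != 0) ==> dn v) (iota 0 n) in
  (forall u, u < n -> arr s a_deg u = deg u) ->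
  var s v_hi = var s v_lo + size L * n.+1 -> table_at s (var s v_lo) L ->
  let L' := next_table C deg c L in size L <= M -> size L' <= M ->
  exists t s', [/\ run x c_stage s t s' /\ t <= stage_time M,
    ctx n r s' /\ (forall u, (arr s' a_done u != 0) = dn u),
    var s' v_hi = var s' v_lo + size L' * n.+1, table_at s' (var s' v_lo) L' &
    var s' v_step = (var s v_step).+1 /\ var s' v_dstep = n - (var s v_step).+1].
Proof.
move=> cs c cn dn C hdeg hi tab L' LM LM'.
have [cur1 dn1 cl1 lim1 [e1 d1]] := p_stage_startP G cs cn.
rewrite -/x -/c in cur1 dn1 cl1 lim1 e1 d1.
set s1 := eval x p_stage_start s in cur1 dn1 cl1 lim1 e1 d1.
have cs1 : ctx n r s1 by apply: ctx_eval.
have f1 v : v \in [:: v_hi; v_lo; v_step] -> var s1 v = var s v.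
  by rewrite !inE => /or3P[] /eqP->; rewrite /s1 evalv.
have tab1 : table_at s1 (var s v_lo) L.
  by apply: (table_at_same (leqnn _) _ tab) => j _; rewrite /s1 evala.
pose acc k := foldl (insert_both C deg c) [::] (take k L).
(* Insertion only appends, so the bound on the final table also holds for every intermediate one. *)
have acc_size k : size (acc k) <= M.
  apply: leq_trans LM'; rewrite /L' /next_table -[in X in _ <= X](cat_take_drop k L) foldl_cat.
  exact: size_foldl_insert.
pose I m s' := exists2 k, m = size L - k & k <= size L /\
  [/\ ctx n r s' /\ (forall u, arr s' a_done u = arr s1 a_done u),
      var s' v_e = var s v_lo + k * n.+1 /\ var s' v_d = (size L - k) * n.+1,
      table_at s' (var s v_lo) L,
      var s' v_hi = var s v_hi + size (acc k) * n.+1 /\ table_at s' (var s v_hi) (acc k) &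
      (forall v, v \in [:: v_lim; v_cur; v_lo; v_step] -> var s' v = var s1 v) /\
      (forall u, u < n -> (arr s' a_closed u != 0) = C u) /\
      (forall u, u < n -> arr s' a_deg u = deg u)].
have I0 : I (size L) s1.
  exists 0; rewrite ?subn0 //; split=> //; split=> //.
  - by rewrite e1 d1 hi addKn mul0n addn0.
  - by rewrite f1 // /acc take0 /= mul0n addn0.
  - by split=> //; split=> // u un; rewrite /s1 evala // hdeg.
set body := CSeq (c_insert p_copy) (CSeq (c_insert (p_copy ;; p_select)) (to_cmd p_advance)).
have step m s' : I m s' -> var s' v_d != 0 -> exists t s'', [/\ run x body s' t s'',
    t <= insert_time M p_copy + (insert_time M (p_copy ;; p_select) + cost n.+1 p_advance) &
    exists2 m', m' < m & I m' s''].
  move=> [k -> [kL [[c' dn'] [e' d'] tab' [hi' acc'] [f' [cl' dg']]]]] d0.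
  have {}kL : k < size L by move: d0; rewrite d' -lt0n muln_gt0 subn_gt0 => /andP[].
  have lim' : var s' v_lim = var s v_hi by rewrite f'.
  have vk : vec n s' (var s' v_e) = nth [::] L k by rewrite e' tab'.
  have hik : var s v_lo + size L * n.+1 <= var s' v_hi by rewrite hi' hi leq_addr.
  have hi'' : var s' v_hi = var s' v_lim + size (acc k) * n.+1 by rewrite lim'.
  have acc'' : table_at s' (var s' v_lim) (acc k) by rewrite lim'.
  have [t1 [s2 [r2 tb2 same2 hi2 tab2]]] :=
    c_insertP (pre := p_copy) isT isT isT c' cl' dg' hi'' acc'' (acc_size k).
  rewrite -/x p_copyP // vk lim' in hi2 tab2; have [fv2 fa2] := run_frame r2.
  have c2 : ctx n r s2 by apply: ctx_run r2 _ _ c'.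
  have tabL2 : table_at s2 (var s v_lo) L by apply: table_at_same hik same2 tab'.
  set A1 := insert_vec C deg (acc k) (nth [::] L k) in hi2 tab2.
  have accS : acc k.+1 = insert_vec C deg A1 (add_vec G r c (nth [::] L k)).
    by rewrite /acc (take_nth [::] kL) foldl_rcons.
  have A1M : size A1 <= M.
    by apply: leq_trans (acc_size k.+1); rewrite accS size_insert_vec.
  have cl2 u : u < n -> (arr s2 a_closed u != 0) = C u by move=> un; rewrite fa2 // cl'.
  have dg2 u : u < n -> arr s2 a_deg u = deg u by move=> un; rewrite fa2 // dg'.
  have lim2 : var s2 v_lim = var s v_hi by rewrite fv2.
  have hi2' : var s2 v_hi = var s2 v_lim + size A1 * n.+1 by rewrite lim2.
  have tab2' : table_at s2 (var s2 v_lim) A1 by rewrite lim2.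
  have e2 : var s2 v_e = var s' v_e by rewrite fv2.
  have cur2 : var s2 v_cur = c by rewrite fv2 // f' // cur1.
  have tmp2 : tmp n (eval x (p_copy ;; p_select) s2) = add_vec G r c (nth [::] L k).
    rewrite evalS p_selectP ?evalv //; last by rewrite cur2.
      by rewrite cur2 p_copyP // e2 e' tabL2.
    exact: ctx_eval.
  have [t2 [s3 [r3 tb3 same3 hi3 tab3]]] :=
    c_insertP (pre := (p_copy ;; p_select)) isT isT isT c2 cl2 dg2 hi2' tab2' A1M.
  rewrite -/x tmp2 lim2 -accS in hi3 tab3; have [fv3 fa3] := run_frame r3.
  have c3 : ctx n r s3 by apply: ctx_run r3 _ _ c2.
  have tabL3 : table_at s3 (var s v_lo) L.
    apply: table_at_same _ same3 tabL2; apply: leq_trans hik _.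
    by rewrite hi2 hi' leq_add2l leq_mul2r size_insert_vec orbT.
  set s4 := eval x p_advance s3.
  have [t4 tb4 r4] := @run_blk_ctx n G r p_advance _ isT isT isT isT c3.
  exists (t1 + (t2 + t4)), s4; split.
  - exact: RSeq r2 (RSeq r3 r4).
  - by rewrite !leq_add.
  - exists (size L - k.+1); first by rewrite ltn_sub2l.
    exists k.+1 => //; split=> //.
    have n13 : var s3 v_n1 = n.+1 by case: c3.
    have e3 : var s3 v_e = var s v_lo + k * n.+1 by rewrite fv3 // fv2.
    split.
    + split; first exact: ctx_eval.
      by move=> u; rewrite /s4 evala // fa3 // fa2 // dn'.
    + rewrite /s4 /= n13 e3 fv3 // fv2 // lim' hi mulnBl mulSn; split; lia.
    + by apply: (table_at_same (leqnn _) _ tabL3) => j _; rewrite /s4 evala.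
    + split; first by rewrite /s4 evalv.
      by apply: (table_at_same (leqnn _) _ tab3) => j _; rewrite /s4 evala.
    + split; [move=> v hv|split=> u un].
      * rewrite -f' // /s4 evalv; last by move: hv; rewrite !inE => /or4P[] /eqP->.
          by move: hv; rewrite !inE => /or4P[] /eqP->; rewrite fv3 // fv2.
        by [].
      * by rewrite /s4 evala // fa3 // cl2.
      * by rewrite /s4 evala // fa3 // dg2.
have [t2 [s2 [r2 tb2 [d20 [m' [k _ [kL [[c2 dn2] [_ d2] _ [hi2 acc2] [f2 _]]]]]]]]] :=
  run_while_measure step I0.
have ek : k = size L.
  apply/eqP; rewrite eqn_leq kL /= -subn_eq0.
  by move/eqP: d20; rewrite d2 muln_eq0 orbF.
rewrite ek in hi2 acc2.
have accL : acc (size L) = L' by rewrite /acc take_size.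
rewrite accL in hi2 acc2.
set fin := (AddV v_lo v_lim v_zero ;; AddV v_step v_step v_one ;; SubV v_dstep v_n v_step).
set s3 := eval x fin s2.
have [t1 tb1 r1] := @run_blk_ctx n G r p_stage_start _ isT isT isT isT cs.
have [t3 tb3 r3] := @run_blk_ctx n G r fin _ isT isT isT isT c2.
have [hn2 _ one2 zero2 _] := c2.
have lo3 : var s3 v_lo = var s v_hi by rewrite /s3 /fin /= zero2 addn0 f2.
exists (t1 + (t2 + t3)), s3; split.
- split; first exact: RSeq r1 (RSeq r2 r3).
  apply: leq_add => //; apply: leq_add => //.
  by apply: leq_trans tb2 _; rewrite leq_add2r leq_mul2r LM orbT.
- split; first exact: ctx_eval.
  by move=> u; rewrite /s3 /fin evala // dn2 dn1.
- by rewrite lo3 /s3 /fin evalv.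
- by rewrite lo3; apply: (table_at_same (leqnn _) _ acc2) => j _; rewrite /s3 /fin evala.
- by rewrite /s3 /fin /= one2 hn2 f2 // f1 // addn1.
Qed.

End Tables.

(** * Partial alliances and their records *)

Section States.
Variables (n : nat) (G : sgraph 'I_n) (r : nat) (out : seq nat).
Implicit Types (S : {set 'I_n}) (z : seq nat) (i u : nat).

(* A selected vertex gets n extra units on its own counter; this marks it as
   selected, and makes the condition checked on its counter hold. *)
Definition counter S (u : nat) : nat :=
  \sum_(v in S) (adjn G r v u + (if u == v then n else 0)).

Definition degree (u : nat) : nat := \sum_(v < n) adjn G r u v.

Definition closed_at i : pred nat := fun u =>
  (u \in take i out) && all (fun v => (adjn G r u v != 0) ==> (v \in take i out)) (iota 0 n).

Definition satisfied S (u : nat) : bool :=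
  (counter S u == 0) || (degree u + 2 <= 2 * counter S u).

Definition state i S : seq nat :=
  mkseq (fun u => if u == n then #|S| else if closed_at i u then 0 else counter S u) n.+1.

Definition valid i S : bool :=
  [forall u in S, nat_of_ord u \in take i out] &&
  [forall u : 'I_n, closed_at i u ==> satisfied S u].

Lemma adjn_sym u v : u < n -> v < n -> adjn G r u v = adjn G r v u.
Proof.
move=> un vn; have := adjnE G r (Ordinal un) (Ordinal vn).
have := adjnE G r (Ordinal vn) (Ordinal un); rewrite /= => -> ->.
by rewrite adj_sym.
Qed.

Lemma counterU1 S (c : 'I_n) u : c \notin S ->
  counter (c |: S) u = counter S u + (adjn G r c u + (if u == c then n else 0)).
Proof. by move=> cS; rewrite /counter big_setU1 //= addnC. Qed.

Lemma nth_state i S u : u < n.+1 -> nth 0 (state i S) u =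
  if u == n then #|S| else if closed_at i u then 0 else counter S u.
Proof. by move=> un; rewrite nth_mkseq. Qed.

Lemma nth_state_lt i S u : u < n ->
  nth 0 (state i S) u = if closed_at i u then 0 else counter S u.
Proof. by move=> un; rewrite nth_state ?ltn_eqF // ltnS ltnW. Qed.

Lemma nth_state_n i S : nth 0 (state i S) n = #|S|.
Proof. by rewrite nth_state // eqxx. Qed.

Hypothesis uniq_out : uniq out.
Hypothesis full_out : forall u : 'I_n, nat_of_ord u \in out.
Hypothesis out_lt : forall u, u \in out -> u < n.

Lemma size_out : size out = n.
Proof.
have : perm_eq out (iota 0 n).
  apply: uniq_perm => //; first exact: iota_uniq.
  move=> u; rewrite mem_iota add0n; apply/idP/idP => [/out_lt//|/andP[_ un]].
  exact: (full_out (Ordinal un)).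
by move=> /perm_size ->; rewrite size_iota.
Qed.

Section Step.
Variables (i : nat) (i_n : i < n).
Let c := nth 0 out i.
Let co : c < n. Proof. by apply: out_lt; rewrite mem_nth // size_out. Qed.
Let oc : 'I_n := Ordinal co.

Lemma take_step u : (u \in take i.+1 out) = (u == c) || (u \in take i out).
Proof. by rewrite (take_nth 0) ?size_out // mem_rcons inE. Qed.

Lemma c_new : c \notin take i out.
Proof.
have : uniq (take i out ++ drop i out) by rewrite cat_take_drop.
rewrite cat_uniq => /and3P[_ /hasPn h _].
have cd : c \in drop i out by rewrite /c (drop_nth 0) ?size_out // mem_head.
exact: h cd.
Qed.

Lemma closed_step u : closed_at i u -> closed_at i.+1 u.
Proof.
move=> /andP[ui /allP al]; rewrite /closed_at take_step ui orbT /=.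
by apply/allP => v vn; apply/implyP => /(implyP (al v vn)); rewrite take_step => ->; rewrite orbT.
Qed.

Definition extend (b : bool) S : {set 'I_n} := if b then oc |: S else S.
Definition extend_vec (b : bool) z : seq nat := if b then add_vec G r c z else z.

(** All neighbours of a closed vertex are placed, so the new vertex [c] is not among them, nor is it
    the vertex itself. *)
Lemma closed_far S u : closed_at i u -> u < n ->
  adjn G r c u + (if u == c then n else 0) = 0.
Proof.
move=> /andP[ui /allP al] un.
have -> : (u == c) = false by apply: contraTF ui => /eqP ->; apply: c_new.
rewrite addn0 adjn_sym //; apply/eqP; apply: contraNT c_new => a0.
by apply: (implyP (al c _)) => //; rewrite mem_iota add0n co.
Qed.

Lemma extendP b S : [forall u in S, nat_of_ord u \in take i out] ->
  [/\ forall u, u < n -> nth 0 (extend_vec b (state i S)) u =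
        if closed_at i u then 0 else counter (extend b S) u,
      nth 0 (extend_vec b (state i S)) n = #|extend b S| &
      forall u, u < n -> closed_at i u -> counter (extend b S) u = counter S u].
Proof.
move=> /forall_inP sub; have cS : oc \notin S.
  by apply/negP => /sub; rewrite (negPf c_new).
case: b => /=; last first.
  by split=> // [u un|]; [apply: nth_state_lt|apply: nth_state_n].
split=> [u un||u un cu].
- rewrite nth_mkseq; last exact: ltnW.
  rewrite nth_state_lt // ltn_eqF //.
  case: ifP => cu; first by rewrite add0n (closed_far S).
  by rewrite counterU1.
- by rewrite nth_mkseq // nth_state_n eqxx cardsU1 cS addnC.
- by rewrite counterU1 // (closed_far S) // addn0.
Qed.

(** A vertex closed earlier shows the counter 0 and passes the test. Its condition remains true
    nevertheless, as its actual counter does not change by [closed_far]. *)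
Lemma ok_extend b S : valid i S ->
  ok_vec n (closed_at i.+1) degree (extend_vec b (state i S)) = valid i.+1 (extend b S) /\
  clear_vec n (closed_at i.+1) (extend_vec b (state i S)) = state i.+1 (extend b S).
Proof.
case/andP=> sub /forallP va; have [h1 h2 h3] := extendP b sub; split; last first.
  apply: eq_mkseq_in => u; rewrite ltnS leq_eqVlt => /orP[/eqP ->|un].
    by rewrite ltnn eqxx h2.
  rewrite un (ltn_eqF un) h1 //=; case: ifP => // nc.
  by case: ifP => // /closed_step; rewrite nc.
have -> : valid i.+1 (extend b S) =
    [forall u : 'I_n, closed_at i.+1 u ==> satisfied (extend b S) u].
  rewrite /valid; case: (boolP [forall u in _, _]) => //= /negP[].
  apply/forall_inP => u uS; rewrite take_step; move: uS; rewrite /extend.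
  case: b {h1 h2 h3} => [|uS]; last by rewrite (forall_inP sub _ uS) orbT.
  rewrite inE => /orP[|uS]; last by rewrite (forall_inP sub _ uS) orbT.
  by rewrite inE -val_eqE /= => ->.
have eq u : u < n -> closed_at i.+1 u -> (nth 0 (extend_vec b (state i S)) u == 0) ||
    (degree u + 2 <= 2 * nth 0 (extend_vec b (state i S)) u) = satisfied (extend b S) u.
  move=> un _; rewrite h1 //; case: ifP => // cu.
  by have := va (Ordinal un); rewrite cu /= /satisfied h3 // => ->.
apply/allP/forallP => [h u|h u].
  apply/implyP => cu; rewrite -eq ?ltn_ord //.
  by have := h u; rewrite mem_iota add0n ltn_ord cu; apply.
rewrite mem_iota add0n => /andP[_ un]; apply/implyP => cu; rewrite eq //.
exact: (implyP (h (Ordinal un))).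
Qed.

(** Removing the newest vertex does not affect the counters of the vertices closed before it, so
    every valid set arises from a valid one by a stage. *)
Lemma valid_restrict S' : valid i.+1 S' -> exists b S, valid i S /\ S' = extend b S.
Proof.
move=> /andP[/forall_inP sub /forallP va].
have sub' : [forall u in S' :\ oc, nat_of_ord u \in take i out].
  apply/forall_inP => u; rewrite !inE => /andP[ne /sub]; rewrite take_step => /orP[|//].
  by move=> e; case/negP: ne; rewrite -val_eqE.
exists (oc \in S'), (S' :\ oc).
have eS : S' = extend (oc \in S') (S' :\ oc).
  apply/setP => u; rewrite /extend; case: ifP => h; rewrite !inE.
    by case: eqP => [->|].
  by case: eqP => [->|].
split=> //; rewrite /valid sub' /=; apply/forallP => u; apply/implyP => cu.
have [_ _ h3] := extendP (oc \in S') sub'.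
have := implyP (va u) (closed_step cu); rewrite {1}eS /satisfied h3 //.
Qed.

End Step.

Lemma mem_insert_vec C deg L z w : (w \in insert_vec n C deg L z) =
  (w \in L) || ok_vec n C deg z && (w == clear_vec n C z).
Proof.
rewrite /insert_vec; case: ok_vec => /=; last by rewrite orbF.
case: (boolP (_ \in L)) => h /=; last by rewrite mem_rcons inE orbC.
by case: eqP => [->|]; rewrite ?h ?orbF.
Qed.

Lemma uniq_insert_vec C deg L z : uniq L -> uniq (insert_vec n C deg L z).
Proof.
by move=> uL; rewrite /insert_vec; case: ifP => // /andP[_ h]; rewrite rcons_uniq h.
Qed.

Lemma uniq_next_table C deg c L : uniq (next_table G r C deg c L).
Proof.
suff H A : uniq A -> uniq (foldl (insert_both G r C deg c) A L) by apply: H.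
by elim: L A => //= z L IH A uA; apply: IH; do 2!apply: uniq_insert_vec.
Qed.

Lemma mem_next_table C deg c L w : (w \in next_table G r C deg c L) =
  has (fun z => ok_vec n C deg z && (w == clear_vec n C z) ||
    ok_vec n C deg (add_vec G r c z) && (w == clear_vec n C (add_vec G r c z))) L.
Proof.
rewrite /next_table; suff H A : (w \in foldl (insert_both G r C deg c) A L) =
    (w \in A) || has (fun z => ok_vec n C deg z && (w == clear_vec n C z) ||
    ok_vec n C deg (add_vec G r c z) && (w == clear_vec n C (add_vec G r c z))) L.
  exact: H.
elim: L A => [|z L IH] A /=; first by rewrite orbF.
by rewrite IH !mem_insert_vec !orbA.
Qed.

Fixpoint table (i : nat) : seq (seq nat) :=
  if i is i'.+1 then next_table G r (closed_at i) degree (nth 0 out i') (table i')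
  else [:: nseq n.+1 0].

Lemma uniq_table i : uniq (table i).
Proof. by case: i => [|i] //; apply: uniq_next_table. Qed.

Lemma tableP i w : i <= n ->
  reflect (exists2 S, valid i S & w = state i S) (w \in table i).
Proof.
elim: i w => [|i IH] w i_n.
  have st0 : state 0 set0 = nseq n.+1 0.
    apply: (@eq_from_nth _ 0); first by rewrite size_mkseq size_nseq.
    move=> u; rewrite size_mkseq => un; rewrite nth_state // nth_nseq un cards0.
    by case: ifP => // _; rewrite /closed_at take0 /= /counter big_set0.
  rewrite /= inE; apply: (iffP eqP) => [->|[S /andP[/forall_inP sub _] ->]].
    exists set0 => //; rewrite /valid; apply/andP; split.
      by apply/forall_inP => u; rewrite inE.
    by apply/forallP => u; rewrite /closed_at take0.
  have -> : S = set0 by apply/setP => u; rewrite inE; apply/negP => /sub; rewrite take0.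
  exact: st0.
rewrite [table _]/= mem_next_table; apply: (iffP hasP).
  case=> z /IH -/(_ (ltnW i_n))[S vS ->].
  have [ok0 cl0] := ok_extend i_n false vS; have [ok1 cl1] := ok_extend i_n true vS.
  rewrite /extend_vec in ok0 cl0 ok1 cl1.
  rewrite ok0 cl0 ok1 cl1 => /orP[]/andP[v /eqP ->]; by eexists; [exact: v|].
case=> S' vS' ->; have [b [S [vS eS]]] := valid_restrict i_n vS'.
have [ok cl] := ok_extend i_n b vS; exists (state i S).
  by apply/(IH _ (ltnW i_n)); exists S.
rewrite eS in vS' *; rewrite vS' in ok.
by case: b {eS vS'} ok cl => /= -> ->; rewrite eqxx ?orbT.
Qed.

Hypothesis n_pos : 0 < n.

Lemma counterE S (u : 'I_n) :
  counter S u = deg_in G S u + (if u \in S then n else 0).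
Proof.
rewrite /counter big_split /=; congr (_ + _).
  rewrite (eq_bigr (fun v : 'I_n => nat_of_bool (G v u))) => [|v _]; last exact: adjnE.
  rewrite -big_mkcondr sum1_card; apply: eq_card => v.
  by rewrite !inE unfold_in /= adj_sym.
rewrite -big_mkcondr /=; case: ifP => uS.
  rewrite (big_pred1 u) // => v /=; rewrite -val_eqE eq_sym /=.
  by rewrite andb_idl // => /eqP/val_inj ->.
rewrite big_pred0 // => v; apply/negbTE/negP => /andP[vS /eqP/val_inj e].
by rewrite e vS in uS.
Qed.

Lemma deg_in_lt S (u : 'I_n) : deg_in G S u < n.
Proof.
apply: (@leq_ltn_trans #|[set~ u]|); last by rewrite cardsC1 card_ord ltn_predL.
apply: subset_leq_card; apply/subsetP => v; rewrite !inE => /andP[_ uv].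
by apply: contraTneq uv => ->; rewrite adj_irrefl.
Qed.

(** Degrees are smaller than [n], so the extra [n] units can be recognised. *)
Lemma selected_counter S (u : 'I_n) : (u \in S) = (n <= counter S u).
Proof.
rewrite counterE; case: (u \in S); first by rewrite leq_addl.
by rewrite addn0 leqNgt deg_in_lt.
Qed.

(** A placed vertex outside of the frontier is closed and has entry 0. The counter of an unplaced
    vertex counts its selected neighbours; these are placed, hence in the frontier, where selection
    is visible from the counters. *)
Lemma state_frontier i S S' : valid i S -> valid i S' -> #|S| = #|S'| ->
  (forall u : 'I_n, u \in frontier G (take i out) ->
     nth 0 (state i S) u = nth 0 (state i S') u) -> state i S = state i S'.
Proof.
move=> /andP[/forall_inP sub _] /andP[/forall_inP sub' _] eS eF.
have not_closed (u : 'I_n) : u \in frontier G (take i out) -> closed_at i u = false.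
  rewrite inE => /andP[_ /existsP[v /andP[vi uv]]]; apply/negbTE/negP => /andP[_ /allP al].
  have := al v; rewrite mem_iota add0n ltn_ord => /(_ isT)/implyP.
  by rewrite adjnE uv (negPf vi) => /(_ isT).
have eFS (u : 'I_n) : u \in frontier G (take i out) -> (u \in S) = (u \in S').
  move=> uF; have := eF u uF; rewrite !nth_state_lt //.
  by rewrite not_closed // !selected_counter => ->.
apply: eq_mkseq_in => u; rewrite ltnS leq_eqVlt => /orP[/eqP ->|un]; first by rewrite eqxx.
rewrite ltn_eqF //; case: ifP => // nc; have [ui|ui] := boolP (u \in take i out).
  have uF : Ordinal un \in frontier G (take i out).
    rewrite inE ui /=; move/negbT: nc; rewrite /closed_at ui /= => /allPn[v].
    rewrite mem_iota add0n => /andP[_ vn]; rewrite negb_imply => /andP[uv vi].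
    apply/existsP; exists (Ordinal vn); rewrite vi /=.
    by move: uv; rewrite (adjnE G r (Ordinal un) (Ordinal vn)) eqb0 negbK.
  have := eF _ uF; rewrite !nth_state_lt //=.
  by rewrite (not_closed _ uF).
rewrite /counter [LHS]big_mkcond [RHS]big_mkcond; apply: eq_bigr => v _.
have uv0 : v \in S \/ v \in S' -> (u == v) = false.
  move=> h; apply/negbTE; apply: contraNneq ui => ->.
  by case: h => [/sub|/sub'].
have [vu|vu] := boolP (G v (Ordinal un)).
  have [vi|vi] := boolP (nat_of_ord v \in take i out).
    rewrite eFS // inE vi /=; apply/existsP; exists (Ordinal un).
    by rewrite /= ui vu.
  have -> : (v \in S) = false by apply/negbTE; apply: contra vi; apply: sub.
  by have -> : (v \in S') = false by apply/negbTE; apply: contra vi; apply: sub'.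
have a0 : adjn G r v u = 0 by rewrite (adjnE G r v (Ordinal un)) (negPf vu).
have zero T : (v \in T -> (u == v) = false) ->
    (if v \in T then adjn G r v u + (if u == v then n else 0) else 0) = 0.
  by case: ifP => // _ /(_ isT) ->; rewrite a0.
by rewrite !zero // => h; apply: uv0; [right|left].
Qed.

Lemma counter_lt S u : u < n -> counter S u < (2 * n).+1.
Proof.
move=> un; rewrite (counterE S (Ordinal un)).
by have := deg_in_lt S (Ordinal un); case: ifP => _; lia.
Qed.

(** By [state_frontier], a record is determined by its size entry and its counters on the frontier.
    The map [enc] puts 0 elsewhere, so its values lie in a product that is easy to count. *)
Lemma size_table i K : i <= n -> #|frontier G (take i out)| <= K ->
  size (table i) <= n.+1 * (2 * n).+1 ^ K.
Proof.
move=> i_n FK; set F := frontier G (take i out) in FK *.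
pose enc z : 'I_n.+1 * {ffun 'I_n -> 'I_(2 * n).+1} :=
  (inord (nth 0 z n), [ffun u : 'I_n => if u \in F then inord (nth 0 z u) else ord0]).
have enc_inj : {in table i &, injective enc}.
  move=> z z' /(tableP _ i_n)[S vS ->] /(tableP _ i_n)[S' vS' ->] [e1 /ffunP e2].
  have small (T : {set 'I_n}) : #|T| < n.+1.
    by rewrite ltnS; apply: leq_trans (max_card _) _; rewrite card_ord.
  apply: state_frontier => //.
    by move/(congr1 val): e1; rewrite !nth_state_n /= !inordK.
  move=> u uF; have := e2 u; rewrite !ffunE uF => /(congr1 val).
  have lt T : nth 0 (state i T) u < (2 * n).+1.
    rewrite nth_state_lt //; case: ifP => // _.
    exact: counter_lt.
  by rewrite /= !inordK.
have : uniq (map enc (table i)) by rewrite map_inj_in_uniq ?uniq_table.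
rewrite -(size_map enc) => /card_uniqP <-.
pose D : {set 'I_n.+1 * {ffun 'I_n -> 'I_(2 * n).+1}} :=
  setX [set: 'I_n.+1] [set g | g \in pffun_on ord0 F predT].
apply: leq_trans (_ : #|D| <= _).
  apply: subset_leq_card; apply/subsetP => y /mapP[z _ ->]; rewrite !inE /=.
  apply/pffun_onP; split=> //; apply/subsetP => u; rewrite inE ffunE.
  by case: ifP => // _; rewrite eqxx.
rewrite cardsX cardsT card_ord leq_mul2l /= cardsE card_pffun_on cardT size_enum_ord.
by rewrite leq_pexp2l.
Qed.

Lemma accept_table : (exists2 z, z \in table n & 1 <= nth 0 z n <= r) <->
  has_small_strong_offensive_alliance G r.
Proof.
have deg_card (u : 'I_n) : degree u = #|[set v | G u v]|.
  rewrite /degree (eq_bigr (fun v : 'I_n => nat_of_bool (G u v))) => [|v _]; last exact: adjnE.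
  by rewrite -big_mkcond /= -sum1_card; apply: eq_bigl => v; rewrite inE.
have all_in (u : 'I_n) : nat_of_ord u \in take n out.
  by rewrite take_oversize ?size_out.
have closed_n (u : 'I_n) : closed_at n u.
  rewrite /closed_at all_in; apply/allP => v; rewrite mem_iota add0n => /andP[_ vn].
  by rewrite (all_in (Ordinal vn)) implybT.
have sat (S : {set 'I_n}) (u : 'I_n) : satisfied S u =
   ((u \in open_nbhd G S) ==> (deg_in G (~: S)%SET u + 2 <= deg_in G S u)).
  have dsum : degree u = deg_in G S u + deg_in G (~: S)%SET u.
    rewrite deg_card -(cardsID S); congr (_ + _); apply: eq_card => v; rewrite !inE //.
    by rewrite andbC.
  rewrite /satisfied counterE inE; case: (boolP (u \in S)) => uS /=.
    have le := deg_in_lt [set: 'I_n] u.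
    have ed : degree u = deg_in G [set: 'I_n] u.
      by rewrite deg_card; apply: eq_card => v; rewrite !inE.
    (* A selected vertex passes because degree + 2 <= n + 1 <= 2n. *)
    by apply/orP; right; lia.
  rewrite addn0; have -> : [exists v in S, G v u] = (deg_in G S u != 0).
    rewrite -lt0n card_gt0; apply/existsP/set0Pn => -[v].
      by move=> /andP[vS vu]; exists v; rewrite inE vS adj_sym.
    by rewrite inE => /andP[vS uv]; exists v; rewrite vS adj_sym.
  case: eqP => //= _; rewrite dsum; apply/idP/idP; lia.
have validE S : valid n S =
   [forall u in open_nbhd G S, deg_in G (~: S)%SET u + 2 <= deg_in G S u].
  rewrite /valid (_ : [forall u in S, _]); last by apply/forall_inP.
  by apply: eq_forallb => u; rewrite closed_n /= sat.
split=> [[z /(tableP _ (leqnn n))[S vS ->]]|/existsP[S /andP[/andP[S0 vS] sz]]].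
  rewrite nth_state_n => sz; apply/existsP; exists S.
  rewrite sz andbT /strong_offensive_alliance -validE vS andbT.
  by case/andP: sz; rewrite card_gt0.
exists (state n S); last by rewrite nth_state_n.
by apply/(tableP _ (leqnn n)); exists S => //; rewrite validE.
Qed.

End States.

(** * Running time and correctness *)

Section Main.
Variables (n : nat) (G : sgraph 'I_n) (r : nat) (h f : nat -> nat) (K : nat).
Let x := encode G r.
Hypothesis n_pos : 0 < n.
Hypothesis hf : forall a b, 0 < a -> 2 * b <= a -> h a + f b <= f a.
Hypothesis fK : f n <= K.
Hypothesis f_mono : forall a b, a <= b -> f a <= f b.
Hypothesis sep : forall A : {set 'I_n}, exists X : {set 'I_n},
  [/\ X \subset A, #|X| <= h #|A| & halves G A (A :\: X)].

Definition table_bound : nat := n.+1 * (2 * n).+1 ^ K.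

Definition order_time : nat :=
  cost n.+1 p_top + (n * n * (block_time n K + 2) + 1).

Definition main_time : nat :=
  cost n.+1 p_init + (order_time + (cost n.+1 (p_degrees ;; SubV v_dstep v_n v_step) +
    (n * (stage_time n table_bound + 2) + 1 + (cost n.+1 p_accept_start +
      (table_bound * (cost n.+1 p_accept + 2) + 1))))).

Lemma accept_loop s L : ctx n r s -> var s v_e = var s v_lo -> var s v_res = 0 ->
  var s v_hi = var s v_lo + size L * n.+1 -> var s v_d = size L * n.+1 ->
  table_at n s (var s v_lo) L ->
  exists t s', [/\ run x (CWhile v_d (to_cmd p_accept)) s t s',
    t <= size L * (cost n.+1 p_accept + 2) + 1 &
    var s' v_res = has (fun z => 1 <= nth 0 z n <= r) L].
Proof.
move=> cs e0 res0 hi d0 tab.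
pose I m s' := exists2 k, m = size L - k & k <= size L /\ [/\ ctx n r s',
  var s' v_e = var s v_lo + k * n.+1, var s' v_d = (size L - k) * n.+1,
  var s' v_hi = var s v_hi /\ (forall j, arr s' a_tab j = arr s a_tab j) &
  var s' v_res = has (fun z => 1 <= nth 0 z n <= r) (take k L)].
have I0 : I (size L) s.
  exists 0; rewrite ?subn0 //; split=> //; split=> //; last by rewrite take0.
  by rewrite e0 mul0n addn0.
have step m s' : I m s' -> var s' v_d != 0 -> exists t s'',
    [/\ run x (to_cmd p_accept) s' t s'', t <= cost n.+1 p_accept & exists2 m', m' < m & I m' s''].
  move=> [k -> [kL [c' e' d' [hi' tab'] res']]] dn0.
  have {}kL : k < size L by move: dn0; rewrite d' -lt0n muln_gt0 subn_gt0 => /andP[].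
  have [t tb rn] := @run_blk_ctx n G r p_accept _ isT isT isT isT c'.
  exists t, (eval x p_accept s'); split=> //.
  exists (size L - k.+1); first by rewrite ltn_sub2l.
  exists k.+1 => //; split=> //; have [r1 r2 r3] := p_acceptP G c'.
  rewrite -/x in r1 r2 r3; split.
  - exact: ctx_eval.
  - by rewrite r2 e' mulSn; lia.
  - by rewrite r3 e' hi' hi mulnBl mulSn; lia.
  - by split=> [|j]; rewrite ?evalv ?evala.
  - rewrite r1 res' (take_nth [::] kL) -cats1 has_cat /= orbF.
    have -> : arr s' a_tab (var s' v_e + n) = nth 0 (nth [::] L k) n.
      by rewrite tab' e' -tab // nth_mkseq.
    by case: ifP => _; rewrite ?orbT ?orbF.
have [t [s' [rn tb [d' [m' [k _ [kL [_ _ dk _ res']]]]]]]] := run_while_measure step I0.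
exists t, s'; split=> //; rewrite res'; suff -> : k = size L by rewrite take_size.
by apply/eqP; rewrite eqn_leq kL /= -subn_eq0; move/eqP: d'; rewrite dk muln_eq0 orbF.
Qed.

Lemma c_mainP s : (forall v, var s v = 0) -> (forall A j, arr s A j = 0) ->
  exists t s', [/\ run x c_main s t s', t <= main_time &
    var s' v_res = has_small_strong_offensive_alliance G r].
Proof.
move=> v0 a0; have [cs1 blk1] := p_initP G r v0 a0; rewrite -/x in cs1 blk1.
(* [p_init] itself sets [v_n], whereas [run_blk] wants unmodified loop bounds; so it is applied to
   the two loops only. *)
have rt1 : exists2 t, t <= cost n.+1 p_init & run x (to_cmd p_init) s t (eval x p_init s).
  pose rest := BSeq (BFor v_i v_n v_di (Put a_row v_i v_t ;; AddV v_t v_t v_n))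
    (BFor v_i v_n v_di (Put a_blk v_i v_one)).
  pose s0 := exec_atom x (SetC v_t 2) (exec_atom x (AddV v_n1 v_n v_one)
    (exec_atom x (Inp v_r v_one) (exec_atom x (Inp v_n v_zero)
    (exec_atom x (SetC v_one 1) s)))).
  have sn : var s0 v_n = n by rewrite /s0 /= v0.
  have [|t tb rn] := @run_blk x rest s0 n.+1 isT.
    by move=> N; rewrite !inE => /orP[] /eqP->; rewrite sn.
  exists (1 + (1 + (1 + (1 + (1 + t))))); first by move: tb; rewrite /rest /=; lia.
  do 5!(apply: RSeq; first exact: RAtom).
  exact: rn.
set s1 := eval x p_init s in cs1 blk1 rt1.
have z1 v : v \in [:: v_cnt; v_lo; v_step; v_res] -> var s1 v = 0.
  by rewrite !inE => /or4P[] /eqP->; rewrite /s1 evalv.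
have za1 A j : A \in [:: a_done; a_tab] -> arr s1 A j = 0.
  by rewrite !inE => /orP[] /eqP->; rewrite /s1 evala.
have [t2 [s2 [r2 tb2 [good_out full_out]]]] :=
  c_orderP hf fK f_mono sep cs1 blk1 (z1 v_cnt isT).
have [fv2 fa2] := run_frame r2.
have cs2 : ctx n r s2 by apply: ctx_run r2 _ _ cs1.
set out := order_of s2 in good_out full_out; have [uo lo fro] := good_out.
have so : size out = n by apply: size_out full_out lo.
have ord2 i : i < n -> arr s2 a_ord i = nth 0 out i.
  by move=> i_n; rewrite /out /order_of nth_mkseq //; move: so; rewrite size_mkseq => ->.
set s3 := eval x (p_degrees ;; SubV v_dstep v_n v_step) s2.
have cs3 : ctx n r s3 by apply: ctx_eval.
have [deg3 hi3] := p_degreesP G cs2; rewrite -/x in deg3 hi3.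
have [t3 tb3 r3] := @run_blk_ctx n G r (p_degrees ;; SubV v_dstep v_n v_step) _ isT isT isT isT cs2.
have e3 v : v \in [:: v_lo; v_step; v_res] -> var s3 v = 0.
  by rewrite !inE => /or3P[] /eqP->; rewrite /s3 evalv // fv2 // z1.
pose M := table_bound.
pose tbl := table G r out.
have sz i : i <= n -> size (tbl i) <= M.
  by move=> i_n; apply: size_table => //; apply: fro; rewrite so.
pose I m s' := exists2 i, m = n - i & i <= n /\ [/\ ctx n r s',
  (forall u, (arr s' a_done u != 0) = (u \in take i out)),
  (forall j, j < n -> arr s' a_ord j = nth 0 out j) /\
  (forall u, u < n -> arr s' a_deg u = degree G r u),
  var s' v_hi = var s' v_lo + size (tbl i) * n.+1 /\ table_at n s' (var s' v_lo) (tbl i) &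
  [/\ var s' v_step = i, var s' v_dstep = n - i & var s' v_res = 0]].
have I0 : I n s3.
  exists 0; rewrite ?subn0 //; split=> //; split=> //.
  - by move=> u; rewrite take0 /s3 evala // fa2 // za1.
  - split=> [j jn|u un]; first by rewrite /s3 evala // ord2.
    by rewrite /s3 evalS [LHS]/= deg3.
  - rewrite (e3 v_lo isT) add0n; split.
      by rewrite mul1n -hi3 /s3 evalS.
    case=> // _; apply: (@eq_from_nth _ 0); rewrite size_mkseq ?size_nseq // => u un.
    by rewrite nth_mkseq // nth_nseq un /s3 evala // fa2 // za1.
  - split; [exact: e3| |exact: e3]; set s' := eval x p_degrees s2.
    have -> : var s3 v_dstep = var s' v_n - var s' v_step by [].
    rewrite !evalv // [var s2 v_step]fv2 // z1 // subn0.
    by have [->] := cs2.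
have step m s' : I m s' -> var s' v_dstep != 0 -> exists t s'', [/\ run x c_stage s' t s'',
    t <= stage_time n M & exists2 m', m' < m & I m' s''].
  move=> [i -> [i_n [c' dn' [ord' deg'] [hi' tab'] [st' ds' res']]]] d0.
  have {}i_n : i < n by move: d0; rewrite ds' -lt0n subn_gt0.
  have cE : arr s' a_ord (var s' v_step) = nth 0 out i by rewrite st' ord'.
  have c_lt : arr s' a_ord (var s' v_step) < n by rewrite cE; apply: lo; rewrite mem_nth ?so.
  have := c_stageP (G := G) (M := M) c' c_lt deg' hi' tab'.
  cbv beta zeta; set C := (X in next_table G r X).
  have -> : C = closed_at G r out i.+1.
    have dnE u : (u == arr s' a_ord (var s' v_step)) || (arr s' a_done u != 0) =
        (u \in take i.+1 out) by rewrite (take_step uo full_out lo) // cE dn'.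
    apply/funext => u; rewrite /C /closed_at dnE; congr (_ && _).
    by apply: eq_all => v; rewrite dnE.
  rewrite cE -/(tbl i.+1) => /(_ (sz _ (ltnW i_n)) (sz _ i_n)).
  move=> [t [s'' [[rn tb] [c'' dn''] hi'' tab'' [st'' ds'']]]].
  have [fv fa] := run_frame rn.
  exists t, s''; split=> //; exists (n - i.+1); first by rewrite ltn_sub2l.
  exists i.+1 => //; split=> //; split=> //.
  - by move=> u; rewrite dn'' dn' (take_step uo full_out lo) // cE.
  - by split=> j jn; rewrite fa // ?ord' ?deg'.
  - by rewrite st'' ds'' st' fv.
have [t4 [s4 [r4 tb4 [d4 [m' [i _ [i_n [cs4 _ _ [hi4 tab4] [_ ds4 res4]]]]]]]]] :=
  run_while_measure step I0.
have ei : i = n by apply/eqP; rewrite eqn_leq i_n /= -subn_eq0 -ds4 d4.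
rewrite ei in hi4 tab4.
set s5 := eval x p_accept_start s4.
have cs5 : ctx n r s5 by apply: ctx_eval.
have [t5 tb5 r5] := @run_blk_ctx n G r p_accept_start _ isT isT isT isT cs4.
have [_ _ _ zero4 _] := cs4.
have lo5 : var s5 v_lo = var s4 v_lo by [].
have [||||||t6 [s6 [r6 tb6 res6]]] := @accept_loop s5 (tbl n).
- by [].
- by rewrite /s5 /= zero4 addn0.
- by rewrite /s5 evalv.
- by rewrite lo5 -hi4.
- by rewrite /s5 /= zero4 addn0 hi4 addKn.
- by rewrite lo5.
have [t1 tb1 r1] := rt1.
exists (t1 + (t2 + (t3 + (t4 + (t5 + t6))))), s6; split.
- by apply: RSeq r1 (RSeq r2 (RSeq r3 (RSeq r4 (RSeq r5 r6)))).
- rewrite /main_time; do 3!(apply: leq_add => //); apply: leq_add => //; apply: leq_add => //.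
  by apply: leq_trans tb6 _; rewrite leq_add2r leq_mul2r sz ?orbT.
- rewrite res6; congr nat_of_bool; have acc := accept_table G r uo full_out lo n_pos.
  apply/hasP/idP => [[z hz1 hz2]|/acc[z hz1 hz2]]; last by exists z.
  by apply/acc; exists z.
Qed.

End Main.

Lemma cost_le p q b : 0 < p -> weight b <= q -> depth b <= 3 -> cost p b <= q * p ^ 3.
Proof.
move=> p0 wq d3; apply: leq_trans (cost_bound b p0) _.
by rewrite leq_mul // leq_pexp2l.
Qed.

(** * Crude sums of running times: p is n + 1, W is (2n + 1)^K, and Q bounds the cost of a block of
    code *)

Section Arith.
Variables (p W Q : nat).
Hypotheses (p0 : 0 < p) (W0 : 0 < W) (Q0 : 0 < Q).

Lemma order_arith c1 c2 c3 c4 c5 V m : c1 <= Q -> c2 <= Q -> c3 <= Q -> c4 <= Q -> c5 <= Q ->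
  V <= W -> m <= p ->
  c1 + (m * m * (c2 + (V * (c3 + 2) + 1 + (c4 + c5)) + 2) + 1) <= 11 * (p * p * (W * Q)).
Proof.
move=> h1 h2 h3 h4 h5 VW mp.
have WQ : Q <= W * Q by rewrite leq_pmull.
have WQ' : W <= W * Q by rewrite leq_pmulr.
have V1 : V * (c3 + 2) <= W * (Q + 2) by rewrite leq_mul // leq_add2r.
have mm : m * m <= p * p by rewrite leq_mul.
have X0 : c2 + (V * (c3 + 2) + 1 + (c4 + c5)) + 2 <= 9 * (W * Q) by lia.
have : m * m * (c2 + (V * (c3 + 2) + 1 + (c4 + c5)) + 2) <= p * p * (9 * (W * Q)).
  by rewrite leq_mul.
have : W * Q <= p * p * (W * Q) by rewrite leq_pmull // muln_gt0 p0.
by lia.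
Qed.

Lemma insert_arith c1 c2 c3 M : c1 <= Q -> c2 <= Q -> c3 <= Q -> M <= p * W ->
  c1 + (M * (c2 + 2) + 1 + c3) <= 6 * (p * W * Q).
Proof.
move=> h1 h2 h3 MW; set Y := p * W in MW *; have Y0 : 0 < Y by rewrite muln_gt0 p0.
have : M * (c2 + 2) <= Y * (Q + 2) by rewrite leq_mul // leq_add2r.
have : Q <= Y * Q by rewrite leq_pmull.
have : Y <= Y * Q by rewrite leq_pmulr.
by lia.
Qed.

Lemma stage_arith c1 i1 i2 c2 c3 M : c1 <= Q -> c2 <= Q -> c3 <= Q ->
  i1 <= 6 * (p * W * Q) -> i2 <= 6 * (p * W * Q) -> M <= p * W ->
  c1 + (M * (i1 + (i2 + c2) + 2) + 1 + c3) <= 18 * (p * W * (p * W * Q)).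
Proof.
move=> h1 h2 h3 hi1 hi2 MW; set Y := p * W in MW hi1 hi2 *.
have Y0 : 0 < Y by rewrite muln_gt0 p0.
have YQ : Q <= Y * Q by rewrite leq_pmull.
have : M * (i1 + (i2 + c2) + 2) <= Y * (15 * (Y * Q)) by rewrite leq_mul //; lia.
have : Y * Q <= Y * (Y * Q) by rewrite leq_pmull.
by lia.
Qed.

Lemma main_arith c1 o c2 m s c3 c4 M : c1 <= Q -> c2 <= Q -> c3 <= Q -> c4 <= Q ->
  m <= p -> M <= p * W -> o <= 11 * (p * p * (W * Q)) -> s <= 18 * (p * W * (p * W * Q)) ->
  c1 + (o + (c2 + (m * (s + 2) + 1 + (c3 + (M * (c4 + 2) + 1))))) <= 40 * (p ^ 3 * W ^ 2 * Q).
Proof.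
move=> h1 h2 h3 h4 mp MW ho hs; set Y := p * W in MW hs *.
have Y0 : 0 < Y by rewrite muln_gt0 p0.
have -> : p ^ 3 * W ^ 2 * Q = p * (Y * (Y * Q)) by rewrite /Y; lia.
set Z := Y * (Y * Q) in hs *.
have YZ : Y * Q <= Z by rewrite leq_pmull.
have YQ : Q <= Y * Q by rewrite leq_pmull.
have YQ' : Y <= Y * Q by rewrite leq_pmulr.
have e1 : m * (s + 2) <= p * (20 * Z) by rewrite leq_mul //; lia.
have e2 : M * (c4 + 2) <= Y * (Q + 2) by rewrite leq_mul // leq_add2r.
have pZ : Z <= p * Z by rewrite leq_pmull.
have : p * p * (W * Q) <= p * Z.
  have -> : p * p * (W * Q) = p * (Y * Q) by rewrite /Y; lia.
  by rewrite leq_mul2l YZ orbT.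
by lia.
Qed.

End Arith.

(** Every loop-bounded block has weight at most 240 and at most three nested loops, a depth attained
    in [p_comp]. The square comes from the comparison of each new record with those already in the
    table. *)
Lemma main_time_le n K : main_time n K <= 40 * 240 * n.+1 ^ 6 * ((2 * n).+1 ^ K) ^ 2.
Proof.
set W := (2 * n).+1 ^ K; set Q := 240 * n.+1 ^ 3.
have W0 : 0 < W by rewrite expn_gt0.
have Q0 : 0 < Q by rewrite muln_gt0 expn_gt0.
have -> : 40 * 240 * n.+1 ^ 6 * W ^ 2 = 40 * (n.+1 ^ 3 * W ^ 2 * Q) by rewrite /Q -[6]/(3 + 3) expnD; ring.
have VW : n.+1 ^ K <= W by rewrite /W; case: (K) => // k; rewrite leq_exp2r // ltnS; lia.
apply: main_arith => //; try exact: cost_le.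
- by apply: order_arith => //; exact: cost_le.
- by apply: stage_arith => //; try exact: cost_le; apply: insert_arith => //; exact: cost_le.
Qed.

Lemma size_le_input_size x : size x <= input_size x.
Proof.
rewrite /input_size; elim: x => [|a x IH]; first by rewrite big_nil.
by rewrite big_cons /=; apply: leq_trans (leq_add (ltn0Sn _) IH).
Qed.

Lemma lt_input_size_encode n (G : sgraph 'I_n) r : n < input_size (encode G r).
Proof.
apply: leq_trans (size_le_input_size _).
by rewrite /encode /= size_allpairs size_enum_ord; nia.
Qed.

Lemma answers_main n (G : sgraph 'I_n) r t s (b : bool) :
  run (encode G r) c_main (Store (fun=> 0) (fun _ _ => 0)) t s ->
  var s v_res = b -> answers_within (compile c_main 0) (encode G r) t b.
Proof.
move=> rn res; have [||m' [r1 [h _ _]]] := compile_correct rn wf_main (P := compile c_main 0)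
  (off := 0) (m := fun=> 0); [by move=> i|by split|].
rewrite /answers_within r1 size_compile; split; first exact: leqnn.
by rewrite [LHS]h.
Qed.

Local Close Scope nat_scope.

(** * From the recurrence to square roots and logarithms *)

Section RealBounds.
Variable R : realType.

Definition root_bound (a : nat) : nat := Num.truncn (2 * Num.sqrt a%:R : R).

Definition order_bound (a : nat) : nat := Num.truncn (84 * Num.sqrt a%:R : R).

(** The factor 2 makes up for rounding down: 2y - 1 >= y for y >= 1. *)
Lemma root_boundP a : (a <= root_bound a * root_bound a)%N.
Proof.
case: a => [//|a]; have := truncnS_gt (2 * Num.sqrt a.+1%:R : R).
rewrite -/(root_bound a.+1); set q := root_bound _; set y := Num.sqrt _ => hq.
have y1 : 1 <= y by rewrite -[leLHS]sqrtr1 ler_sqrt // ler1n.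
have yq : y <= q%:R by move: hq; rewrite -natr1; lra.
rewrite -(ler_nat R) natrM -[leLHS]sqr_sqrtr ?ler0n // -/y expr2.
by apply: ler_pM => //; lra.
Qed.

(** The first summand is at most 20 sqrt a + 1 <= 21 sqrt a, and sqrt (a / 2) <= 3/4 sqrt a. The
    constant 84 solves 21 + 3/4 x = x. *)
Lemma order_bound_rec a b : (0 < a -> 2 * b <= a ->
  (10 * root_bound a + 1) + order_bound b <= order_bound a)%N.
Proof.
move=> a0 ba; rewrite truncn_ge_nat; last by rewrite mulr_ge0 ?sqrtr_ge0.
rewrite !(natrD, natrM).
have t1 : (root_bound a)%:R <= 2 * Num.sqrt a%:R :> R by rewrite truncn_le mulr_ge0 ?sqrtr_ge0.
have t2 : (order_bound b)%:R <= 84 * Num.sqrt b%:R :> R by rewrite truncn_le mulr_ge0 ?sqrtr_ge0.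
have a1 : 1 <= Num.sqrt a%:R :> R by rewrite -[leLHS]sqrtr1 ler_sqrt // ler1n.
have ba' : Num.sqrt b%:R <= 3 / 4 * Num.sqrt a%:R :> R.
  have -> : 3 / 4 * Num.sqrt a%:R = Num.sqrt ((3 / 4) ^+ 2 * a%:R) :> R.
    by rewrite sqrtrM ?sqr_ge0 // sqrtr_sqr ger0_norm //; lra.
  apply: ler_wsqrtr; move: ba; rewrite -(ler_nat R) natrM => ba.
  have : 0 <= b%:R :> R by []. lra.
by lra.
Qed.

Lemma order_bound_mono a b : (a <= b)%N -> (order_bound a <= order_bound b)%N.
Proof.
move=> ab; rewrite le_truncn // ler_pM2l // ler_wsqrtr ?ler_nat //.
Qed.

(** For n >= 2, the inequality 2n + 1 <= n^3 turns (2n + 1)^(2K) into n^(6K), and K <= 84 sqrt n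
    gives the exponent 504 = 6 * 84. *)
Lemma main_time_real n : (0 < n)%N ->
  (main_time n (order_bound n))%:R <= (40 * 240 * 3 ^+ 168) *
    2 `^ (504 / ln 2 * (Num.sqrt n%:R * ln n%:R)) * n.+1%:R ^+ 6 :> R.
Proof.
move=> n0; set K := order_bound n.
have K84 : K%:R <= 84 * Num.sqrt n%:R :> R by rewrite truncn_le mulr_ge0 ?sqrtr_ge0.
have n1 : 1 <= n%:R :> R by rewrite ler1n.
have ln0 : 0 <= ln n%:R :> R by rewrite ln_ge0.
set E := 2 `^ _; have eE : E = expR (504 * (Num.sqrt n%:R * ln n%:R)).
  rewrite /E /powR pnatr_eq0 /=; congr expR.
  have l2 : ln 2 != 0 :> R by rewrite gt_eqF // ln_gt0 // ltr1n.
  by field.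
have E1 : 1 <= E by rewrite eE -[leLHS]expR0 ler_expR mulr_ge0 ?ler0n // mulr_ge0 ?sqrtr_ge0.
have nE : n%:R ^+ (6 * K) <= E.
  rewrite -[n%:R]lnK ?posrE ?ltr0n // -expRM_natl eE ler_expR natrM.
  rewrite [504 * _](_ : _ = 6 * (84 * Num.sqrt n%:R) * ln n%:R); last by ring.
  by apply: ler_wpM2r => //; apply: ler_wpM2l.
have W : ((2 * n).+1%:R ^+ K) ^+ 2 <= 3 ^+ 168 * E.
  rewrite -exprM; have [n2|] := ltnP 1 n.
    apply: le_trans (_ : n%:R ^+ (6 * K) <= _).
      have -> : (6 * K = 3 * (K * 2))%N by lia.
      rewrite [leRHS]exprM; apply: lerXn2r; rewrite ?nnegrE ?exprn_ge0 //.
      by rewrite -natrX ler_nat; nia.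
    apply: le_trans nE _; apply: ler_peMl; first lra.
    by apply: exprn_ege1; rewrite ler1n.
  (* For n = 1 the logarithm vanishes; the constant factor 3^168 takes over, because K <= 84. *)
  rewrite leq_eqVlt ltnNge n0 orbF => /eqP en.
  have : K%:R <= 84 :> R by move: K84; rewrite en sqrtr1 mulr1.
  rewrite ler_nat => K84'; apply: le_trans (_ : 3 ^+ 168 <= _).
    rewrite en; apply: ler_weXn2l; first by rewrite ler1n.
    by lia.
  by apply: ler_peMr => //; apply: exprn_ge0.
have := main_time_le n K; rewrite -(ler_nat R) => /le_trans; apply.
rewrite 2!natrM [(40 * 240)%:R]natrM (natrX R n.+1 6) (natrX R (_ ^ K) 2) (natrX R (2 * n).+1 K).
have : 0 <= n.+1%:R ^+ 6 :> R by apply: exprn_ge0.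
move: (n.+1%:R ^+ 6) (3 ^+ 168) W => p D W p0.
rewrite -!mulrA [D * _]mulrA [D * E * _]mulrC.
do 2!(apply: ler_wpM2l; first exact: ler0n).
exact: ler_wpM2l.
Qed.

End RealBounds.

Theorem theorem9 (R : realType) :
  exists (P : program) (C c : R) (k : nat),
    forall (n : nat) (G : sgraph 'I_n) (r : nat),
      apex R G -> (1 <= r)%N ->
      exists t : nat,
        t%:R <= C * 2 `^ (c * (Num.sqrt n%:R * ln n%:R))
                  * (input_size (encode G r))%:R ^+ k
        /\ answers_within P (encode G r) t
             (has_small_strong_offensive_alliance G r).
Proof.
(* The input size exceeds [n], so its sixth power absorbs the factor (n + 1)^6. *)
exists (compile c_main 0), (40 * 240 * 3 ^+ 168), (504 / ln 2), 6%N => n G r ap _.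
have n0 : (0 < n)%N by have [v _] := ap; apply: leq_trans (ltn_ord v).
have sep (A : {set 'I_n}) : exists X : {set 'I_n},
    [/\ X \subset A, (#|X| <= 10 * root_bound R #|A| + 1)%N & halves G A (A :\: X)].
  have [X [XA cX half]] := apex_separator ap (root_boundP R #|A|).
  by exists X; split=> //; apply/'forall_implyP.
have [t [s [rn tb res]]] := c_mainP r n0 (@order_bound_rec R) (leqnn _)
  (@order_bound_mono R) sep (s := Store (fun=> 0%N) (fun _ _ => 0%N)) (fun=> erefl)
  (fun _ _ => erefl).
exists t; split; last exact: answers_main rn res.
apply: le_trans (_ : (main_time n (order_bound R n))%:R <= _); first by rewrite ler_nat.
apply: le_trans (main_time_real R n0) _; apply: ler_wpM2l.
  apply: mulr_ge0; last exact: powR_ge0.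
  by rewrite mulr_ge0 ?exprn_ge0 ?ler0n // mulr_ge0 ?ler0n.
by apply: lerXn2r; rewrite ?nnegrE // ler_nat lt_input_size_encode.
Qed.
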